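(* Let $n\ge1$, $\tau>0$, and let $\{\xi(t),t\in\mathbb R\}$ be a random process with stationary $n$th increments $\xi^{(n)}(t,\tau)$ whose spectral function $F$ is absolutely continuous with spectral density $f(\lambda)$ admitting the canonical factorization $f=|\Phi|^2$. Let $a:[0,\infty)\to\mathbb C$ be such that $\int_0^\infty|\mathbf D^\tau a(t)|dt<\infty$ and $\int_0^\infty t|\mathbf D^\tau a(t)|^2dt<\infty$. Then the optimal linear estimate $\widehat A\xi$ of the functional $A\xi=\int_0^\infty a(t)\xi(t)dt$ from observations of $\xi(t)$ for $t<0$ is $$\widehat A\xi=-\int_{-\tau n}^0v_\tau(t)\xi(t)dt+\int_{-\infty}^\infty h_\tau^{(a)}(\lambda)(1-e^{-i\lambda\tau})^n\frac{(1+i\lambda)^n}{(i\lambda)^n}dZ(\lambda),$$ with spectral characteristic $$h^{(a)}_\tau(\lambda)=A_\tau(\lambda)-r^{(a)}_\tau(\lambda)\Phi_\tau^{-1}(\lambda),\quad A_\tau(\lambda)=\int_0^\infty\mathbf D^\tau a(t)e^{i\lambda t}dt,\quad r_\tau^{(a)}(\lambda)=\int_0^\infty(\mathbf D^\tau\mathbf A\varphi_\tau)(t)e^{i\lambda t}dt,$$ and the mean square error is $$\Delta(f,\widehat A\xi)=\mathsf E|A\xi-\widehat A\xi|^2=\frac1{2\pi}\int_{-\infty}^\infty|r_\tau^{(a)}(\lambda)|^2d\lambda=\|\mathbf D^\tau\mathbf A\varphi_\tau\|^2,$$ where $\|\cdot\|$ is the norm of $L_2([0,\infty))$.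
   Context: All random variables belong to $L_2(\Omega,\mathcal F,\mathsf P)$. The $n$th increment of $\xi$ with step $\tau>0$ is $\xi^{(n)}(t,\tau)=\sum_{l=0}^n(-1)^l\binom nl\xi(t-l\tau)$. The process has stationary $n$th increments if $\mathsf E\xi^{(n)}(t_0,\tau)$ and $\mathsf E\xi^{(n)}(t_0+t,\tau_1)\overline{\xi^{(n)}(t_0,\tau_2)}$ exist and do not depend on $t_0$; the mean of the increments is assumed to be $0$. Spectral representation: $\xi^{(n)}(t,\tau)=\int_{-\infty}^\infty e^{it\lambda}\chi_\tau(\lambda)\,dZ(\lambda)$, $\chi_\tau(\lambda)=(1-e^{-i\lambda\tau})^n\frac{(1+i\lambda)^n}{(i\lambda)^n}$, where $Z$ is an orthogonal random measure with $\mathsf EZ(A_1)\overline{Z(A_2)}=F(A_1\cap A_2)$, $F$ being a finite measure on $\mathbb R$ (the spectral function). The spectral density $f$ is normalized by $dF(\lambda)=\frac1{2\pi}f(\lambda)\,d\lambda$. $H^t(\xi^{(n)})$ is the closed linear span in $L_2(\Omega)$ of $\{\xi^{(n)}(u,\sigma):u\le t,\sigma>0\}$. ''$f$ admits the canonical factorization'' means: there is a process $\eta$ with orthogonal increments, $\mathsf E|\eta(t)-\eta(s)|^2=|t-s|$, such that $H^z(\xi^{(n)})=H^z(\eta)$ for all $z\in\mathbb R$ ($H^z(\eta)$ is the closed span of the increments of $\eta$ on $(-\infty,z]$), and functions $\varphi_\sigma\in L_2([0,\infty))$, $\sigma>0$, and $\varphi\in L_2([0,\infty))$ such that $\xi^{(n)}(t,\sigma)=\int_{-\infty}^t\varphi_\sigma(t-s)\,d\eta(s)$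 (one-sided moving average representation), $f(\lambda)=|\Phi(\lambda)|^2$, $\Phi(\lambda)=\int_0^\infty e^{-i\lambda t}\varphi(t)dt$, and $\Phi_\sigma(\lambda):=\int_0^\infty e^{-i\lambda t}\varphi_\sigma(t)dt=\chi_\sigma(\lambda)\Phi(\lambda)$. Notation: $d(k)$, $k\ge0$, are defined by $\sum_{k\ge0}d(k)x^k=\big(\sum_{j\ge0}x^j\big)^n$; $\mathbf D^\tau x(t)=\sum_{k=0}^\infty x(t+\tau k)d(k)$; $b_\tau(t)=\mathbf D^\tau a(t)$, $t\ge0$; $v_\tau(t)=\sum_{l=\lceil -t/\tau\rceil}^n(-1)^l\binom nl b_\tau(t+l\tau)$, $t\in[-\tau n,0)$. $\mathbf A$ is the operator $(\mathbf A\psi)(t)=\int_0^\infty a(t+u)\psi(u)du$, and $(\mathbf D^\tau\mathbf A\psi)(t)=\int_0^\infty(\mathbf D^\tau a)(t+u)\psi(u)\,du$. The functional $A\xi$ is understood through its representation $A\xi=B\xi-V\xi$, $B\xi=\int_0^\infty b_\tau(t)\xi^{(n)}(t,\tau)dt$, $V\xi=\int_{-\tau n}^0v_\tau(t)\xi(t)dt$. Since $V\xi$ depends only on observed values, the optimal linear estimate is $\widehat A\xi=\widehat B\xi-V\xi$, where $\widehat B\xi$ is the orthogonal projection of $B\xi$ on the closed subspace generated by the increments $\xi^{(n)}(u,\sigma)$, $u<0$, $\sigma>0$. *)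

(* Defs.v *)
From HB Require Import structures.
From mathcomp Require Import all_boot all_order all_algebra.
From mathcomp Require Import complex.
From mathcomp Require Import all_classical all_reals all_analysis.

Set Implicit Arguments.
Unset Strict Implicit.
Unset Printing Implicit Defensive.

Import Order.TTheory GRing.Theory Num.Theory.
Import numFieldNormedType.Exports.

Local Open Scope classical_set_scope.
Local Open Scope ring_scope.

Notation cRe := complex.Re.
Notation cIm := complex.Im.
Notation cmod := ComplexField.Normc.normc.
Notation leb R := (@lebesgue_measure R).

Section ComplexIntegration.
Context {R : realType} {d : measure_display} {T : measurableType d}.
Implicit Types (mu : {measure set T -> \bar R}) (D : set T) (g : T -> R[i]).

Definition cmeasurable D g : Prop :=
  measurable_fun D (fun x => cRe (g x)) /\
  measurable_fun D (fun x => cIm (g x)).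

Definition cintegrable mu D g : Prop :=
  cmeasurable D g /\ (\int[mu]_(x in D) (cmod (g x))%:E < +oo)%E.

Definition cintegral mu D g : R[i] :=
  Complex (Rintegral mu D (fun x => cRe (g x)))
          (Rintegral mu D (fun x => cIm (g x))).

Definition sqnorm mu D g : \bar R :=
  (\int[mu]_(x in D) (cmod (g x) ^+ 2)%:E)%E.

Definition L2 mu D g : Prop := cmeasurable D g /\ (sqnorm mu D g < +oo)%E.

End ComplexIntegration.

Section RandomVariables.
Context {R : realType} {d : measure_display} {T : measurableType d}.
Implicit Types (P : probability T R) (X Y I : T -> R[i]).

Definition cE P X : R[i] := cintegral P setT X.

Definition inner P X Y : R[i] := cE P (fun w => X w * conjc (Y w)).

Definition closed_span P (S : set (T -> R[i])) : set (T -> R[i]) :=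
  [set X | L2 P setT X /\
    forall e : R, 0 < e ->
      exists (m : nat) (c : 'I_m -> R[i]) (Y : 'I_m -> T -> R[i]),
        (forall i, S (Y i)) /\
        (sqnorm P setT (fun w => X w - \sum_(i < m) c i * Y i w)%R < e%:E)%E].

Definition is_projection P (H : set (T -> R[i])) X Y : Prop :=
  H Y /\ forall U, H U -> inner P (fun w => X w - Y w) U = 0.

(* [I] is the integral over [D] of [g t * X t] as an element of L_2(Omega), in
   the weak (Pettis) sense, which determines [I] almost surely.  Bochner
   integrals in L_2(Omega) are instances, and so are, for jointly measurable
   processes whose norm in L_2(Omega) is integrable against |g|, integrals taken
   path by path. *)
Definition is_ms_integral P (D : set R) (g : R -> R[i]) (X : R -> T -> R[i]) I
    : Prop :=
  L2 P setT I /\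
  forall Y, L2 P setT Y ->
    cintegrable (leb R) D (fun t => g t * inner P (X t) Y) /\
    inner P I Y = cintegral (leb R) D (fun t => g t * inner P (X t) Y).

(* Countable additivity of [Z] in mean square follows from the covariance
   identity. *)
Definition orthogonal_random_measure P
    (F : {finite_measure set (measurableTypeR R) -> \bar R})
    (Z : set R -> T -> R[i]) : Prop :=
  (forall A : set (measurableTypeR R), measurable A -> L2 P setT (Z A)) /\
  forall A1 A2 : set (measurableTypeR R), measurable A1 -> measurable A2 ->
    inner P (Z A1) (Z A2) = (fine (F (A1 `&` A2)))%:C%C.

(* [I] is the stochastic integral of [g] in L_2(F) with respect to [Z]: the
   mean-square limit of integrals of simple functions tending to [g]. *)
Definition is_Z_integral P
    (F : {finite_measure set (measurableTypeR R) -> \bar R})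
    (Z : set R -> T -> R[i]) (g : R -> R[i]) I : Prop :=
  [/\ L2 F setT g, L2 P setT I &
    forall e : R, 0 < e ->
      exists (m : nat) (c : 'I_m -> R[i])
             (A : 'I_m -> set (measurableTypeR R)),
        [/\ forall i, measurable (A i),
            (sqnorm F setT
              (fun x => g x - \sum_(i < m) c i * (\1_(A i) x : R)%:C%C)%R
               < e%:E)%E &
            (sqnorm P setT (fun w => I w - \sum_(i < m) c i * Z (A i) w)%R
               < e%:E)%E]].

Definition orthogonal_increments P (eta : R -> T -> R[i]) : Prop :=
  [/\ forall t, L2 P setT (eta t),
      forall s1 t1 s2 t2, s1 <= t1 -> t1 <= s2 -> s2 <= t2 ->
        inner P (fun w => eta t1 w - eta s1 w)
                (fun w => eta t2 w - eta s2 w) = 0 &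
      forall s t, sqnorm P setT (fun w => eta t w - eta s w) = `|t - s|%:E].

(* [I] is the integral over the line of [g] in L_2(R) against [d eta]: the
   mean-square limit of integrals of step functions tending to [g]. *)
Definition is_eta_integral P (eta : R -> T -> R[i]) (g : R -> R[i]) I : Prop :=
  [/\ L2 (leb R) setT g, L2 P setT I &
    forall e : R, 0 < e ->
      exists (m : nat) (c : 'I_m -> R[i]) (u v : 'I_m -> R),
        [/\ forall i, u i <= v i,
            (sqnorm (leb R) setT
              (fun s => g s
                 - \sum_(i < m) c i * (\1_(`]u i, v i]%classic) s : R)%:C%C)%R
               < e%:E)%E &
            (sqnorm P setT
              (fun w => I w
                 - \sum_(i < m) c i * (eta (v i) w - eta (u i) w))%R
               < e%:E)%E]].

End RandomVariables.

Section Fourier.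
Context {R : realType}.

(* [cexp x] is e^{ix}. *)
Definition cexp (x : R) : R[i] := Complex (cos x) (sin x).

Definition halfline : set R := `[0, +oo[%classic.

(* [G] is (a version of) the Fourier transform of [g] in L_2([0, oo)),
   G(lambda) = int_0^oo e^{i s lambda t} g(t) dt, with s = 1 or s = -1: as [g]
   need not be integrable, the integral is the limit in L_2(R) of the integrals
   over [0, N]. *)
Definition is_fourier (s : R) (g G : R -> R[i]) : Prop :=
  [/\ L2 (leb R) halfline g, L2 (leb R) setT G &
    (fun N : nat => sqnorm (leb R) setT (fun x : R =>
        G x - cintegral (leb R) `[0, N%:R]%classic
                (fun t : R => cexp (s * x * t) * g t)))
      @ \oo --> (0 : \bar R)%E].

(* Here [g] is integrable on [0, oo). *)
Definition fourier_L1 (g : R -> R[i]) (x : R) : R[i] :=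
  cintegral (leb R) halfline (fun t : R => cexp (x * t) * g t).

End Fourier.

Section Increments.
Context {R : realType}.

(* The coefficient of x^k in (1 + x + x^2 + ...)^n; truncating the geometric
   series after x^k does not change it. *)
Definition dcoef (n k : nat) : nat :=
  (((\poly_(j < k.+1) 1%N : {poly nat}) ^+ n)`_k)%R.

Definition Dpartial (n : nat) (tau : R) (x : R -> R[i]) (t : R) (N : nat)
    : R[i] :=
  \sum_(k < N) x (t + tau * k%:R) * (dcoef n k)%:R.

Definition Dconverges (n : nat) (tau : R) (x : R -> R[i]) (t : R) : Prop :=
  cvgn (fun N => cRe (Dpartial n tau x t N) : R) /\
  cvgn (fun N => cIm (Dpartial n tau x t N) : R).

Definition Dop (n : nat) (tau : R) (x : R -> R[i]) (t : R) : R[i] :=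
  Complex (limn (fun N => cRe (Dpartial n tau x t N) : R))
          (limn (fun N => cIm (Dpartial n tau x t N) : R)).

Definition vfun (n : nat) (tau : R) (b : R -> R[i]) (t : R) : R[i] :=
  \sum_(l < n.+1 | (Num.ceil (- t / tau) <= l%:Z)%R)
    (-1) ^+ l * 'C(n, l)%:R * b (t + l%:R * tau).

(* (A psi)(t) = int_0^oo a(t + u) psi(u) du; the operator D^tau A is
   [opA (Dop n tau a)]. *)
Definition opA (a psi : R -> R[i]) (t : R) : R[i] :=
  cintegral (leb R) halfline (fun u : R => a (t + u) * psi u).

(* At lambda = 0 the formula has a removable singularity, where division by 0
   makes it 0; this is harmless as the spectral measure is absolutely
   continuous. *)
Definition chi (n : nat) (tau x : R) : R[i] :=
  (1 - cexp (- (x * tau))) ^+ n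
  * ((1 + Complex 0 x) ^+ n / (Complex 0 x) ^+ n).

Context {d : measure_display} {T : measurableType d}.
Implicit Types (P : probability T R) (xi : R -> T -> R[i]).

Definition incr (n : nat) xi (t tau : R) (w : T) : R[i] :=
  \sum_(l < n.+1) (-1) ^+ l * 'C(n, l)%:R * xi (t - l%:R * tau) w.

Definition stationary_increments P (n : nat) xi : Prop :=
  (forall t0 t1 tau, 0 < tau ->
     cE P (incr n xi t0 tau) = cE P (incr n xi t1 tau)) /\
  (forall t0 t1 t tau1 tau2, 0 < tau1 -> 0 < tau2 ->
     inner P (incr n xi (t0 + t) tau1) (incr n xi t0 tau2) =
     inner P (incr n xi (t1 + t) tau1) (incr n xi t1 tau2)).

Definition spectral_representation P (n : nat) xi
    (F : {finite_measure set (measurableTypeR R) -> \bar R})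
    (Z : set R -> T -> R[i]) : Prop :=
  orthogonal_random_measure P F Z /\
  forall t tau, 0 < tau ->
    is_Z_integral P F Z (fun x => cexp (t * x) * chi n tau x)
      (incr n xi t tau).

(* dF = f dlambda / (2 pi) *)
Definition spectral_density
    (F : {finite_measure set (measurableTypeR R) -> \bar R}) (f : R -> R)
    : Prop :=
  [/\ measurable_fun setT f, forall x, 0 <= f x &
      forall A : set (measurableTypeR R), measurable A ->
        F A = (\int[leb R]_(x in A) (f x / (2 * pi))%:E)%E].

Definition H_incr P (n : nat) xi (z : R) : set (T -> R[i]) :=
  closed_span P
    [set X | exists u s : R, [/\ u <= z, 0 < s & X = incr n xi u s]].

(* The span of the increments observed strictly before time 0. *)
Definition H_obs P (n : nat) xi : set (T -> R[i]) :=
  closed_span P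
    [set X | exists u s : R, [/\ u < 0, 0 < s & X = incr n xi u s]].

Definition H_eta P (eta : R -> T -> R[i]) (z : R) : set (T -> R[i]) :=
  closed_span P
    [set X | exists s t : R,
      [/\ s <= t, t <= z & X = (fun w => eta t w - eta s w)]].

(* Equalities between L_2 Fourier transforms hold almost everywhere. *)
Record canonical_factorization P (n : nat) xi (f : R -> R)
    (eta : R -> T -> R[i]) (phi_ : R -> R -> R[i]) (phi : R -> R[i])
    (Phi_ : R -> R -> R[i]) (Phi : R -> R[i]) : Prop := CanonicalFactorization {
  cf_orthogonal : orthogonal_increments P eta ;
  cf_span : forall z, H_incr P n xi z = H_eta P eta z ;
  cf_moving_average : forall t s, 0 < s ->
    is_eta_integral P eta (fun u => if u <= t then phi_ s (t - u) else 0)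
      (incr n xi t s) ;
  cf_Phi : is_fourier (-1) phi Phi ;
  cf_Phi_ : forall s, 0 < s -> is_fourier (-1) (phi_ s) (Phi_ s) ;
  cf_density : {ae leb R, forall x, f x = cmod (Phi x) ^+ 2} ;
  cf_chi : forall s, 0 < s ->
    {ae leb R, forall x, Phi_ s x = chi n s x * Phi x} }.

(* The functional being B xi - V xi with V xi observed, its optimal linear
   estimate is the projection of B xi minus V xi. *)
Definition is_optimal_estimate P (n : nat) xi (Bxi Vxi Ahat : T -> R[i])
    : Prop :=
  exists Bhat, is_projection P (H_obs P n xi) Bxi Bhat /\
    Ahat = (fun w => Bhat w - Vxi w).

End Increments.

(* Main.v *)
Require Import Defs.
From HB Require Import structures.
From mathcomp Require Import all_boot all_order all_algebra.
From mathcomp Require Import complex.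
From mathcomp Require Import all_classical all_reals all_analysis.
From mathcomp Require Import measurable_realfun ring lra zify.
Import Order.TTheory GRing.Theory Num.Theory.
Import numFieldNormedType.Exports.
Set Implicit Arguments.
Unset Strict Implicit.
Unset Printing Implicit Defensive.
Local Open Scope classical_set_scope.
Local Open Scope ring_scope.

(* The increments generate unitarily equivalent subspaces of L_2(Omega), of
   L_2(F) (spectral domain, through Z) and of L_2(R) (time domain, through eta):
   xi^(n)(t, s) corresponds to e^{it.} chi_s and to phi_s(t - .).
   Multiplication by Phi carries the spectral to the time domain up to the
   Fourier transform, a fact first checked for generators, tested against
   indicators of intervals, and then extended by density, which gives in
   particular the Plancherel formula used here.  Since
   H^z(xi^(n)) = H^z(eta), the error B xi - Bhat xi, being orthogonal to
   everything observed before 0, is represented in the time domain by a function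
   vanishing on (-oo, 0); testing it against increments of eta after 0, which
   are orthogonal to Bhat xi, identifies it with D^tau A phi_tau on [0, oo).  Its
   Fourier transform is r = mu Phi, where mu represents the error in the spectral
   domain, so that Bhat xi is represented there by
   A_tau chi_tau - mu = (A_tau - r / Phi_tau) chi_tau. *)

(** No Fourier transform on L_2(R) is presupposed. Its isometry is read off from covariances:
    xi^(n)(t, s) has the same inner products in both domains, and dF = |Phi|^2 dlambda / (2 pi). To
    reach all of L_2(R), the functions phi_s(t - .) must be total there; H^z(xi^(n)) = H^z(eta)
    ensures it by putting the indicators of intervals in their closed span. Isometries are handled
    as closures of graphs in product spaces, which treats extension by density and simultaneous
    approximation in several spaces alike. The observed space is generated by times u < 0, but H^z
    by times u <= z. The gap at 0 is harmless: increments of eta over intervals ending before 0 lie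
    in the observed space, which itself lies in H^0, and the point 0 is Lebesgue-null. The weak
    integral B xi is known only through its inner products, so it has to be shown to lie in the
    closed span of the increments before it can be represented in either domain. Division by Phi_tau
    = chi_tau Phi makes sense F-almost everywhere: F does not charge the zeros of Phi, and chi_tau
    has countably many zeros. *)

(** * Hilbert spaces and closed spans *)

(* A Hilbert space carried by a subset of a vector space, with a form that is
   only semidefinite: elements of L_2 are thus functions, not classes, and
   equality almost everywhere is the vanishing of [nrm] on the difference.
   Completeness is required of rapidly converging sequences only. *)
Record hspace (R : realType) (V : lmodType R[i]) := HSpace {
  hdom : set V;
  hip : V -> V -> R[i];
  hdom0 : hdom 0;
  hdom_comb : forall a x y, hdom x -> hdom y -> hdom (a *: x + y);
  hip_comb : forall a x y z, hdom x -> hdom y -> hdom z ->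
    hip (a *: x + y) z = a * hip x z + hip y z;
  hip_conj : forall x y, hdom x -> hdom y -> hip y x = ((hip x y)^*)%C;
  hip_ge0 : forall x, hdom x -> 0 <= cRe (hip x x);
  hcomplete : forall u : nat -> V, (forall k, hdom (u k)) ->
    (forall k, cRe (hip (u k.+1 - u k) (u k.+1 - u k)) <= 16^-1 ^+ k) ->
    exists2 x, hdom x & forall e : R, 0 < e -> exists N, forall k, (N <= k)%N ->
      cRe (hip (x - u k) (x - u k)) < e }.

Section ComplexFacts.
Context {R : realType}.
Implicit Types (x y z : R[i]).

Lemma cmodE z : cmod z ^+ 2 = cRe z ^+ 2 + cIm z ^+ 2.
Proof. by case: z => a b /=; rewrite sqr_sqrtr // addr_ge0 // sqr_ge0. Qed.

Lemma cmod_ge0 z : 0 <= cmod z.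
Proof. by case: z => a b /=; exact: sqrtr_ge0. Qed.

Lemma ReD x y : cRe (x + y) = cRe x + cRe y. Proof. by case: x y => ? ? [? ?]. Qed.

Lemma ImD x y : cIm (x + y) = cIm x + cIm y. Proof. by case: x y => ? ? [? ?]. Qed.

Lemma ReN x : cRe (- x) = - cRe x. Proof. by case: x. Qed.

Lemma ImN x : cIm (- x) = - cIm x. Proof. by case: x. Qed.

Lemma ReM x y : cRe (x * y) = cRe x * cRe y - cIm x * cIm y.
Proof. by case: x y => ? ? [? ?]. Qed.

Lemma ImM x y : cIm (x * y) = cRe x * cIm y + cIm x * cRe y.
Proof. by case: x y => ? ? [? ?]. Qed.

Lemma ReJ x : cRe (x^*)%C = cRe x. Proof. by case: x. Qed.

Lemma ImJ x : cIm (x^*)%C = - cIm x. Proof. by case: x. Qed.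
Definition ReImE := (ReD, ImD, ReN, ImN, ReM, ImM, ReJ, ImJ).

Lemma ReImP x y : cRe x = cRe y -> cIm x = cIm y -> x = y.
Proof. by case: x y => ? ? [? ?] /= -> ->. Qed.

Lemma cmod_eq0 z : cmod z ^+ 2 <= 0 -> z = 0.
Proof.
move=> h; apply: ComplexField.Normc.eq0_normc; apply/eqP.
by rewrite -sqrf_eq0 eq_le h sqr_ge0.
Qed.

(** Turns approximation estimates into vanishing. As [K] may be zero or negative, e is taken to be a
    / 2 / (|K| + 1), which would give a <= a / 2. *)
Lemma le_small (K a : R) : (forall e, 0 < e -> a <= K * e) -> a <= 0.
Proof.
move=> h; rewrite leNgt; apply/negP => a0.
have K1 : 0 < `|K| + 1 by rewrite ltr_wpDl.
have := h (a / 2 / (`|K| + 1)) _; rewrite divr_gt0 ?divr_gt0// => /(_ isT).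
rewrite leNgt => /negP; apply.
have : K * (a / 2 / (`|K| + 1)) <= (`|K| + 1) * (a / 2 / (`|K| + 1)).
  rewrite ler_wpM2r // ?ltW ?divr_gt0 ?divr_gt0 //.
  by rewrite (le_lt_trans (ler_norm K)) // ltrDl.
by move=> /le_lt_trans; apply; rewrite mulrC divfK ?gt_eqF //; lra.
Qed.

End ComplexFacts.

Section HilbertTheory.
Context {R : realType} {V : lmodType R[i]} (H : hspace V).
Implicit Types (x y z u : V) (a : R[i]) (S : set V).
Let D := hdom H.
Let ip := hip H.

(* The square of the norm. *)
Definition nrm x : R := cRe (ip x x).

Lemma domZ a x : D x -> D (a *: x).
Proof. by move=> dx; rewrite -[a *: x]addr0; apply: hdom_comb => //; exact: hdom0. Qed.

Lemma domD x y : D x -> D y -> D (x + y).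
Proof. by move=> dx dy; rewrite -[x]scale1r; exact: hdom_comb. Qed.

Lemma domN x : D x -> D (- x).
Proof. by move=> dx; rewrite -scaleN1r; exact: domZ. Qed.

Lemma domB x y : D x -> D y -> D (x - y).
Proof. by move=> dx dy; apply: domD => //; exact: domN. Qed.

Lemma ip0l z : D z -> ip 0 z = 0.
Proof.
move=> dz; have d0 := hdom0 H.
have := hip_comb 1 d0 d0 dz; rewrite scaler0 add0r mul1r => /eqP.
by rewrite -subr_eq0 opprD addrA subrr sub0r oppr_eq0 => /eqP.
Qed.

Lemma ipZl a x z : D x -> D z -> ip (a *: x) z = a * ip x z.
Proof.
move=> dx dz; rewrite -[a *: x]addr0 /ip hip_comb //; last exact: hdom0.
by rewrite -/ip ip0l // addr0.
Qed.

Lemma ipDl x y z : D x -> D y -> D z -> ip (x + y) z = ip x z + ip y z.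
Proof. by move=> dx dy dz; rewrite -{1}[x]scale1r /ip hip_comb // mul1r. Qed.

Lemma ipNl x z : D x -> D z -> ip (- x) z = - ip x z.
Proof. by move=> dx dz; rewrite -scaleN1r ipZl // mulN1r. Qed.

Lemma ipBl x y z : D x -> D y -> D z -> ip (x - y) z = ip x z - ip y z.
Proof. by move=> dx dy dz; rewrite ipDl ?ipNl //; exact: domN. Qed.

Lemma ipC x y : D x -> D y -> ip y x = ((ip x y)^*)%C.
Proof. exact: hip_conj. Qed.

Lemma ipDr x y z : D x -> D y -> D z -> ip z (x + y) = ip z x + ip z y.
Proof.
move=> dx dy dz; rewrite (ipC (domD dx dy) dz) ipDl // rmorphD /=.
by rewrite -(ipC dx dz) -(ipC dy dz).
Qed.

Lemma ipZr a x z : D x -> D z -> ip z (a *: x) = (a^*)%C * ip z x.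
Proof.
by move=> dx dz; rewrite (ipC (domZ a dx) dz) ipZl // rmorphM /= -(ipC dx dz).
Qed.

Lemma ipNr x z : D x -> D z -> ip z (- x) = - ip z x.
Proof.
by move=> dx dz; rewrite (ipC (domN dx) dz) ipNl // rmorphN /= -(ipC dx dz).
Qed.

Lemma ipBr x y z : D x -> D y -> D z -> ip z (x - y) = ip z x - ip z y.
Proof.
move=> dx dy dz; rewrite (ipC (domB dx dy) dz) ipBl // rmorphB /=.
by rewrite -(ipC dx dz) -(ipC dy dz).
Qed.

Lemma ip0r z : D z -> ip z 0 = 0.
Proof. by move=> dz; rewrite ipC ?ip0l ?rmorph0 //; exact: hdom0. Qed.

Lemma ip_Im x : D x -> cIm (ip x x) = 0.
Proof. by move=> dx; have := congr1 (@cIm R) (ipC dx dx); rewrite ImJ; lra. Qed.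

Lemma nrm_ge0 x : D x -> 0 <= nrm x.
Proof. exact: hip_ge0. Qed.

Lemma nrm0 : nrm 0 = 0.
Proof. by rewrite /nrm ip0l //; exact: hdom0. Qed.

Lemma nrmZ a x : D x -> nrm (a *: x) = cmod a ^+ 2 * nrm x.
Proof.
move=> dx; rewrite /nrm ipZl ?ipZr //; last exact: domZ.
by rewrite !ReImE ip_Im // cmodE; ring.
Qed.

Lemma nrmN x : D x -> nrm (- x) = nrm x.
Proof.
by move=> dx; rewrite -scaleN1r nrmZ // cmodE /= oppr0 expr0n addr0 sqrrN expr1n mul1r.
Qed.

Lemma nrmBC x y : D x -> D y -> nrm (x - y) = nrm (y - x).
Proof. by move=> dx dy; rewrite -nrmN ?opprB //; exact: domB. Qed.

Lemma nrmD_exp x y : D x -> D y ->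
  nrm (x + y) = nrm x + nrm y + 2 * cRe (ip x y).
Proof.
move=> dx dy; have dxy := domD dx dy.
by rewrite /nrm ipDl ?ipDr // (ipC dx dy) !ReImE; ring.
Qed.

Lemma nrmB_exp x y : D x -> D y ->
  nrm (x - y) = nrm x + nrm y - 2 * cRe (ip x y).
Proof.
move=> dx dy; rewrite nrmD_exp ?nrmN ?ipNr ?ReImE //; last exact: domN.
by ring.
Qed.

Lemma nrmD_le x y : D x -> D y -> nrm (x + y) <= 2 * nrm x + 2 * nrm y.
Proof.
move=> dx dy; have := nrm_ge0 (domB dx dy).
by rewrite nrmB_exp // nrmD_exp //; lra.
Qed.

Lemma nrm_mid x y z : D x -> D y -> D z ->
  nrm (x - z) <= 2 * nrm (x - y) + 2 * nrm (y - z).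
Proof.
move=> dx dy dz; have := nrmD_le (domB dx dy) (domB dy dz).
by rewrite addrA subrK.
Qed.

(** Since the form is only semidefinite, [nrm y = 0] does not give y = 0. In that case the bound
    [key] is affine in s, and a large s forces <x, y> = 0. *)
Lemma cauchy_schwarz x y : D x -> D y -> cmod (ip x y) ^+ 2 <= nrm x * nrm y.
Proof.
move=> dx dy.
(* Expansion of the square of x - s <x, y> y; with the factor <x, y> included, a real parameter s
   suffices. *)
have key (s : R) : 0 <= nrm x - 2 * s * cmod (ip x y) ^+ 2
    + s ^+ 2 * cmod (ip x y) ^+ 2 * nrm y.
  pose c : R[i] := s%:C%C * ip x y.
  have := nrm_ge0 (domB dx (domZ c dy)).
  rewrite nrmB_exp ?nrmZ ?ipZr //; last exact: domZ.
  rewrite !cmodE !ReImE /= => h; apply: le_trans h _.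
  by rewrite le_eqVlt; apply/orP; left; apply/eqP; ring.
set m := cmod _ ^+ 2 in key *.
have m0 : 0 <= m by exact: sqr_ge0.
have [y0|y0] := eqVneq (nrm y) 0.
  rewrite y0 mulr0 leNgt; apply/negP => mp.
  have := key ((nrm x + 1) / (2 * m)); rewrite y0 mulr0 addr0.
  have -> : 2 * ((nrm x + 1) / (2 * m)) * m = nrm x + 1.
    by field; rewrite gt_eqF.
  by lra.
have yp : 0 < nrm y by rewrite lt_neqAle eq_sym y0 nrm_ge0.
have := key (nrm y)^-1.
have -> : nrm x - 2 * (nrm y)^-1 * m + (nrm y)^-1 ^+ 2 * m * nrm y
   = nrm x - m / nrm y by field.
by rewrite subr_ge0 ler_pdivrMr.
Qed.

Lemma nrm0_ip0 x y : D x -> D y -> nrm x = 0 -> ip x y = 0.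
Proof.
move=> dx dy x0; apply: cmod_eq0.
by apply: le_trans (cauchy_schwarz dx dy) _; rewrite x0 mul0r.
Qed.

Definition lin S : set V := [set x | exists (m : nat) (c : 'I_m -> R[i]) (Y : 'I_m -> V),
  (forall i, S (Y i)) /\ x = \sum_(i < m) c i *: Y i].

Lemma lin0 S : lin S 0.
Proof.
exists 0%N, (fun _ => 0), (fun _ => 0); split; first by case.
by rewrite big_ord0.
Qed.

Lemma linD S x y : lin S x -> lin S y -> lin S (x + y).
Proof.
move=> [m [c [Y [SY ->]]]] [m' [c' [Y' [SY' ->]]]].
exists (m + m')%N, (fun i => match fintype.split i with inl j => c j | inr j => c' j end),
  (fun i => match fintype.split i with inl j => Y j | inr j => Y' j end); split.
  by move=> i; case: fintype.splitP => j _.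
rewrite big_split_ord /=; congr (_ + _); apply: eq_bigr => i _.
  by rewrite (unsplitK (inl i)).
by rewrite (unsplitK (inr i)).
Qed.

Lemma linZ S a x : lin S x -> lin S (a *: x).
Proof.
move=> [m [c [Y [SY ->]]]]; exists m, (fun i => a * c i), Y; split=> //.
by rewrite scaler_sumr; apply: eq_bigr => i _; rewrite scalerA.
Qed.

Lemma lin_sub S x : S x -> lin S x.
Proof.
move=> Sx; exists 1%N, (fun _ => 1), (fun _ => x); split => //.
by rewrite big_ord1 scale1r.
Qed.

Lemma lin_min S (G : set V) : G 0 -> (forall a x y, G x -> G y -> G (a *: x + y)) ->
  S `<=` G -> lin S `<=` G.
Proof.
move=> G0 GD SG x [m [c [Y [SY ->]]]].
by apply: big_rec => // i y _ Gy; apply: GD => //; exact: SG.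
Qed.

Lemma lin_dom S : S `<=` D -> lin S `<=` D.
Proof. by move=> SD; apply: lin_min => //; [exact: hdom0|exact: hdom_comb]. Qed.

Definition clos S : set V := [set x | D x /\
  forall e : R, 0 < e -> exists2 y, lin S y & nrm (x - y) < e].

Lemma clos_dom S : clos S `<=` D. Proof. by move=> x []. Qed.

Lemma clos_lin S : S `<=` D -> lin S `<=` clos S.
Proof.
move=> SD x lx; split; first exact: (lin_dom SD).
by move=> e e0; exists x => //; rewrite subrr nrm0.
Qed.

Lemma clos_sub S : S `<=` D -> S `<=` clos S.
Proof. by move=> SD x Sx; apply: clos_lin => //; exact: lin_sub. Qed.

Lemma clos_comb S a x y : S `<=` D -> clos S x -> clos S y -> clos S (a *: x + y).
Proof.
move=> SD [dx cx] [dy cy]; split; first exact: hdom_comb.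
move=> e e0.
have a1 : 0 < cmod a ^+ 2 + 1 by rewrite ltr_wpDl ?sqr_ge0.
have e4 : 0 < e / 4 by lra.
have [x' lx' hx'] := cx _ (divr_gt0 e4 a1).
have [y' ly' hy'] := cy _ e4.
exists (a *: x' + y'); first by apply: linD => //; exact: linZ.
have dx' := lin_dom SD lx'; have dy' := lin_dom SD ly'.
rewrite opprD addrACA -scalerBr.
apply: le_lt_trans (nrmD_le (domZ a (domB dx dx')) (domB dy dy')) _.
rewrite nrmZ; last exact: domB.
have : cmod a ^+ 2 * nrm (x - x') <= e / 4.
  apply: (@le_trans _ _ ((cmod a ^+ 2 + 1) * nrm (x - x'))).
    by rewrite ler_wpM2r ?nrm_ge0 ?lerDl //; exact: domB.
  by move: hx'; rewrite lter_pdivlMr // mulrC => /ltW.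
by lra.
Qed.

Lemma clos0 S : clos S 0.
Proof.
split; first exact: hdom0.
by move=> e e0; exists 0; [exact: lin0|rewrite subrr nrm0].
Qed.

Lemma closB S x y : S `<=` D -> clos S x -> clos S y -> clos S (x - y).
Proof. by move=> SD cx cy; rewrite addrC -scaleN1r; exact: clos_comb. Qed.

Lemma clos_limit S x : S `<=` D -> D x ->
  (forall e, 0 < e -> exists2 y, clos S y & nrm (x - y) < e) -> clos S x.
Proof.
move=> SD dx h; split=> // e e0.
have e4 : 0 < e / 4 by lra.
have [y [dy cy] hy] := h _ e4.
have [z lz hz] := cy _ e4.
exists z => //; apply: le_lt_trans (nrm_mid dx dy (lin_dom SD lz)) _.
by lra.
Qed.

Lemma clos_min S S' : S' `<=` D -> S `<=` clos S' -> clos S `<=` clos S'.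
Proof.
move=> S'D SS' x [dx cx]; apply: clos_limit => // e e0.
have [y ly hy] := cx e e0; exists y => //.
by move: y ly {hy}; apply: lin_min => //; [exact: clos0|move=> *; exact: clos_comb].
Qed.

Lemma orth_clos S u : D u -> S `<=` D -> (forall s, S s -> ip s u = 0) ->
  forall x, clos S x -> ip x u = 0.
Proof.
move=> du SD Su x [dx cx]; apply: cmod_eq0; apply: (@le_small _ (nrm u)) => e e0.
have [y ly hy] := cx e e0.
have dy := lin_dom SD ly.
have y0 : D y /\ ip y u = 0.
  move: y ly {hy dy}; apply: lin_min.
  - by split; [exact: hdom0|exact: ip0l].
  - move=> a y z [dy y0] [dz z0]; split; first exact: hdom_comb.
    by rewrite /ip hip_comb // -/ip y0 z0 mulr0 addr0.
  - by move=> s Ss; split; [exact: SD|exact: Su].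
have -> : ip x u = ip (x - y) u by rewrite ipBl // y0.2 subr0.
apply: le_trans (cauchy_schwarz (domB dx dy) du) _.
by rewrite mulrC ler_wpM2l ?nrm_ge0 // ltW.
Qed.

Lemma clos_complete S (u : nat -> V) : S `<=` D -> (forall k, clos S (u k)) ->
  (forall k, nrm (u k.+1 - u k) <= 16^-1 ^+ k) ->
  exists2 x, clos S x & forall e, 0 < e -> exists N, forall k, (N <= k)%N -> nrm (x - u k) < e.
Proof.
move=> SD cu hu; have [|x dx hx] := hcomplete _ hu; first by move=> k; exact: (clos_dom (cu k)).
exists x => //; apply: clos_limit => // e e0.
by have [N hN] := hx e e0; exists (u N) => //; exact: hN.
Qed.

Lemma projection S x : S `<=` D -> D x -> exists2 y, clos S y &
  forall u, clos S u -> ip (x - y) u = 0.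
Proof.
move=> SD dx.
pose E := [set nrm (x - y) | y in clos S].
have E0 : has_inf E.
  split; first by exists (nrm (x - 0)); exists 0 => //; exact: clos0.
  by exists 0 => _ [y [dy _] <-]; apply: nrm_ge0; exact: domB.
pose dl := inf E.
have dl_le y : clos S y -> dl <= nrm (x - y).
  by move=> cy; apply: ge_inf; [case: E0|exists y].
have near (e : R) : 0 < e -> exists y, clos S y /\ nrm (x - y) < dl + e.
  move=> e0; have [_ [y cy <-] hy] := inf_adherent e0 E0.
  by exists y.
(* Parallelogram law for x - y and x - z: the midpoint w of y and z is at squared distance at least
   [dl] from x. *)
have mid y z : clos S y -> clos S z ->
    nrm (y - z) <= 2 * nrm (x - y) + 2 * nrm (x - z) - 4 * dl.
  move=> cy cz; have [dy _] := cy; have [dz _] := cz.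
  pose w := 2^-1 *: (y + z).
  have cw : clos S w.
    have -> : w = 2^-1 *: y + (2^-1 *: z + 0) by rewrite addr0 /w scalerDr.
    by apply: clos_comb => //; apply: clos_comb => //; exact: clos0.
  have := dl_le _ cw.
  have -> : nrm (x - w) = 4^-1 * nrm ((x - y) + (x - z)).
    have -> : (x - y) + (x - z) = (2 : R[i]) *: (x - w).
      rewrite scalerBr /w scalerA divff ?pnatr_eq0 // scale1r scaler_nat.
      by rewrite opprD mulr2n addrACA.
    rewrite nrmZ; last by apply: domB => //; exact: clos_dom cw.
    by rewrite cmodE !ReImE /=; field.
  have dxy := domB dx dy; have dxz := domB dx dz.
  rewrite nrmD_exp //.
  have -> : y - z = (x - z) - (x - y).
    by rewrite opprB [RHS]addrC addrA subrK.
  by rewrite (nrmB_exp dxz dxy) (ipC dxy dxz) ReJ; lra.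
(* By [mid], an excess of 8^-1 16^-k makes consecutive terms differ by at most 16^-k in [nrm], the
   rate that completeness asks for. *)
have /choice[u hu] : forall k, exists y, clos S y /\ nrm (x - y) < dl + 8^-1 * 16^-1 ^+ k.
  by move=> k; apply: near; rewrite mulr_gt0 ?exprn_gt0 ?invr_gt0.
have [||y cy hy] := @clos_complete S u SD.
- by move=> k; case: (hu k).
- move=> k; have [c1 h1] := hu k; have [c2 h2] := hu k.+1.
  apply: le_trans (mid _ _ c2 c1) _.
  have : (16^-1 ^+ k.+1 : R) <= 16^-1 ^+ k.
    by rewrite exprS ler_piMl ?exprn_ge0 ?invr_ge0 // invf_le1 // ler1n.
  have : 0 <= (16^-1 : R) ^+ k by rewrite exprn_ge0 // invr_ge0.
  by move: h1 h2; lra.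
have [dy _] := cy.
have min_y : nrm (x - y) <= dl.
  rewrite -subr_le0; apply: (@le_small _ 1) => e e0; rewrite mul1r.
  (* In the expansion of the square of (x - y) + (y - u k), Cauchy-Schwarz controls the cross term
     p: as M exceeds nrm (x - y), a distance nrm (y - u k) below e^2 / (16 M) gives |p| <= e / 4. *)
  pose M := nrm (x - y) + dl + 1.
  have dl0 : 0 <= dl by apply: lb_le_inf; [case: E0|move=> _ [z [dz _] <-]; apply: nrm_ge0; exact: domB].
  have M0 : 0 < M by rewrite /M; have := nrm_ge0 (domB dx dy); lra.
  have e1 : 0 < e ^+ 2 / (16 * M) by rewrite divr_gt0 ?mulr_gt0 // exprn_gt0.
  have e2 : 0 < e / 4 by lra.
  have [N1 hN1] := hy _ e1; have [N2 hN2] := hy _ e2.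
  have [N3 hN3] : exists N3, forall k, (N3 <= k)%N -> 8^-1 * 16^-1 ^+ k < e / 8.
    have /cvgrPdist_lt/(_ e e0) : (fun k : nat => (16^-1 : R) ^+ k) @ \oo --> (0 : R).
      by apply: cvg_expr; rewrite ger0_norm ?invr_ge0 // invf_lt1 // ltr1n.
    case=> N3 _ h3; exists N3 => k /h3 /=; rewrite sub0r normrN ger0_norm; first by lra.
    by rewrite exprn_ge0 ?invr_ge0.
  pose k := maxn N1 (maxn N2 N3).
  have k1 : (N1 <= k)%N by rewrite leq_maxl.
  have k2 : (N2 <= k)%N by rewrite /k; lia.
  have k3 : (N3 <= k)%N by rewrite /k; lia.
  have [ck hk] := hu k; have [dk _] := ck.
  have h1 := hN1 _ k1; have h2 := hN2 _ k2; have h3 := hN3 _ k3.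
  have dxy := domB dx dy; have dyk := domB dy dk.
  have E1 := nrmD_exp dxy dyk; rewrite addrA subrK in E1.
  have C := cauchy_schwarz dxy dyk; rewrite cmodE in C.
  set p := cRe (ip (x - y) (y - u k)) in E1 C.
  have C2 : p ^+ 2 <= nrm (x - y) * nrm (y - u k).
    by apply: le_trans C; rewrite lerDl sqr_ge0.
  have C3 : p ^+ 2 <= (e / 4) ^+ 2.
    apply: le_trans C2 _; apply: (@le_trans _ _ (M * (e ^+ 2 / (16 * M)))).
      apply: ler_pM; [exact: nrm_ge0|exact: nrm_ge0| |exact: ltW].
      by rewrite /M; lra.
    by rewrite le_eqVlt; apply/orP; left; apply/eqP; field; rewrite gt_eqF.
  have C4 : - p <= e / 4.
    rewrite leNgt; apply/negP => hp.
    have : (e / 4) ^+ 2 < (- p) ^+ 2 by rewrite ltr_pXn2r ?nnegrE //; lra.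
    by rewrite sqrrN ltNge C3.
  have := nrm_ge0 dyk.
  by move: E1 h3 hk C4; lra.
exists y => // u' cu.
have du := clos_dom cu.
have dxy := domB dx dy.
apply: cmod_eq0; set m := cmod _ ^+ 2.
have m0 : 0 <= m by exact: sqr_ge0.
(* Moving y by s <x - y, u'> u' stays in the closed subspace, so the squared distance remains at
   least [dl]. Below, s = 1 / (nrm u' + 1) forces m = 0, even for u' of norm 0. *)
have key (s : R) : 0 <= s ^+ 2 * m * nrm u' - 2 * s * m.
  pose c : R[i] := s%:C%C * ip (x - y) u'.
  have cz : clos S (c *: u' + y) by apply: clos_comb.
  have := dl_le _ cz; rewrite opprD (addrC (- _)) addrA.
  rewrite nrmB_exp //; last exact: domZ.
  rewrite ipZr // nrmZ // !cmodE !ReImE /= => h.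
  have : dl <= dl + (s ^+ 2 * m * nrm u' - 2 * s * m).
    by apply: le_trans h _; rewrite /m cmodE; move: min_y; lra.
  by lra.
have n0 := nrm_ge0 du.
have n1 : 0 < nrm u' + 1 by lra.
have := key (nrm u' + 1)^-1.
have -> : (nrm u' + 1)^-1 ^+ 2 * m * nrm u' - 2 * (nrm u' + 1)^-1 * m =
  - (m * ((nrm u' + 2) / (nrm u' + 1) ^+ 2)) by field; rewrite gt_eqF.
rewrite oppr_ge0 pmulr_lle0 // divr_gt0 ?exprn_gt0 //; lra.
Qed.

(** The residual of the projection of x is orthogonal to S, hence null, and the closure absorbs null
    vectors. *)
Lemma clos_total S x : S `<=` D ->
  (forall u, D u -> (forall s, S s -> ip s u = 0) -> nrm u = 0) ->
  D x -> clos S x.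
Proof.
move=> SD tot dx; have [y cy hy] := projection SD dx.
have [dy _] := cy; have dxy := domB dx dy.
have n0 : nrm (x - y) = 0.
  apply: tot => // s Ss.
  by rewrite (ipC dxy (SD _ Ss)) (hy _ (clos_sub SD Ss)) rmorph0.
by apply: clos_limit => // e e0; exists y => //; rewrite n0.
Qed.

End HilbertTheory.

(** * Products of Hilbert spaces and graphs of isometries *)

Section ProductSpace.
Context {R : realType} {V1 V2 : lmodType R[i]} (H1 : hspace V1) (H2 : hspace V2).

Let pdom : set (V1 * V2) := [set p | hdom H1 p.1 /\ hdom H2 p.2].
Let pip (p q : V1 * V2) : R[i] := hip H1 p.1 q.1 + hip H2 p.2 q.2.

Let pcomplete (u : nat -> V1 * V2) : (forall k, pdom (u k)) ->
  (forall k, cRe (pip (u k.+1 - u k) (u k.+1 - u k)) <= 16^-1 ^+ k) ->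
  exists2 x, pdom x & forall e : R, 0 < e -> exists N, forall k, (N <= k)%N ->
    cRe (pip (x - u k) (x - u k)) < e.
Proof.
move=> du hu.
have d1 k : hdom H1 (u k).1 by case: (du k).
have d2 k : hdom H2 (u k).2 by case: (du k).
have [|x1 dx1 h1] := @hcomplete _ _ H1 (fun k => (u k).1) d1.
  move=> k; apply: le_trans (hu k); rewrite /pip ReD lerDl /=.
  by apply: hip_ge0; exact: domB.
have [|x2 dx2 h2] := @hcomplete _ _ H2 (fun k => (u k).2) d2.
  move=> k; apply: le_trans (hu k); rewrite /pip ReD lerDr /=.
  by apply: hip_ge0; exact: domB.
exists (x1, x2) => // e e0; have e2 : 0 < e / 2 by lra.
have [N1 hN1] := h1 _ e2; have [N2 hN2] := h2 _ e2.
exists (maxn N1 N2) => k; rewrite geq_max => /andP[k1 k2].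
have := hN1 _ k1; have := hN2 _ k2; rewrite /pip ReD /=; lra.
Qed.

Definition hprod : hspace (V1 * V2)%type.
Proof.
refine (@HSpace R (V1 * V2)%type pdom pip _ _ _ _ _ pcomplete).
- by split; exact: hdom0.
- by move=> a x y [? ?] [? ?]; split; exact: hdom_comb.
- move=> a x y z [? ?] [? ?] [? ?].
  by rewrite /pip /= !hip_comb // mulrDr addrACA.
- move=> x y [x1 x2] [y1 y2].
  by rewrite /pip (hip_conj x1 y1) (hip_conj x2 y2) rmorphD.
- by move=> x [? ?]; rewrite /pip ReD addr_ge0 // hip_ge0.
Defined.

Lemma nrm_prod p : nrm hprod p = nrm H1 p.1 + nrm H2 p.2.
Proof. exact: ReD. Qed.

Lemma ip_prod p q : hip hprod p q = hip H1 p.1 q.1 + hip H2 p.2 q.2.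
Proof. by []. Qed.

(* [clos (hprod H1 H2) S] is the graph of the continuous extension of the map
   whose graph is spanned by [S]; inner products of pairs with [(- c x, y)]
   reduce the claim to orthogonality. *)
Lemma clos_isometry (S : set (V1 * V2)) (c : R) : S `<=` hdom hprod ->
  (forall p q, S p -> S q -> hip H2 p.2 q.2 = c%:C%C * hip H1 p.1 q.1) ->
  forall p q, clos hprod S p -> clos hprod S q ->
    hip H2 p.2 q.2 = c%:C%C * hip H1 p.1 q.1.
Proof.
move=> SD iso.
pose tw (q : V1 * V2) := (- c%:C%C *: q.1, q.2).
have dtw q : hdom hprod q -> hdom hprod (tw q).
  by move=> [? ?]; split => //; exact: domZ.
have ip_tw p q : hdom hprod p -> hdom hprod q ->
    hip hprod p (tw q) = hip H2 p.2 q.2 - c%:C%C * hip H1 p.1 q.1.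
  move=> [p1 p2] [q1 q2]; rewrite ip_prod /= ipZr //.
  have -> : ((- c%:C%C)^*)%C = - c%:C%C by apply: ReImP; rewrite !ReImE /=; lra.
  by rewrite mulNr addrC.
have twC p q : hdom hprod p -> hdom hprod q ->
    hip hprod p (tw q) = ((hip hprod q (tw p))^*)%C.
  move=> dp dq; rewrite !ip_tw //; case: dp => p1 p2; case: dq => q1 q2.
  rewrite (hip_conj q1 p1) (hip_conj q2 p2) rmorphB rmorphM /=.
  by rewrite oppr0.
have one s : S s -> forall p, clos hprod S p -> hip hprod p (tw s) = 0.
  move=> Ss; apply: orth_clos => //; first by apply: dtw; exact: SD.
  move=> p Sp; rewrite ip_tw; [|exact: SD|exact: SD].
  by rewrite (iso _ _ Sp Ss) subrr.
move=> p q cp cq; have dp := clos_dom cp; have dq := clos_dom cq.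
apply/eqP; rewrite -subr_eq0 -ip_tw //; apply/eqP.
apply: (@orth_clos _ _ hprod S (tw q) (dtw _ dq) SD _ p cp) => s Ss.
rewrite twC //; last exact: SD.
by rewrite one // conjc0.
Qed.

Lemma clos_isometry_nrm (S : set (V1 * V2)) (c : R) : S `<=` hdom hprod ->
  (forall p q, S p -> S q -> hip H2 p.2 q.2 = c%:C%C * hip H1 p.1 q.1) ->
  forall p, clos hprod S p -> nrm H2 p.2 = c * nrm H1 p.1.
Proof.
move=> SD iso p cp; rewrite /nrm (clos_isometry SD iso cp cp) ReM /=.
by rewrite mul0r subr0.
Qed.

(** When first coordinates converge to a, the second ones are Cauchy because squared norms are
    scaled by c; completeness of H2 supplies b. *)
Lemma clos_extension (S : set (V1 * V2)) (c : R) : 0 <= c ->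
  S `<=` hdom hprod ->
  (forall p q, S p -> S q -> hip H2 p.2 q.2 = c%:C%C * hip H1 p.1 q.1) ->
  forall a, clos H1 (fst @` S) a -> exists b, clos hprod S (a, b).
Proof.
move=> c0 SD iso a [da ca].
have SL := @clos_lin _ _ hprod _ SD.
pose dl k : R := 16^-1 ^+ k / (4 * (c + 1)).
have c1 : 0 < 4 * (c + 1) by lra.
have x0 k : 0 < (16^-1 : R) ^+ k by rewrite exprn_gt0 // invr_gt0.
have dl0 k : 0 < dl k by rewrite /dl divr_gt0.
have /choice[u hu] : forall k, exists p, lin S p /\ nrm H1 (a - p.1) < dl k.
  move=> k; have [y ly hy] := ca _ (dl0 k).
  suff [p lp py] : exists2 p, lin S p & p.1 = y by exists p; rewrite py.
  move: y ly {hy}; apply: lin_min.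
  - by exists 0 => //; exact: lin0.
  - move=> b _ _ [p lp <-] [q lq <-]; exists (b *: p + q) => //.
    by apply: linD => //; exact: linZ.
  - by move=> _ [p Sp <-]; exists p => //; exact: lin_sub.
have cu k : clos hprod S (u k) by apply: SL; case: (hu k).
have d1 k : hdom H1 (u k).1 by case: (clos_dom (cu k)).
have d2 k : hdom H2 (u k).2 by case: (clos_dom (cu k)).
have [k|b db hb] := @hcomplete _ _ H2 (fun k => (u k).2) d2.
  have cB : clos hprod S (u k.+1 - u k) by apply: closB.
  have := clos_isometry_nrm SD iso cB; rewrite /nrm /= => ->.
  have := nrm_mid (d1 k.+1) da (d1 k).
  rewrite (nrmBC (d1 k.+1) da).
  have := (hu k).2; have := (hu k.+1).2.
  have : dl k.+1 <= dl k.
    rewrite /dl ler_pM2r ?invr_gt0 // exprS ler_piMl ?(ltW (x0 k)) //.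
    by rewrite invf_le1 // ler1n.
  move=> h1 h2 h3 h4.
  have h5 : nrm H1 ((u k.+1).1 - (u k).1) <= 4 * dl k by lra.
  apply: (@le_trans _ _ (c * (4 * dl k))); first by rewrite ler_wpM2l.
  rewrite /dl; set X := 16^-1 ^+ k.
  have -> : c * (4 * (X / (4 * (c + 1)))) = X * (c / (c + 1)).
    by field; rewrite gt_eqF //; lra.
  have c2 : c / (c + 1) <= 1 by rewrite ler_pdivrMr; lra.
  by rewrite ler_piMr // ltW // x0.
exists b; apply: clos_limit => // e e0.
have e2 : 0 < e / 2 by lra.
have [N1 hN1] := hb _ e2.
have [N2 hN2] : exists N, forall k, (N <= k)%N -> dl k < e / 2.
  have /cvgrPdist_lt/(_ _ (mulr_gt0 e2 c1)) : (fun k : nat => (16^-1 : R) ^+ k) @ \oo --> (0 : R).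
    by apply: cvg_expr; rewrite ger0_norm ?invr_ge0 // invf_lt1 // ltr1n.
  case=> N _ hN; exists N => k /hN /=; rewrite sub0r normrN ger0_norm ?ltW //.
  by rewrite /dl ltr_pdivrMr.
pose k := maxn N1 N2.
exists (u k) => //; rewrite nrm_prod /=.
have := hN1 k (leq_maxl _ _); have := hN2 k (leq_maxr _ _).
by have := (hu k).2; rewrite /nrm; lra.
Qed.

End ProductSpace.

Section BoundedMap.
Context {R : realType} {V1 V2 : lmodType R[i]} (H1 : hspace V1) (H2 : hspace V2).

(** Serves to exchange or drop coordinates of graphs and to multiply by Phi, all of which are
    bounded linear maps. *)
Lemma clos_image (f : V1 -> V2) (K : R) (S : set V1) (S' : set V2) :
  S `<=` hdom H1 -> S' `<=` hdom H2 ->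
  (forall x, hdom H1 x -> hdom H2 (f x)) ->
  f 0 = 0 ->
  (forall a x y, f (a *: x + y) = a *: f x + f y) ->
  (forall x, hdom H1 x -> nrm H2 (f x) <= K * nrm H1 x) ->
  (forall x, S x -> clos H2 S' (f x)) ->
  forall x, clos H1 S x -> clos H2 S' (f x).
Proof.
move=> SD S'D fD f0 fL fK fS x [dx cx].
apply: clos_limit => //; first exact: fD.
move=> e e0.
have K1 : 0 < `|K| + 1 by rewrite ltr_wpDl.
have [y ly hy] := cx _ (divr_gt0 e0 K1).
have dy := lin_dom SD ly; have dxy := domB dx dy.
exists (f y).
  move: y ly {hy dy dxy}; apply: lin_min => //.
  - by rewrite f0; exact: clos0.
  - by move=> a y z fy fz; rewrite fL; apply: clos_comb.
have -> : f x - f y = f (x - y).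
  have -> : x - y = (-1) *: y + x by rewrite scaleN1r addrC.
  by rewrite fL scaleN1r addrC.
apply: le_lt_trans (fK _ dxy) _.
apply: (@le_lt_trans _ _ ((`|K| + 1) * nrm H1 (x - y))).
  rewrite ler_wpM2r ?nrm_ge0 // (le_trans (ler_norm _)) //; lra.
by rewrite mulrC -ltr_pdivlMr.
Qed.

End BoundedMap.

(** * Complex-valued functions and L_2 *)

Section ComplexMeasurable.
Context {R : realType} {d : measure_display} {T : measurableType d} (D : set T).
Implicit Types (f g : T -> R[i]).

Lemma cmeas_cst (c : R[i]) : cmeasurable D (fun _ => c).
Proof. by split; exact: measurable_cst. Qed.

Lemma cmeasD f g : cmeasurable D f -> cmeasurable D g ->
  cmeasurable D (fun x => f x + g x).
Proof.
move=> [f1 f2] [g1 g2]; split; under eq_fun do rewrite ?ReD ?ImD.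
- exact: measurable_funD.
- exact: measurable_funD.
Qed.

Lemma cmeasM f g : cmeasurable D f -> cmeasurable D g ->
  cmeasurable D (fun x => f x * g x).
Proof.
move=> [f1 f2] [g1 g2]; split; under eq_fun do rewrite ?ReM ?ImM.
- by apply: measurable_funB; exact: measurable_funM.
- by apply: measurable_funD; exact: measurable_funM.
Qed.

Lemma cmeasJ f : cmeasurable D f -> cmeasurable D (fun x => ((f x)^*)%C).
Proof.
move=> [f1 f2]; split; under eq_fun do rewrite ?ReJ ?ImJ; first by [].
exact: measurable_funN.
Qed.

Lemma cmeasN f : cmeasurable D f -> cmeasurable D (fun x => - f x).
Proof.
move=> [f1 f2]; split; under eq_fun do rewrite ?ReN ?ImN.
- exact: measurable_funN.
- exact: measurable_funN.
Qed.

Lemma cmeasB f g : cmeasurable D f -> cmeasurable D g ->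
  cmeasurable D (fun x => f x - g x).
Proof. by move=> mf mg; apply: cmeasD => //; exact: cmeasN. Qed.

Lemma cmeasZ (c : R[i]) f : cmeasurable D f -> cmeasurable D (fun x => c * f x).
Proof. by move=> mf; apply: cmeasM => //; exact: cmeas_cst. Qed.

Lemma meas_cmod2 f : cmeasurable D f -> measurable_fun D (fun x => cmod (f x) ^+ 2).
Proof.
move=> [f1 f2]; under eq_fun do rewrite cmodE.
by apply: measurable_funD; exact: measurable_funX.
Qed.

Lemma meas_cmod2_powR f (p : R) : cmeasurable D f ->
  measurable_fun D (fun x => (cmod (f x) ^+ 2) `^ p).
Proof.
move=> mf.
apply: (@measurableT_comp _ _ _ _ _ _ (@powR R ^~ p) _ (fun x => cmod (f x) ^+ 2)).
  exact: measurable_powR.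
exact: meas_cmod2.
Qed.

Lemma meas_cmod f : cmeasurable D f -> measurable_fun D (fun x => cmod (f x)).
Proof.
move=> mf; have -> : (fun x => cmod (f x)) = (fun x => (cmod (f x) ^+ 2) `^ 2^-1).
  by apply/funext => x; rewrite powR12_sqrt ?sqr_ge0 // sqrtr_sqr ger0_norm ?cmod_ge0.
exact: meas_cmod2_powR.
Qed.

(** The inverse is the conjugate times |z|^2 to the power -1. This real power is measurable on the
    whole line and is 0 at 0, in agreement with 0^-1 = 0. *)
Lemma cmeasV f : cmeasurable D f -> cmeasurable D (fun x => (f x)^-1).
Proof.
move=> mf; have [f1 f2] := mf.
have m2 : measurable_fun D (fun x => (cmod (f x) ^+ 2) `^ (-1)).
  exact: meas_cmod2_powR.
have E x : (f x)^-1 = ((cmod (f x) ^+ 2) `^ (-1))%:C%C * ((f x)^*)%C.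
  rewrite powR_inv1 ?sqr_ge0 // cmodE; case: (f x) => a b.
  by apply: ReImP => /=; ring.
have -> : (fun x => (f x)^-1) = (fun x => ((cmod (f x) ^+ 2) `^ (-1))%:C%C * ((f x)^*)%C).
  exact/funext.
apply: cmeasM; last exact: cmeasJ.
by split => //=; exact: measurable_cst.
Qed.

Lemma cmeas_real (h : T -> R) : measurable_fun D h -> cmeasurable D (fun x => (h x)%:C%C).
Proof. by move=> mh; split => //=; exact: measurable_cst. Qed.

End ComplexMeasurable.

Lemma abs_Re (R : realType) (z : R[i]) : `|cRe z| <= cmod z.
Proof.
rewrite -ler_sqr ?nnegrE ?normr_ge0 ?cmod_ge0 // cmodE real_normK ?num_real //.
by rewrite lerDl sqr_ge0.
Qed.

Lemma abs_Im (R : realType) (z : R[i]) : `|cIm z| <= cmod z.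
Proof.
rewrite -ler_sqr ?nnegrE ?normr_ge0 ?cmod_ge0 // cmodE real_normK ?num_real //.
by rewrite lerDr sqr_ge0.
Qed.

Lemma cmod_le (R : realType) (z : R[i]) : cmod z <= `|cRe z| + `|cIm z|.
Proof.
rewrite -ler_sqr ?nnegrE ?addr_ge0 ?normr_ge0 ?cmod_ge0 // cmodE sqrrD.
rewrite !real_normK ?num_real // lerD2r lerDl mulrn_wge0 // mulr_ge0 //.
Qed.

Section ComplexIntegral.
Context {R : realType} {d : measure_display} {T : measurableType d}.
Context (mu : {measure set T -> \bar R}) (D : set T) (mD : measurable D).
Implicit Types (f g : T -> R[i]).

Lemma cintegrableP f : cintegrable mu D f <->
  mu.-integrable D (fun x => (cRe (f x))%:E) /\
  mu.-integrable D (fun x => (cIm (f x))%:E).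
Proof.
split=> [[mf fI]|[f1 f2]].
  have [m1 m2] := mf.
  have I : mu.-integrable D (fun x => (cmod (f x))%:E).
    apply/integrableP; split; first by apply/measurable_EFinP; exact: meas_cmod.
    apply: le_lt_trans fI; rewrite le_eqVlt; apply/orP; left; apply/eqP.
    by apply: eq_integral => x _; rewrite gee0_abs // lee_fin cmod_ge0.
  split; apply: le_integrable I => //; try exact/measurable_EFinP.
  - by move=> x _; rewrite lee_fin (ger0_norm (cmod_ge0 _)) abs_Re.
  - by move=> x _; rewrite lee_fin (ger0_norm (cmod_ge0 _)) abs_Im.
have mf : cmeasurable D f.
  by split; apply/measurable_EFinP; [exact: measurable_int f1|exact: measurable_int f2].
split=> //.
have /integrableP[_] := integrableD mD (integrable_norm f1) (integrable_norm f2).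
apply: le_lt_trans; apply: ge0_le_integral => //.
- by move=> x _; rewrite lee_fin cmod_ge0.
- by apply/measurable_EFinP; exact: meas_cmod.
- have [m1 m2] := mf.
  by apply/measurable_EFinP; apply: measurableT_comp => //; apply: measurable_funD;
    exact: measurableT_comp.
- by move=> x _; rewrite /= lee_fin ger0_norm ?addr_ge0 // cmod_le.
Qed.

Lemma integrable_Zl (c : R) (h : T -> R) : mu.-integrable D (fun x => (h x)%:E) ->
  mu.-integrable D (EFin \o (fun x => c * h x)).
Proof.
move=> hI; have -> : EFin \o (fun x => c * h x) = (fun x => c%:E * (h x)%:E)%E by [].
exact: integrableZl.
Qed.

Lemma integrable_D (h k : T -> R) : mu.-integrable D (fun x => (h x)%:E) ->
  mu.-integrable D (fun x => (k x)%:E) ->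
  mu.-integrable D (EFin \o (fun x => h x + k x)).
Proof. by move=> hI kI; exact: (integrableD mD hI kI). Qed.

Lemma cintegrableD f g : cintegrable mu D f -> cintegrable mu D g ->
  cintegrable mu D (fun x => f x + g x).
Proof.
move=> /cintegrableP[f1 f2] /cintegrableP[g1 g2]; apply/cintegrableP; split.
- by under eq_fun do rewrite ReD EFinD; exact: integrableD.
- by under eq_fun do rewrite ImD EFinD; exact: integrableD.
Qed.

Lemma cintegralD f g : cintegrable mu D f -> cintegrable mu D g ->
  cintegral mu D (fun x => f x + g x) = cintegral mu D f + cintegral mu D g.
Proof.
move=> /cintegrableP[f1 f2] /cintegrableP[g1 g2].
apply: ReImP; rewrite ?ReD ?ImD /=.
- by rewrite -RintegralD //; apply: eq_Rintegral => x _; rewrite ReD.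
- by rewrite -RintegralD //; apply: eq_Rintegral => x _; rewrite ImD.
Qed.

Lemma cintegrableZ (c : R[i]) f : cintegrable mu D f ->
  cintegrable mu D (fun x => c * f x).
Proof.
move=> /cintegrableP[f1 f2]; apply/cintegrableP; split.
- under eq_fun do rewrite ReM EFinB !EFinM.
  by apply: integrableB => //; exact: integrableZl.
- under eq_fun do rewrite ImM EFinD !EFinM.
  by apply: integrableD => //; exact: integrableZl.
Qed.

Lemma cintegralZ (c : R[i]) f : cintegrable mu D f ->
  cintegral mu D (fun x => c * f x) = c * cintegral mu D f.
Proof.
move=> /cintegrableP[f1 f2]; apply: ReImP; rewrite ?ReM ?ImM /=.
- rewrite -(RintegralZl (cRe c) mD f1) -(RintegralZl (cIm c) mD f2) -RintegralB //.
  + by apply: eq_Rintegral => x _; rewrite ReM.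
  + exact: integrable_Zl.
  + exact: integrable_Zl.
- rewrite -(RintegralZl (cRe c) mD f2) -(RintegralZl (cIm c) mD f1) -RintegralD //.
  + by apply: eq_Rintegral => x _; rewrite ImM.
  + exact: integrable_Zl.
  + exact: integrable_Zl.
Qed.

Lemma cintegralJ f : cintegrable mu D f ->
  cintegral mu D (fun x => ((f x)^*)%C) = ((cintegral mu D f)^*)%C.
Proof.
move=> /cintegrableP[f1 f2]; apply: ReImP; rewrite ?ReJ ?ImJ /=.
- by apply: eq_Rintegral => x _; rewrite ReJ.
- rewrite -mulN1r -RintegralZl //.
  by apply: eq_Rintegral => x _; rewrite ImJ mulN1r.
Qed.

Lemma cintegrable_le f (h : T -> R) : cmeasurable D f ->
  mu.-integrable D (EFin \o h) -> (forall x, D x -> cmod (f x) <= h x) ->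
  cintegrable mu D f.
Proof.
move=> mf hi fh; split=> //.
apply: le_lt_trans (integrable_lty mD hi); apply: ge0_le_integral => //.
- by move=> x _; rewrite lee_fin cmod_ge0.
- by apply/measurable_EFinP; exact: meas_cmod.
- exact: measurable_int hi.
Qed.

Lemma cintegral_ae f g : cmeasurable D f -> cmeasurable D g ->
  {ae mu, forall x, D x -> f x = g x} -> cintegral mu D f = cintegral mu D g.
Proof.
move=> [f1 f2] [g1 g2] fg; rewrite /cintegral /Rintegral; congr Complex; congr fine.
- apply: ae_eq_integral => //; try exact/measurable_EFinP.
  by apply: filterS fg => x h Dx; rewrite /= h.
- apply: ae_eq_integral => //; try exact/measurable_EFinP.
  by apply: filterS fg => x h Dx; rewrite /= h.
Qed.

Lemma eq_cintegral f g : (forall x, D x -> f x = g x) -> cintegral mu D f = cintegral mu D g.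
Proof.
by move=> fg; rewrite /cintegral; congr Complex; apply: eq_Rintegral => x;
  rewrite inE => /fg ->.
Qed.

End ComplexIntegral.

Section SquareIntegrable.
Context {R : realType} {d : measure_display} {T : measurableType d}.
Context (mu : {measure set T -> \bar R}).
Implicit Types (f g h : T -> R[i]).

Notation L2T := (L2 mu setT).

Let mT : measurable [set: T] := measurableT.

Lemma L2_sq f : L2T f <-> cmeasurable setT f /\
  mu.-integrable setT (fun x => (cmod (f x) ^+ 2)%:E).
Proof.
split=> [[mf fI]|[mf /integrableP[_ fI]]]; split=> //.
  apply/integrableP; split; first by apply/measurable_EFinP; exact: meas_cmod2.
  by under eq_integral do rewrite gee0_abs ?lee_fin ?sqr_ge0 //.
by move: fI; under eq_integral do rewrite gee0_abs ?lee_fin ?sqr_ge0 //.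
Qed.

Lemma L2_le f g h : L2T f -> L2T g -> cmeasurable setT h ->
  (forall x, cmod (h x) ^+ 2 <= 2 * cmod (f x) ^+ 2 + 2 * cmod (g x) ^+ 2) -> L2T h.
Proof.
move=> /L2_sq[mf fI] /L2_sq[mg gI] mh le; apply/L2_sq; split=> //.
apply: le_integrable (integrableD mT (integrableZl mT 2 fI) (integrableZl mT 2 gI)) => //.
  by apply/measurable_EFinP; exact: meas_cmod2.
move=> x _ /=; rewrite lee_fin ger0_norm ?sqr_ge0 //.
by apply: le_trans (le x) _; exact: ler_norm.
Qed.

Lemma cmodD2 (z w : R[i]) : cmod (z + w) ^+ 2 <= 2 * cmod z ^+ 2 + 2 * cmod w ^+ 2.
Proof.
rewrite !cmodE !ReImE -subr_ge0.
have -> : 2 * (cRe z ^+ 2 + cIm z ^+ 2) + 2 * (cRe w ^+ 2 + cIm w ^+ 2) -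
  ((cRe z + cRe w) ^+ 2 + (cIm z + cIm w) ^+ 2) =
  (cRe z - cRe w) ^+ 2 + (cIm z - cIm w) ^+ 2 by ring.
by rewrite addr_ge0 ?sqr_ge0.
Qed.

Lemma L2_cst0 : L2T (fun _ => 0).
Proof.
split; first exact: cmeas_cst.
rewrite /sqnorm; under eq_integral do rewrite cmodE /= expr0n addr0.
by rewrite integral0 ltry.
Qed.

Lemma L2_Z (a : R[i]) f : L2T f -> L2T (fun x => a * f x).
Proof.
move=> /L2_sq[mf fI]; apply/L2_sq; split; first exact: cmeasZ.
under eq_fun do rewrite ComplexField.Normc.normcM exprMn EFinM.
exact: integrableZl.
Qed.

Lemma L2_D f g : L2T f -> L2T g -> L2T (fun x => f x + g x).
Proof.
move=> lf lg; apply: (L2_le lf lg); last by move=> x; exact: cmodD2.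
by apply: cmeasD; [case: lf|case: lg].
Qed.

Lemma cmodJ (z : R[i]) : cmod (z^*)%C = cmod z.
Proof. by case: z => a b /=; rewrite sqrrN. Qed.

Lemma cmod_mul_le (z w : R[i]) : cmod (z * w) <= cmod z ^+ 2 + cmod w ^+ 2.
Proof.
rewrite ComplexField.Normc.normcM.
have := sqr_ge0 (cmod z - cmod w); have := cmod_ge0 z; have := cmod_ge0 w.
have := sqr_ge0 (cmod z + cmod w).
by rewrite sqrrB sqrrD; nra.
Qed.

Lemma L2_mul f g : L2T f -> L2T g -> cintegrable mu setT (fun x => f x * (g x)^*%C).
Proof.
move=> /L2_sq[mf fI] /L2_sq[mg gI].
apply: (@cintegrable_le _ _ _ _ _ mT _ (fun x => cmod (f x) ^+ 2 + cmod (g x) ^+ 2)).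
- by apply: cmeasM => //; exact: cmeasJ.
- exact: integrable_D.
- by move=> x _; rewrite -(cmodJ (g x)) cmod_mul_le.
Qed.

Definition ip2 f g : R[i] := cintegral mu setT (fun x => f x * (g x)^*%C).

Lemma ip2_Re f : cRe (ip2 f f) = fine (sqnorm mu setT f).
Proof.
rewrite /= /Rintegral /sqnorm; congr fine; apply: eq_integral => x _.
by rewrite cmodE ReM ReJ ImJ mulrN opprK -!expr2.
Qed.

Lemma sqnorm_ip2 f : L2T f -> sqnorm mu setT f = (cRe (ip2 f f))%:E.
Proof.
move=> [_ fI]; rewrite ip2_Re fineK // ge0_fin_numE //.
by apply: integral_ge0 => x _; rewrite lee_fin sqr_ge0.
Qed.

Lemma ip2_comb (a : R[i]) f g h : L2T f -> L2T g -> L2T h ->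
  ip2 (fun x => a * f x + g x) h = a * ip2 f h + ip2 g h.
Proof.
move=> lf lg lh; rewrite /ip2 -cintegralZ //; last exact: L2_mul.
rewrite -cintegralD //; [|by apply: cintegrableZ => //; exact: L2_mul|exact: L2_mul].
by apply: eq_cintegral => x _; rewrite mulrDl mulrA.
Qed.

Lemma ip2_conj f g : L2T f -> L2T g -> ip2 g f = ((ip2 f g)^*)%C.
Proof.
move=> lf lg; rewrite /ip2 -cintegralJ //; last exact: L2_mul.
by apply: eq_cintegral => x _; rewrite rmorphM /= conjcK mulrC.
Qed.

Lemma ip2_ge0 f : 0 <= cRe (ip2 f f).
Proof.
rewrite ip2_Re fine_ge0 //; apply: integral_ge0 => x _.
by rewrite lee_fin sqr_ge0.
Qed.

Lemma ip2_ae f f' g : cmeasurable setT f -> cmeasurable setT f' -> cmeasurable setT g ->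
  {ae mu, forall x, f x = f' x} -> ip2 f g = ip2 f' g.
Proof.
move=> mf mf' mg ff'; apply: cintegral_ae => //.
- by apply: cmeasM => //; exact: cmeasJ.
- by apply: cmeasM => //; exact: cmeasJ.
- by apply: filterS ff' => x -> _.
Qed.

Lemma sqnorm_ae f f' : cmeasurable setT f -> cmeasurable setT f' ->
  {ae mu, forall x, f x = f' x} -> sqnorm mu setT f = sqnorm mu setT f'.
Proof.
move=> mf mf' ff'; apply: ge0_ae_eq_integral => //.
- by apply/measurable_EFinP; exact: meas_cmod2.
- by apply/measurable_EFinP; exact: meas_cmod2.
- by move=> x _; rewrite lee_fin sqr_ge0.
- by move=> x _; rewrite lee_fin sqr_ge0.
- by apply: filterS ff' => x -> _.
Qed.

Lemma sqnorm_eq0 f : L2T f -> sqnorm mu setT f = 0%E -> {ae mu, forall x, f x = 0}.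
Proof.
move=> /L2_sq[mf _] f0.
have : (\int[mu]_x `|(cmod (f x) ^+ 2)%:E| = 0)%E.
  by under eq_integral do rewrite gee0_abs ?lee_fin ?sqr_ge0 //.
move=> /ae_eq_integral_abs => /(_ mT).
have m2 : measurable_fun setT (fun x => (cmod (f x) ^+ 2)%:E).
  by apply/measurable_EFinP; exact: meas_cmod2.
move=> /(_ m2); apply: filterS => x /(_ I) [h].
by apply: cmod_eq0; rewrite h.
Qed.

Lemma ip2_nrm0 f : L2T f -> cRe (ip2 f f) = 0 -> {ae mu, forall x, f x = 0}.
Proof. by move=> lf f0; apply: sqnorm_eq0 => //; rewrite sqnorm_ip2 // f0. Qed.

End SquareIntegrable.

(* The sequences [a k -+ 2 C 2^-k] are monotone. *)
Lemma geometric_cvg (R : realType) (a : R ^nat) (C : R) :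
  (forall k, `|a k.+1 - a k| <= C * 2^-1 ^+ k) ->
  cvgn a /\ forall k, `|limn a - a k| <= 2 * C * 2^-1 ^+ k.
Proof.
move=> ha.
pose q k : R := 2^-1 ^+ k.
have C0 : 0 <= C by have := ha 0%N; rewrite expr0 mulr1; apply: le_trans.
have q0 k : 0 <= q k by rewrite exprn_ge0.
have qS k : q k.+1 = q k / 2 by rewrite /q exprSr.
have q1 k : q k <= 1.
  elim: k => [|k ih]; first by rewrite /q expr0.
  by rewrite qS; have := q0 k; lra.
pose b k := a k - 2 * C * q k; pose c k := a k + 2 * C * q k.
have hk k : - (C * q k) <= a k.+1 - a k <= C * q k by rewrite -ler_norml; exact: ha.
have bS k : b k <= b k.+1.
  rewrite /b qS; have /andP[+ _] := hk k; lra.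
have cS k : c k.+1 <= c k.
  rewrite /c qS; have /andP[_ +] := hk k; lra.
have bh : {homo b : n m / (n <= m)%N >-> n <= m}.
  exact/nondecreasing_seqP.
have ch : {homo c : n m / (n <= m)%N >-> m <= n}.
  exact/nonincreasing_seqP.
have bc k : b k <= c k.
  by have := mulr_ge0 C0 (q0 k); rewrite /b /c; lra.
have cb : cvgn b.
  apply: nondecreasing_is_cvgn => //; exists (c 0%N) => _ [k _ <-].
  by apply: le_trans (bc k) _; exact: ch.
have q_cvg : (fun k => 2 * C * q k) @ \oo --> (0 : R).
  rewrite -[X in _ --> X](mulr0 (2 * C)); apply: cvgM; first exact: cvg_cst.
  by apply: cvg_expr; rewrite ger0_norm // invf_lt1 // ltr1n.
have ab : a = b \+ (fun k => 2 * C * q k) by apply/funext => k; rewrite /= /b subrK.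
have ca : a @ \oo --> limn b.
  by rewrite {1}ab -[X in _ --> X]addr0; apply: cvgD.
split; first by apply/cvg_ex; exists (limn b).
move=> k; rewrite (cvg_lim _ ca) // ler_norml; apply/andP; split.
  have := nondecreasing_cvgn_le bh cb k; rewrite /b /q; lra.
have cc : c @ \oo --> limn b by rewrite -[X in _ --> X]addr0; apply: cvgD.
have cvc : cvgn c by apply/cvg_ex; exists (limn b).
have := nonincreasing_cvgn_ge ch cvc k; rewrite (cvg_lim _ cc) // /c /q; lra.
Qed.

(** * Completeness of L_2 *)

Section L2Complete.
Context {R : realType} {d : measure_display} {T : measurableType d}.
Context (mu : {measure set T -> \bar R}).
Let mT : measurable [set: T] := measurableT.

(** Riesz-Fischer argument. The weights 4^k in S split the rate 16^-k in two: the integral of S is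
    still at most 2, and |u (k+1) - u k| <= sqrt S 2^-k wherever S is finite. *)
Lemma L2_complete (u : nat -> T -> R[i]) : (forall k, L2 mu setT (u k)) ->
  (forall k, cRe (ip2 mu (fun x => u k.+1 x - u k x) (fun x => u k.+1 x - u k x))
     <= 16^-1 ^+ k) ->
  exists2 X, L2 mu setT X & forall k,
    cRe (ip2 mu (fun x => X x - u k x) (fun x => X x - u k x)) <= 16 * 4^-1 ^+ k.
Proof.
move=> lu hu.
have lB f g : L2 mu setT f -> L2 mu setT g -> L2 mu setT (fun x => f x - g x).
  move=> lf lg; have := L2_D lf (L2_Z (-1) lg).
  by under eq_fun do rewrite mulN1r.
pose D k x : R := cmod (u k.+1 x - u k x) ^+ 2.
pose S x : \bar R := (\sum_(0 <= k <oo) (4 ^+ k * D k x)%:E)%E.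
have D0 k x : 0 <= D k x by exact: sqr_ge0.
have p4 k : 0 <= (4 : R) ^+ k by exact: exprn_ge0.
have mD k : measurable_fun setT (D k) by apply: meas_cmod2; case: (lB _ _ (lu k.+1) (lu k)).
have mDE k : measurable_fun setT (fun x => (4 ^+ k * D k x)%:E).
  by apply/measurable_EFinP; apply: measurable_funM => //; exact: measurable_cst.
have DE0 k x : (0%:E <= (4 ^+ k * D k x)%:E)%E by rewrite lee_fin mulr_ge0.
have S0 x : (0 <= S x)%E by apply: nneseries_ge0 => k _ _; exact: DE0.
have mS : measurable_fun setT S by exact: ge0_emeasurable_sum.
have IS : (\int[mu]_x S x <= 2%:E)%E.
  rewrite integral_nneseries //.
  apply: le_trans (@epsilon_trick0 R 2 xpredT _) => //.
  apply: lee_nneseries => [k _ _|k _].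
    by apply: integral_ge0 => x _; exact: DE0.
  have -> : (\int[mu]_x (4 ^+ k * D k x)%:E = (4 ^+ k)%:E * \int[mu]_x (D k x)%:E)%E.
    under eq_integral do rewrite EFinM.
    rewrite ge0_integralZl ?lee_fin //; first exact/measurable_EFinP.
    by move=> x _; rewrite lee_fin.
  have -> : (\int[mu]_x (D k x)%:E)%E = sqnorm mu setT (fun x => u k.+1 x - u k x) by [].
  rewrite sqnorm_ip2; last exact: lB.
  rewrite -EFinM lee_fin.
  apply: (@le_trans _ _ (4 ^+ k * 16^-1 ^+ k)); first by rewrite ler_wpM2l.
  have -> : (2 : R) / (2 ^ k.+1)%:R = 2^-1 ^+ k.
    by rewrite natrX exprS exprVn invfM mulrA divff ?mul1r.
  rewrite -exprMn; apply: lerXn2r; rewrite ?nnegrE ?mulr_ge0 ?invr_ge0 //.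
  by rewrite ler_pdivrMr //; lra.
have S_int : mu.-integrable setT S.
  apply/integrableP; split=> //.
  under eq_integral do rewrite gee0_abs //.
  by apply: le_lt_trans IS _; rewrite ltry.
pose N : set T := [set x | (S x < +oo)%E].
have mN : measurable N.
  by rewrite -[N]setTI; apply: emeasurable_fun_infty_o.
have aeN : {ae mu, forall x, N x}.
  apply: filterS (integrable_ae mT S_int) => x /(_ Logic.I).
  by rewrite fin_numElt => /andP[].
(* Setting the sequence to 0 off N, where S is infinite, makes it converge at every point, so that
   the limit is measurable as a pointwise limit. *)
pose v k x : R[i] := if x \in N then u k x else 0.
have vN k x : N x -> v k x = u k x by rewrite /v; move=> /mem_set ->.
have vN0 k x : ~ N x -> v k x = 0 by move=> nN; rewrite /v memNset.
pose c x : R := Num.sqrt (fine (S x)).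
have c0 x : 0 <= c x by exact: sqrtr_ge0.
have hv x k : cmod (v k.+1 x - v k x) <= c x * 2^-1 ^+ k.
  have [Nx|Nx] := pselect (N x); last first.
    by rewrite !vN0 // subrr ComplexField.Normc.normc0 mulr_ge0 // exprn_ge0.
  rewrite !vN //.
  rewrite -ler_sqr ?nnegrE ?cmod_ge0 ?mulr_ge0 ?exprn_ge0 ?invr_ge0 //.
  rewrite exprMn sqr_sqrtr ?fine_ge0 // -/(D k x).
  have -> : (2^-1 ^+ k ^+ 2 : R) = 4^-1 ^+ k by rewrite exprAC expr2; congr (_ ^+ _); lra.
  rewrite exprVn ler_pdivlMr ?exprn_gt0 // mulrC -lee_fin fineK; last first.
    by rewrite ge0_fin_numE.
  have := @nneseries_lim_ge R (fun k => (4 ^+ k * D k x)%:E) xpredT 0 k.+1.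
  rewrite big_nat_recr //= => h; apply: le_trans (h _); last by move=> *; exact: DE0.
  rewrite leeDr //; apply: sume_ge0 => j _; exact: DE0.
have mv k : cmeasurable setT (v k).
  have [[m1 m2] _] := lu k.
  have E : v k = fun x => (\1_N x)%:C%C * u k x.
    apply/funext => x; rewrite /v indicE; case: (x \in N) => /=.
      by rewrite mul1r.
    by rewrite mul0r.
  rewrite E; apply: cmeasM => //; apply: cmeas_real; exact: measurable_indic.
have hRe x : cvgn (fun k => cRe (v k x)) /\
    forall k, `|limn (fun k => cRe (v k x)) - cRe (v k x)| <= 2 * c x * 2^-1 ^+ k.
  by apply: geometric_cvg => k; apply: le_trans (hv x k); rewrite -ReN -ReD abs_Re.
have hIm x : cvgn (fun k => cIm (v k x)) /\
    forall k, `|limn (fun k => cIm (v k x)) - cIm (v k x)| <= 2 * c x * 2^-1 ^+ k.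
  by apply: geometric_cvg => k; apply: le_trans (hv x k); rewrite -ImN -ImD abs_Im.
pose X x : R[i] := Complex (limn (fun k => cRe (v k x))) (limn (fun k => cIm (v k x))).
have mX : cmeasurable setT X.
  split.
  - apply: (@measurable_fun_cvg _ _ _ _ (fun k x => cRe (v k x))).
      by move=> k; case: (mv k).
    by move=> x _; exact: (hRe x).1.
  - apply: (@measurable_fun_cvg _ _ _ _ (fun k x => cIm (v k x))).
      by move=> k; case: (mv k).
    by move=> x _; exact: (hIm x).1.
(* Real and imaginary parts are each within 2 c 2^-k of their limits, with c^2 = S; hence the
   constant 8 = 4 + 4. *)
have bound k x : ((cmod (X x - v k x) ^+ 2)%:E <= (8 * 4^-1 ^+ k)%:E * S x)%E.
  have [Nx|Nx] := pselect (N x); last first.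
    have -> : X x - v k x = 0.
      rewrite vN0 // subr0 /X.
      have z1 : (fun k => cRe (v k x)) = cst 0 by apply/funext => j; rewrite vN0.
      have z2 : (fun k => cIm (v k x)) = cst 0 by apply/funext => j; rewrite vN0.
      by rewrite z1 z2 !lim_cst.
    by rewrite ComplexField.Normc.normc0 expr0n mule_ge0 // lee_fin mulr_ge0 // exprn_ge0.
  have Sf : S x = (c x ^+ 2)%:E by rewrite sqr_sqrtr ?fine_ge0 // fineK // ge0_fin_numE.
  rewrite Sf -EFinM lee_fin cmodE !ReImE /=.
  have h1 := (hRe x).2 k; have h2 := (hIm x).2 k.
  have sq (y z : R) : 0 <= z -> `|y| <= z -> y ^+ 2 <= z ^+ 2.
    by move=> z0 yz; rewrite -[y ^+ 2]real_normK ?num_real // lerXn2r ?nnegrE.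
  have z0 : 0 <= 2 * c x * 2^-1 ^+ k by rewrite !mulr_ge0 // exprn_ge0.
  have := sq _ _ z0 h1; have := sq _ _ z0 h2; rewrite !exprMn.
  have -> : (2^-1 ^+ k ^+ 2 : R) = 4^-1 ^+ k by rewrite exprAC expr2; congr (_ ^+ _); lra.
  lra.
have bound2 k : (sqnorm mu setT (fun x => (X x - u k x)%R) <= (16 * 4^-1 ^+ k)%:E)%E.
  have -> : sqnorm mu setT (fun x => X x - u k x) = sqnorm mu setT (fun x => X x - v k x).
    apply: sqnorm_ae.
    - by apply: cmeasB => //; case: (lu k).
    - exact: cmeasB.
    - by apply: filterS aeN => x Nx; rewrite vN.
  apply: (@le_trans _ _ (\int[mu]_x ((8 * 4^-1 ^+ k)%:E * S x))%E).
    apply: ge0_le_integral => //.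
    - by move=> x _; rewrite lee_fin sqr_ge0.
    - by apply/measurable_EFinP; apply: meas_cmod2; exact: cmeasB.
    - by apply: emeasurable_funM => //; exact: measurable_cst.
  rewrite ge0_integralZl ?lee_fin ?mulr_ge0 ?exprn_ge0 //.
  have k0 : (0%:E <= (8 * 4^-1 ^+ k : R)%:E)%E by rewrite lee_fin mulr_ge0 // exprn_ge0.
  apply: le_trans (lee_wpmul2l k0 IS) _.
  by rewrite -EFinM lee_fin; lra.
have lXu k : L2 mu setT (fun x => X x - u k x).
  split; first by apply: cmeasB => //; case: (lu k).
  by apply: le_lt_trans (bound2 k) _; rewrite ltry.
exists X; last by move=> k; rewrite -lee_fin -sqnorm_ip2.
have := L2_D (lXu 0%N) (lu 0%N).
by under eq_fun do rewrite subrK.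
Qed.

Definition L2h : hspace (T -> R[i]^o).
Proof.
refine (@HSpace R (T -> R[i]^o) (L2 mu setT) (ip2 mu) _ _ _ _ _ _).
- exact: L2_cst0.
- by move=> a x y lx ly; apply: L2_D => //; exact: L2_Z.
- by move=> a x y z; exact: ip2_comb.
- by move=> x y; exact: ip2_conj.
- by move=> x _; exact: ip2_ge0.
- move=> u lu hu; have [X lX hX] := @L2_complete u lu hu.
  exists X => // e e0.
  have e1 : 0 < e / 16 by lra.
  have /cvgrPdist_lt/(_ _ e1) : (fun k : nat => (4^-1 : R) ^+ k) @ \oo --> (0 : R).
    by apply: cvg_expr; rewrite ger0_norm ?invr_ge0 // invf_lt1 // ltr1n.
  case=> n _ hn; exists n => k /hn /=; rewrite sub0r normrN ger0_norm ?exprn_ge0 ?invr_ge0 //.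
  by move=> h; apply: le_lt_trans (hX k) _; lra.
Defined.

End L2Complete.

(** * Norms, closed spans and stochastic integrals in Hilbert space form *)

Section Bridge.
Context {R : realType}.

Lemma lin_funE (T : Type) (m : nat) (c : 'I_m -> R[i]) (Y : 'I_m -> T -> R[i]^o) :
  \sum_(i < m) c i *: Y i = (fun w => \sum_(i < m) c i * Y i w).
Proof. by apply/funext => w; rewrite fct_sumE. Qed.

Lemma lin_prodE (V1 V2 : lmodType R[i]) (m : nat) (c : 'I_m -> R[i]) (Y : 'I_m -> V1 * V2) :
  \sum_(i < m) c i *: Y i = (\sum_(i < m) c i *: (Y i).1, \sum_(i < m) c i *: (Y i).2).
Proof.
rewrite (surjective_pairing (\sum_(i < m) c i *: Y i)).
by congr pair; apply: (big_morph _ _ _).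
Qed.

Context {d : measure_display} {T : measurableType d} (mu : {measure set T -> \bar R}).

Lemma nrm_sqnorm f : L2 mu setT f -> sqnorm mu setT f = (nrm (L2h mu) f)%:E.
Proof. exact: sqnorm_ip2. Qed.

Lemma nrm_ae f : L2 mu setT f -> nrm (L2h mu) f = 0 -> {ae mu, forall x, f x = 0}.
Proof. exact: ip2_nrm0. Qed.

Lemma nrmB_ae f g : L2 mu setT f -> L2 mu setT g -> nrm (L2h mu) (f - g) = 0 ->
  {ae mu, forall x, f x = g x}.
Proof.
move=> lf lg /nrm_ae h; have lfg : L2 mu setT (f - g) by exact: (@domB _ _ (L2h mu)).
apply: filterS (h lfg) => x; rewrite /GRing.add /= /GRing.opp /= => /eqP.
by rewrite subr_eq0 => /eqP.
Qed.

Lemma L2_sub f g : L2 mu setT f -> L2 mu setT g -> L2 mu setT (fun x => f x - g x).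
Proof. exact: (@domB _ _ (L2h mu)). Qed.

(** The pairs (f, I) and (g, I) are at distance 0. *)
Lemma ae_clos (V : lmodType R[i]) (H : hspace V) (S : set ((T -> R[i]^o) * V)) f g I :
  S `<=` hdom (hprod (L2h mu) H) ->
  clos (hprod (L2h mu) H) S (f, I) -> L2 mu setT g -> {ae mu, forall x, f x = g x} ->
  clos (hprod (L2h mu) H) S (g, I).
Proof.
move=> SD c lg fg; have [lf dI] := clos_dom c.
apply: clos_limit => // e e0; exists (f, I) => //.
rewrite nrm_prod /= subrr nrm0 addr0 /nrm.
have lgf := L2_sub lg lf.
have -> : hip (L2h mu) (g - f) (g - f) = 0; last by [].
change (ip2 mu (g - f) (g - f) = 0).
have <- : ip2 mu (fun _ => 0) (g - f) = 0 by exact: (@ip0l _ _ (L2h mu)).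
apply: ip2_ae; [by case: lgf|exact: cmeas_cst|by case: lgf|].
by apply: filterS fg => x h; rewrite /GRing.add /= /GRing.opp /= h subrr.
Qed.

End Bridge.

Section RandomBridge.
Context {R : realType} {d : measure_display} {T : measurableType d} (P : probability T R).
Implicit Types (S : set (T -> R[i])).

Lemma closed_spanE S : S `<=` L2 P setT -> closed_span P S = clos (L2h P) S.
Proof.
move=> SL; apply/seteqP; split => X [lX h]; split=> // e e0.
  have [m [c [Y [SY hY]]]] := h e e0.
  exists (\sum_(i < m) c i *: (Y i : T -> R[i]^o)); first by exists m, c, Y.
  rewrite -lte_fin -nrm_sqnorm; first by rewrite lin_funE.
  rewrite lin_funE; apply: L2_sub => //; rewrite -lin_funE.
  by apply: (@lin_dom _ _ (L2h P) _ SL); exists m, c, Y.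
have [_ [m [c [Y [SY ->]]]] hY] := h e e0.
exists m, c, Y; split=> //.
have lS : L2 P setT (\sum_(i < m) c i *: (Y i : T -> R[i]^o)).
  by apply: (@lin_dom _ _ (L2h P) _ SL); exists m, c, Y.
move: hY; rewrite -lte_fin -nrm_sqnorm; first by rewrite lin_funE.
exact: L2_sub.
Qed.

(** Elementary stochastic integrals. The closure of this set in the product space is the graph of
    the integral against Z, because [is_Z_integral] asks for the same coefficients to approximate in
    both coordinates. [span_eta] plays this role for eta. *)
Definition span_Z (Z : set R -> T -> R[i]) : set ((measurableTypeR R -> R[i]^o) * (T -> R[i]^o)) :=
  [set p | exists2 A : set (measurableTypeR R), measurable A &
    p = (fun x => (\1_A x : R)%:C%C, Z A)].

Definition span_eta (eta : R -> T -> R[i]) : set ((measurableTypeR R -> R[i]^o) * (T -> R[i]^o)) :=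
  [set p | exists u v : R, u <= v /\
    p = (fun s => (\1_(`]u, v]%classic) s : R)%:C%C, (fun w => eta v w - eta u w))].

Lemma is_Z_integralE (F : {finite_measure set (measurableTypeR R) -> \bar R}) Z g I :
  span_Z Z `<=` hdom (hprod (L2h F) (L2h P)) ->
  is_Z_integral P F Z g I <-> clos (hprod (L2h F) (L2h P)) (span_Z Z) (g, I).
Proof.
move=> SD; split => [[lg lI h]|[[lg lI] h]].
  split=> // e e0; have e2 : 0 < e / 2 by lra.
  have [m [c [A [mA h1 h2]]]] := h _ e2.
  pose Y (i : 'I_m) : (measurableTypeR R -> R[i]^o) * (T -> R[i]^o) :=
    (fun x => (\1_(A i) x : R)%:C%C, Z (A i)).
  have SY i : span_Z Z (Y i) by exists (A i).
  have lY : lin (span_Z Z) (\sum_(i < m) c i *: Y i) by exists m, c, Y.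
  exists (\sum_(i < m) c i *: Y i) => //.
  have [l1 l2] := lin_dom SD lY.
  rewrite nrm_prod; move: l1 l2; rewrite lin_prodE /= => l1 l2.
  have k1 : nrm (L2h F) (g - \sum_(i < m) c i *: (Y i).1) < e / 2.
    by rewrite -lte_fin -nrm_sqnorm; [rewrite lin_funE|exact: L2_sub].
  have k2 : nrm (L2h P) (I - \sum_(i < m) c i *: (Y i).2) < e / 2.
    by rewrite -lte_fin -nrm_sqnorm; [rewrite lin_funE|exact: L2_sub].
  by have := ltrD k1 k2; rewrite -splitr.
split=> // e e0; have [y ly hy] := h e e0.
have [l1 l2] := lin_dom SD ly.
have [m [c [Y [SY yE]]]] := ly.
have /choice[A hA] : forall i, exists A : set (measurableTypeR R), measurable A /\
  Y i = (fun x => (\1_A x : R)%:C%C, Z A).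
  by move=> i; have [A mA YA] := SY i; exists A.
have d1 := L2_sub lg l1; have d2 := L2_sub lI l2.
move: hy; rewrite nrm_prod /= => hy.
have n1 : nrm (L2h F) (g - y.1) < e.
  by apply: le_lt_trans hy; rewrite lerDl; exact: (@nrm_ge0 _ _ (L2h P)).
have n2 : nrm (L2h P) (I - y.2) < e.
  by apply: le_lt_trans hy; rewrite lerDr; exact: (@nrm_ge0 _ _ (L2h F)).
have y1 : y.1 = (fun x => \sum_(i < m) c i * (\1_(A i) x : R)%:C%C).
  have -> : y.1 = \sum_(i < m) c i *: (Y i).1 by rewrite yE lin_prodE.
  rewrite lin_funE; apply/funext => x.
  by apply: eq_bigr => i _; rewrite (hA i).2.
have y2 : y.2 = (fun x => \sum_(i < m) c i * Z (A i) x).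
  have -> : y.2 = \sum_(i < m) c i *: (Y i).2 by rewrite yE lin_prodE.
  rewrite lin_funE; apply/funext => x.
  by apply: eq_bigr => i _; rewrite (hA i).2.
exists m, c, A; split; first by move=> i; exact: (hA i).1.
- by move: n1; rewrite -lte_fin -nrm_sqnorm // y1.
- by move: n2; rewrite -lte_fin -nrm_sqnorm // y2.
Qed.

Lemma is_eta_integral_clos eta g I :
  span_eta eta `<=` hdom (hprod (L2h (leb R)) (L2h P)) ->
  is_eta_integral P eta g I -> clos (hprod (L2h (leb R)) (L2h P)) (span_eta eta) (g, I).
Proof.
move=> SD [lg lI h]; split=> // e e0; have e2 : 0 < e / 2 by lra.
have [m [c [u [v [uv h1 h2]]]]] := h _ e2.
pose Y (i : 'I_m) : (measurableTypeR R -> R[i]^o) * (T -> R[i]^o) :=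
  (fun s => (\1_(`]u i, v i]%classic) s : R)%:C%C, (fun w => eta (v i) w - eta (u i) w)).
have SY i : span_eta eta (Y i) by exists (u i), (v i).
have lY : lin (span_eta eta) (\sum_(i < m) c i *: Y i) by exists m, c, Y.
exists (\sum_(i < m) c i *: Y i) => //.
have [l1 l2] := lin_dom SD lY.
rewrite nrm_prod; move: l1 l2; rewrite lin_prodE /= => l1 l2.
have k1 : nrm (L2h (leb R)) (g - \sum_(i < m) c i *: (Y i).1) < e / 2.
  by rewrite -lte_fin -nrm_sqnorm; [rewrite lin_funE|exact: L2_sub].
have k2 : nrm (L2h P) (I - \sum_(i < m) c i *: (Y i).2) < e / 2.
  by rewrite -lte_fin -nrm_sqnorm; [rewrite lin_funE|exact: L2_sub].
by have := ltrD k1 k2; rewrite -splitr.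
Qed.

End RandomBridge.

Lemma ae_and (R : realType) (d : measure_display) (T : measurableType d)
    (mu : {measure set T -> \bar R}) (P Q : T -> Prop) :
  {ae mu, forall x, P x} -> {ae mu, forall x, Q x} -> {ae mu, forall x, P x /\ Q x}.
Proof. by move=> hP hQ; exact: filterI. Qed.

Lemma ae_imp (R : realType) (d : measure_display) (T : measurableType d)
    (mu : {measure set T -> \bar R}) (P Q : T -> Prop) :
  {ae mu, forall x, P x} -> (forall x, P x -> Q x) -> {ae mu, forall x, Q x}.
Proof. by move=> hP PQ; exact: filterS hP. Qed.

(** * Fubini's theorem for complex-valued integrands *)

Section RealFubini.
Context {R : realType} {d1 d2 : measure_display}.
Context {T1 : measurableType d1} {T2 : measurableType d2}.
Context (m1 : {sigma_finite_measure set T1 -> \bar R}).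
Context (m2 : {sigma_finite_measure set T2 -> \bar R}).
Variable h : T1 * T2 -> R.
Hypothesis hI : (m1 \x m2)%E.-integrable setT (fun z => (h z)%:E).

(** Inner integrals may be infinite on a null set; [fine] makes them real without changing the outer
    integral. *)
Let fineE (d : measure_display) (T : measurableType d)
    (m : {measure set T -> \bar R}) (g : T -> \bar R) : m.-integrable setT g ->
  m.-integrable setT (fun x => (fine (g x))%:E) /\
  (\int[m]_x (fine (g x))%:E = \int[m]_x g x)%E.
Proof.
move=> gI; have mg := measurable_int _ gI.
have mf : measurable_fun setT (fun x => (fine (g x))%:E).
  by apply/measurable_EFinP; exact: (measurableT_comp (fine_measurable measurableT) mg).
split.
  apply: le_integrable gI => // x _; case: (g x) => [r| |] //=; by rewrite leey.
apply: ae_eq_integral => //.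
by apply: filterS (integrable_ae measurableT gI) => x hx /hx; exact: fineK.
Qed.

Let integrable_G : m2.-integrable setT (fubini_G m1 (fun z => (h z)%:E)).
Proof.
apply/integrableP; split; first exact: measurable_fubini_G hI.
have mh := measurable_int _ hI.
have mah := measurableT_comp (@abse_measurable _ setT) mh.
apply: le_lt_trans ((integrable21ltyP m1 m2 mh).1 hI); apply: ge0_le_integral => //.
- by apply: measurableT_comp => //; exact: measurable_fubini_G hI.
- by apply: (@measurable_fun_fubini_tonelli_G _ _ _ _ _ m1 (fun z => `|(h z)%:E|)%E).
- move=> y _; apply: le_abse_integral => //.
  exact: (measurableT_comp mh (pair2_measurable y)).
Qed.

Lemma Rfubini_integrable :
  m1.-integrable setT (fun x => (\int[m2]_y h (x, y))%R%:E).
Proof. exact: (fineE (integrable_fubini_F hI)).1. Qed.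

Lemma Rfubini_integrable2 :
  m2.-integrable setT (fun y => (\int[m1]_x h (x, y))%R%:E).
Proof. exact: (fineE integrable_G).1. Qed.

Lemma Rfubini : (\int[m1]_x \int[m2]_y h (x, y))%R = (\int[m2]_y \int[m1]_x h (x, y))%R.
Proof.
congr fine.
exact: etrans (fineE (integrable_fubini_F hI)).2 (etrans (Fubini hI) (esym (fineE integrable_G).2)).
Qed.

End RealFubini.

Section ComplexFubini.
Context {R : realType} {d1 d2 : measure_display}.
Context {T1 : measurableType d1} {T2 : measurableType d2}.
Context (m1 : {sigma_finite_measure set T1 -> \bar R}).
Context (m2 : {sigma_finite_measure set T2 -> \bar R}).
Variable K : T1 -> T2 -> R[i].
Hypothesis mK : cmeasurable [set: T1 * T2] (fun z => K z.1 z.2).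
Hypothesis IK : (\int[m1]_x \int[m2]_y (cmod (K x y))%:E < +oo)%E.

Let prod_int (h : T1 * T2 -> R) : measurable_fun setT h ->
  (forall z, `|h z| <= cmod (K z.1 z.2)) ->
  (m1 \x m2)%E.-integrable setT (fun z => (h z)%:E).
Proof.
move=> mh hK.
apply/integrable12ltyP; first exact/measurable_EFinP.
apply: le_lt_trans IK; apply: ge0_le_integral => //.
- by move=> x _; exact: integral_ge0.
- apply: (@measurable_fun_fubini_tonelli_F _ _ _ _ _ m2 (fun z => `|(h z)%:E|)%E).
    by apply: measurableT_comp => //; exact/measurable_EFinP.
  by [].
- apply: (@measurable_fun_fubini_tonelli_F _ _ _ _ _ m2 (fun z => (cmod (K z.1 z.2))%:E)%E).
    by apply/measurable_EFinP; exact: meas_cmod.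
  by move=> z; rewrite lee_fin cmod_ge0.
- move=> x _; apply: ge0_le_integral => //.
  + apply: measurableT_comp => //; apply/measurable_EFinP.
    exact: (measurableT_comp mh (pair1_measurable x)).
  + apply/measurable_EFinP.
    exact: (measurableT_comp (meas_cmod mK) (pair1_measurable x)).
  + by move=> y _; rewrite lee_fin; exact: (hK (x, y)).
Qed.

Let IRe := prod_int mK.1 (fun z => abs_Re _).
Let IIm := prod_int mK.2 (fun z => abs_Im _).

Lemma cfubini_integrable : cintegrable m1 setT (fun x => cintegral m2 setT (K x)).
Proof.
by apply/cintegrableP => //; split;
  [exact: (Rfubini_integrable IRe)|exact: (Rfubini_integrable IIm)].
Qed.

Lemma cfubini_integrable2 :
  cintegrable m2 setT (fun y => cintegral m1 setT (fun x => K x y)).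
Proof.
by apply/cintegrableP => //; split;
  [exact: (Rfubini_integrable2 IRe)|exact: (Rfubini_integrable2 IIm)].
Qed.

Lemma cfubini : cintegral m1 setT (fun x => cintegral m2 setT (K x)) =
  cintegral m2 setT (fun y => cintegral m1 setT (fun x => K x y)).
Proof. by congr Complex; [exact: (Rfubini IRe)|exact: (Rfubini IIm)]. Qed.

End ComplexFubini.

(** * Functions determined by their integrals over intervals *)

Section IntervalUniqueness.
Context {R : realType}.

(** By Lebesgue differentiation, g x is for almost every x the limit of the averages of g over ]x, x
    + 1 / (n + 1)], and these vanish as soon as the intervals lie in D. *)
Lemma ae0_of_intervals (g : R -> R) (D : set R) : open D ->
  (forall a b : R, (leb R).-integrable `]a, b] (fun x => (g x)%:E)) ->
  (forall a b : R, a <= b -> `]a, b] `<=` D -> (\int[leb R]_(x in `]a, b]) g x)%R = 0) ->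
  {ae leb R, forall x, D x -> g x = 0}.
Proof.
move=> oD gI g0.
have mg : measurable_fun setT g.
  have -> : [set: R] = \bigcup_(k : nat) `]- k%:R, k%:R]%classic.
    apply/seteqP; split => // x _ /=.
    exists (Num.truncn `|x|).+1 => //=; rewrite in_itv /=.
    have h : `|x| < (Num.truncn `|x|).+1%:R by exact: truncnS_gt.
    by move: h; rewrite ltr_norml => /andP[-> /ltW ->].
  apply/measurable_fun_bigcup => // k.
  by apply/measurable_EFinP; exact: measurable_int (gI _ _).
have lg : locally_integrable setT g.
  split=> //; first exact: openT.
  move=> K _ cK.
  have [M [_ hM]] := compact_bounded cK.
  have KS : K `<=` `](- (`|M| + 1) - 1), (`|M| + 1)].
    move=> x Kx; have M1 : M < `|M| + 1 by rewrite (le_lt_trans (ler_norm M)) // ltrDl.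
    have := hM _ M1 _ Kx.
    rewrite /= ler_norml in_itv /= => /andP[h1 h2]; apply/andP; split=> //.
    by apply: lt_le_trans h1; lra.
  have /integrableP[_ +] := gI (- (`|M| + 1) - 1) (`|M| + 1).
  apply: le_lt_trans; apply: ge0_subset_integral => //.
  - exact: compact_measurable.
  - by apply/measurable_EFinP; apply: measurableT_comp => //; exact: measurable_funTS.
apply: (ae_imp (lebesgue_differentiation lg)) => x lx Dx.
pose e n : R := n.+1%:R^-1.
have e0 n : 0 < e n by rewrite invr_gt0.
pose E y n : set R := `]y, y + e n]%classic.
have muE y n : (leb R) (E y n) = (e n)%:E.
  by rewrite /E lebesgue_measure_itv /= lte_fin ltrDl e0 -EFinD addrAC subrr add0r.
have nice_E y : nicely_shrinking y (E y).
  split=> [n|]; first exact: measurable_itv.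
  have e2 n : 0 < 2 * e n by rewrite mulr_gt0.
  (* The ball of radius 2 e n around y contains ]y, y + e n] and has measure 4 e n. *)
  exists (4, fun n => PosNum (e2 n)); split => //=.
  - rewrite -[X in _ --> X](mulr0 2); apply: cvgM; first exact: cvg_cst.
    exact: cvg_harmonic.
  - move=> n z; rewrite /E /= in_itv /= /ball /= => /andP[h1 h2].
    by have := e0 n; rewrite ltr_distlC => h; apply/andP; split; lra.
  - move=> n; rewrite (lebesgue_measure_ball _ (ltW _)) ?mulr_gt0 // muE -EFinM lee_fin.
    by rewrite -mulr_natl; have := e0 n; lra.
have := nice_lebesgue_differentiation nice_E lg lx.
have [r /= r0 rD] := oD _ Dx.
have z0 : \forall n \near \oo, ((leb R (E x n))^-1 * \int[leb R]_(y in E x n) (g y)%:E = 0)%E.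
  have [n0 _ hn0] : \forall n \near \oo, `|0 - e n| < r.
    by have /cvgrPdist_lt := @cvg_harmonic R; apply.
  exists n0 => // n /hn0; rewrite /= sub0r normrN gtr0_norm // => en.
  have ED : E x n `<=` D.
    move=> z; rewrite /E /= in_itv /= => /andP[h1 h2]; apply: rD => /=.
    by rewrite ltr_distlC; apply/andP; split; lra.
  have := g0 x (x + e n); rewrite lerDl ltW // => /(_ isT ED).
  rewrite /Rintegral => h.
  have I : (\int[leb R]_(y in E x n) (g y)%:E)%E \is a fin_num.
    by apply: integrable_fin_num; [exact: measurable_itv|exact: gI].
  by rewrite -(fineK I) h mule0.
move=> h; have : (fun n => (leb R (E x n))^-1 * \int[leb R]_(y in E x n) (g y)%:E)%E @ \oo --> (0 : \bar R).
  by apply: cvg_near_cst.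
by move=> /(cvg_unique _ h) => /(_ (@ereal_hausdorff R)) [].
Qed.

Lemma ae0_of_cintervals (g : R -> R[i]) (D : set R) : open D ->
  (forall a b : R, cintegrable (leb R) `]a, b] g) ->
  (forall a b : R, a <= b -> `]a, b] `<=` D -> cintegral (leb R) `]a, b] g = 0) ->
  {ae leb R, forall x, D x -> g x = 0}.
Proof.
move=> oD gI g0.
have h1 : {ae leb R, forall x, D x -> cRe (g x) = 0}.
  apply: ae0_of_intervals => //.
    by move=> a b; have /cintegrableP[] := gI a b; first exact: measurable_itv.
  by move=> a b ab sD; have := congr1 (@complex.Re R) (g0 a b ab sD).
have h2 : {ae leb R, forall x, D x -> cIm (g x) = 0}.
  apply: ae0_of_intervals => //.
    by move=> a b; have /cintegrableP[] := gI a b; first exact: measurable_itv.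
  by move=> a b ab sD; have := congr1 (@complex.Im R) (g0 a b ab sD).
by apply: (ae_imp (ae_and h1 h2)) => x [r0 i0] Dx; apply: ReImP; rewrite ?r0 ?i0.
Qed.

End IntervalUniqueness.

(** * Fourier transforms of indicators and changes of variable *)

Section CexpFacts.
Context {R : realType}.
Implicit Types (x y : R).

Lemma cexpD x y : cexp (x + y) = cexp x * cexp y.
Proof.
apply: ReImP; rewrite ?ReM ?ImM /=; first exact: cosD.
by rewrite sinD addrC mulrC (mulrC (sin x)) addrC mulrC.
Qed.

Lemma cmod_cexp x : cmod (cexp x) = 1.
Proof. by rewrite /= cos2Dsin2 sqrtr1. Qed.

Lemma cmeas_cexp (d : measure_display) (T : measurableType d) (D : set T) (g : T -> R) :
  measurable_fun D g -> cmeasurable D (fun z : T => cexp (g z)).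
Proof.
move=> mg; split => /=.
- by apply: (measurableT_comp _ mg); apply: continuous_measurable_fun; exact: continuous_cos.
- by apply: (measurableT_comp _ mg); apply: continuous_measurable_fun; exact: continuous_sin.
Qed.

End CexpFacts.

Section Restriction.
Context {R : realType} {d : measure_display} {T : measurableType d}.
Context (mu : {measure set T -> \bar R}) (D : set T) (mD : measurable D).
Implicit Types (f : T -> R[i]).

(** A product with an indicator rather than a conditional, so that measurability follows from that
    of products, also for the kernels in Fubini's theorem. *)
Definition cut f x : R[i] := (\1_D x : R)%:C%C * f x.

Lemma cutE f x : D x -> cut f x = f x.
Proof. by move=> Dx; rewrite /cut indicE mem_set //= mul1r. Qed.

Lemma cutN f x : ~ D x -> cut f x = 0.
Proof. by move=> Dx; rewrite /cut indicE memNset //= mul0r. Qed.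

Lemma cutP f x : cut f x = if x \in D then f x else 0.
Proof. by rewrite /cut indicE; case: (x \in D); rewrite /= ?mul1r ?mul0r. Qed.

Lemma cut_Re f : (fun x => cRe (cut f x)) = (fun x => cRe (f x)) \_ D.
Proof. by apply/funext => x; rewrite patchE cutP; case: ifP. Qed.

Lemma cut_Im f : (fun x => cIm (cut f x)) = (fun x => cIm (f x)) \_ D.
Proof. by apply/funext => x; rewrite patchE cutP; case: ifP. Qed.

Lemma cmeas_cut f : cmeasurable D f <-> cmeasurable setT (cut f).
Proof.
rewrite /cmeasurable cut_Re cut_Im.
by split=> -[h1 h2]; split; apply/(measurable_restrictT _ mD).
Qed.

Lemma cintegral_cut f : cintegral mu D f = cintegral mu setT (cut f).
Proof.
by rewrite /cintegral cut_Re cut_Im; congr Complex; exact: Rintegral_mkcond.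
Qed.

Lemma cut_cmod_integral f : (\int[mu]_(x in D) (cmod (f x))%:E = \int[mu]_x (cmod (cut f x))%:E)%E.
Proof.
rewrite integral_mkcond; apply: eq_integral => x _.
by rewrite patchE cutP; case: ifP => // _; rewrite ComplexField.Normc.normc0.
Qed.

Lemma cintegrable_cut f : cintegrable mu D f <-> cintegrable mu setT (cut f).
Proof.
rewrite /cintegrable cut_cmod_integral.
by split=> -[h1 h2]; split=> //; apply/cmeas_cut.
Qed.

Lemma sqnorm_cut f : sqnorm mu D f = sqnorm mu setT (cut f).
Proof.
rewrite /sqnorm integral_mkcond; apply: eq_integral => x _.
by rewrite patchE cutP; case: ifP => // _; rewrite ComplexField.Normc.normc0 expr0n.
Qed.

Lemma L2_cut f : L2 mu D f <-> L2 mu setT (cut f).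
Proof.
rewrite /L2 sqnorm_cut.
by split=> -[h1 h2]; split=> //; apply/cmeas_cut.
Qed.

Lemma sqnorm_cut_le f : cmeasurable setT f -> (sqnorm mu setT (cut f) <= sqnorm mu setT f)%E.
Proof.
move=> mf; apply: ge0_le_integral => //.
- by move=> x _; rewrite lee_fin sqr_ge0.
- apply/measurable_EFinP; apply: meas_cmod2; apply: cmeasM => //.
  by apply: cmeas_real; exact: measurable_indic.
- by apply/measurable_EFinP; exact: meas_cmod2.
- move=> x _; rewrite lee_fin cutP; case: ifP => // _.
  by rewrite ComplexField.Normc.normc0 expr0n sqr_ge0.
Qed.

End Restriction.

Lemma cintegral0 (R : realType) (d : measure_display) (T : measurableType d)
  (mu : {measure set T -> \bar R}) (D : set T) : cintegral mu D (fun _ => 0) = 0.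
Proof. by apply: ReImP; rewrite /= /Rintegral integral0_eq. Qed.

(** * Passage from the spectral measure to its density *)

Section Density.
Context {R : realType} (F : {finite_measure set (measurableTypeR R) -> \bar R}).
Context (f : R -> R) (F_dens : spectral_density F f).
Context (Phi : R -> R[i]) (mPhi : cmeasurable [set: measurableTypeR R] Phi).
Hypothesis fPhi : {ae leb R, forall x, f x = cmod (Phi x) ^+ 2}.

Let mT : measurable [set: measurableTypeR R] := measurableT.

Lemma density_dominated : F `<< leb R.
Proof.
apply/null_content_dominatesP => A mA A0.
have [mf f0 ->] := F_dens => //.
apply: null_set_integral => //; apply/measurable_EFinP.
by apply: measurable_funM; [exact: measurable_funTS|exact: measurable_cst].
Qed.

Lemma density_ae (Q : R -> Prop) : {ae leb R, forall x, Q x} -> {ae F, forall x, Q x}.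
Proof.
move=> [A [mA A0 sA]]; exists A; split=> //.
by have /null_content_dominatesP := density_dominated; apply.
Qed.

Let dens x : \bar R := (f x / (2 * pi))%:E.

Let mdens : measurable_fun setT dens.
Proof.
have [mf _ _] := F_dens; apply/measurable_EFinP.
by apply: measurable_funM => //; exact: measurable_cst.
Qed.

(** The Radon-Nikodym derivative of F and f / (2 pi) have the same integral over every measurable
    set, hence agree almost everywhere. *)
Lemma density_integral (k : R -> \bar R) : measurable_fun setT k -> (forall x, 0 <= k x)%E ->
  (\int[F]_x k x = \int[leb R]_x (k x * (f x / (2 * pi))%:E))%E.
Proof.
move=> mk k0.
rewrite -(Radon_Nikodym_SigmaFinite.change_of_variables density_dominated) //.
have mg := measurable_int _ (Radon_Nikodym_SigmaFinite.f_integrable density_dominated).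
apply: ae_eq_integral => //; try exact: emeasurable_funM.
apply: ae_eqe_mul2l; apply: integral_ae_eq => //.
  exact: Radon_Nikodym_SigmaFinite.f_integrable density_dominated.
move=> E _ mE; rewrite -Radon_Nikodym_SigmaFinite.f_integral //; last exact: density_dominated.
by have [_ _ ->] := F_dens.
Qed.

(** Since dF = |Phi|^2 dlambda / (2 pi), multiplication by Phi maps L_2(F) isometrically into
    L_2(R), up to the factor 2 pi on squared norms. *)
Lemma density_sqnorm (g : R -> R[i]) : cmeasurable [set: measurableTypeR R] g ->
  sqnorm F setT g = ((2 * pi)^-1%:E * sqnorm (leb R) setT (fun x => (g x * Phi x)%R))%E.
Proof.
move=> mgg; rewrite /sqnorm density_integral; last 2 first.
- by apply/measurable_EFinP; exact: meas_cmod2.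
- by move=> x; rewrite lee_fin sqr_ge0.
have mgP := cmeasM mgg mPhi.
rewrite -ge0_integralZl //; last 3 first.
- by apply/measurable_EFinP; exact: meas_cmod2.
- by move=> x _; rewrite lee_fin sqr_ge0.
- by rewrite lee_fin invr_ge0 mulr_ge0 // pi_ge0.
apply: ae_eq_integral => //.
- apply: emeasurable_funM => //; apply/measurable_EFinP; exact: meas_cmod2.
- apply: emeasurable_funM; first exact: measurable_cst.
  by apply/measurable_EFinP; exact: meas_cmod2.
apply: (ae_imp fPhi) => x fx _.
by rewrite fx -!EFinM ComplexField.Normc.normcM exprMn; congr EFin; ring.
Qed.

(** The density vanishes wherever Phi does. This legitimates the division by Phi_tau in L_2(F). *)
Lemma density_Phi_neq0 : {ae F, forall x, Phi x != 0}.
Proof.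
pose A := setT `&` [set x : R | ((cmod (Phi x) ^+ 2)%:E = 0)%E].
have mA : measurable (A : set (measurableTypeR R)).
  have m2 : measurable_fun setT (fun x => (cmod (Phi x) ^+ 2)%:E).
    by apply/measurable_EFinP; exact: meas_cmod2.
  have := m2 mT [set 0%E] (emeasurable_set1 0%E).
  by [].
exists A; split=> //.
  have [_ _ ->] := F_dens => //.
  rewrite (_ : 0%E = \int[leb R]_(x in A) (cst 0%E x))%E; last by rewrite integral0_eq.
  apply: ae_eq_integral => //; first exact: measurable_funTS.
  apply: (ae_imp fPhi) => x fx [_ [h]].
  by rewrite fx h mul0r.
move=> x /= /negP; rewrite negbK => /eqP h; split => //=.
by rewrite h ComplexField.Normc.normc0 expr0n.
Qed.

End Density.

Section IntervalTransform.
Context {R : realType}.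
Implicit Types (a b s : R).

Lemma itv_lty a b : (leb R `]a, b] < +oo)%E.
Proof. by rewrite lebesgue_measure_itv /=; case: ifP => _; rewrite ?ltry // -EFinD ltry. Qed.

Lemma itv_integrable_cst a b (c : R) : (leb R).-integrable `]a, b] (EFin \o (fun _ => c)).
Proof.
have mI : measurable (`]a, b]%classic : set (measurableTypeR R)) by exact: measurable_itv.
apply/integrableP; split; first exact: measurable_cst.
have -> : (\int[leb R]_(x in `]a, b]) `|(EFin \o (fun _ => c)) x| = `|c%:E| * leb R `]a, b])%E.
  exact: (integral_cst (leb R) mI `|c%:E|%E).
apply: lte_mul_pinfty => //; exact: itv_lty.
Qed.

Definition itv_hat a b s : R[i] := cintegral (leb R) `]a, b] (fun x : R => cexp (x * s)).

Let FTC_itv (g G : R -> R) a b : a <= b -> continuous g ->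
  (forall x : R, is_derive x (1 : R) G (g x)) ->
  (\int[leb R]_(x in `]a, b]) g x)%R = G b - G a.
Proof.
move=> ab cg dG; move: ab; rewrite le_eqVlt => /orP[/eqP <-|ab].
  by rewrite subrr set_itv_ge ?Rintegral_set0 // bnd_simp ltxx.
have mg : measurable_fun setT g by exact: continuous_measurable_fun.
rewrite /Rintegral integral_itv_obnd_cbnd; last first.
  by apply/measurable_EFinP; exact: measurable_funTS.
have cG : continuous G.
  by move=> x; apply: differentiable_continuous; apply/derivable1_diffP; exact: ex_derive.
rewrite (@continuous_FTC2 _ g G) //=.
- exact: continuous_subspaceT.
- split.
  + by move=> x _; exact: ex_derive.
  + by apply: cvg_at_right_filter; exact: cG.
  + by apply: cvg_at_left_filter; exact: cG.
- by move=> x _; rewrite derive1E; exact: derive_val.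
Qed.

Lemma itv_hatE a b s : a <= b -> s != 0 ->
  itv_hat a b s = Complex ((sin (b * s) - sin (a * s)) * s^-1)
                          ((cos (a * s) - cos (b * s)) * s^-1).
Proof.
move=> ab s0.
have cs : continuous (fun x : R => x * s).
  by move=> x; apply: cvgM; [exact: cvg_id|exact: cvg_cst].
have ds (x : R) : is_derive x (1 : R) (fun x : R => x * s) s.
  by apply: is_derive_eq; rewrite scaler0 add0r /GRing.scale /= mulr1.
have c1 : continuous (fun x : R => cos (x * s)).
  by move=> x; apply: continuous_comp; [exact: cs|exact: continuous_cos].
have c2 : continuous (fun x : R => sin (x * s)).
  by move=> x; apply: continuous_comp; [exact: cs|exact: continuous_sin].
have d1 (x : R) : is_derive x (1 : R) (fun x : R => sin (x * s) * s^-1) (cos (x * s)).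
  have h := @is_derive1_comp R sin (fun x : R => x * s) x _ _ (is_derive_sin _) (ds x).
  by apply: is_derive_eq; rewrite scaler0 add0r /GRing.scale /=; field.
have d2 (x : R) : is_derive x (1 : R) (fun x : R => - cos (x * s) * s^-1) (sin (x * s)).
  have h := @is_derive1_comp R cos (fun x : R => x * s) x _ _ (is_derive_cos _) (ds x).
  by apply: is_derive_eq; rewrite scaler0 add0r /GRing.scale /=; field.
congr Complex.
- by rewrite (FTC_itv ab c1 d1) mulrBl.
- by rewrite (FTC_itv ab c2 d2); ring.
Qed.

Lemma itv_hat_bound a b s : a <= b -> cmod (itv_hat a b s) ^+ 2 <= 2 * (b - a) ^+ 2.
Proof.
move=> ab.
have key (g : R -> R) : measurable_fun setT g -> (forall x, `|g x| <= 1) ->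
    (\int[leb R]_(x in `]a, b]) g x)%R ^+ 2 <= (b - a) ^+ 2.
  move=> mg g1; have mI : measurable (`]a, b]%classic : set (measurableTypeR R)).
    exact: measurable_itv.
  have I1 : (leb R).-integrable `]a, b] (EFin \o (fun _ : R => 1 : R)).
    exact: itv_integrable_cst.
  have Ig : (leb R).-integrable `]a, b] (EFin \o g).
    apply: le_integrable I1 => //.
      by apply/measurable_EFinP; exact: measurable_funTS.
    by move=> x _ /=; rewrite lee_fin normr1.
  have Ia : (leb R).-integrable `]a, b] (EFin \o (fun x => `|g x|)).
    exact: (integrable_norm Ig).
  have := le_normr_Rintegral mI Ig.
  have h2 := le_Rintegral mI Ia I1 (fun x _ => g1 x).
  have E1 : (\int[leb R]_(x in `]a, b]) (1 : R))%R = b - a.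
    have mE : fine (leb R `]a, b]) = b - a.
      by rewrite lebesgue_measure_itv /= lte_fin; case: ltP ab => // ab1 ab2; rewrite /=; lra.
    by rewrite -mE -[RHS]mul1r; exact: Rintegral_cst.
  move=> h1; rewrite -[X in X <= _]real_normK ?num_real // lerXn2r ?nnegrE ?subr_ge0 //.
  by apply: le_trans h1 _; rewrite -E1.
have ms : measurable_fun [set: R] (fun x : R => x * s).
  by apply: measurable_funM => //; exact: measurable_cst.
rewrite cmodE mulr2n mulrDl mul1r lerD //; apply: key.
- by have [] := cmeas_cexp ms.
- by move=> x; rewrite ler_norml cos_geN1 cos_le1.
- by have [] := cmeas_cexp ms.
- by move=> x; rewrite ler_norml sin_geN1 sin_le1.
Qed.

Lemma oneDsqr_integrable : (leb R).-integrable setT (EFin \o (fun x : R => (oneDsqr x)^-1)).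
Proof.
have c : continuous (fun x : R => (oneDsqr x)^-1) by exact: continuous_oneDsqrV.
have p x : 0 <= (oneDsqr x)^-1 by rewrite invr_ge0 (le_trans ler01) // oneDsqr_ge1.
apply/integrableP; split.
  by apply/measurable_EFinP; exact: continuous_measurable_fun.
under eq_integral do rewrite /= ger0_norm //.
rewrite ge0_symfun_integralT //.
  by rewrite -set_itvcy integral0y_oneDsqr -EFinM ltry.
by move=> x; rewrite /= /oneDsqr sqrrN.
Qed.

Lemma itv_hat_L2 a b : a <= b -> L2 (leb R) setT (itv_hat a b).
Proof.
move=> ab.
(* The closed formula is 0 at s = 0 because 0^-1 = 0; the actual value there is added back on the
   set {0}. *)
pose h0 (s : R) : R[i] := Complex ((sin (b * s) - sin (a * s)) * s^-1)
                          ((cos (a * s) - cos (b * s)) * s^-1).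
have E : itv_hat a b = (fun s => h0 s + (\1_[set 0] s : R)%:C%C * itv_hat a b 0).
  apply/funext => s; rewrite indicE; have [->|s0] := eqVneq s 0.
    rewrite mem_set //= mul1r (_ : h0 0 = 0) ?add0r //.
    by apply: ReImP; rewrite /= invr0 mulr0.
  by rewrite memNset ?mul0r ?addr0 ?itv_hatE //; exact/eqP.
have ml (c : R) : measurable_fun [set: R] (fun s : R => c * s).
  by apply: measurable_funM => //; exact: measurable_cst.
have mi : measurable_fun [set: R] (fun s : R => s^-1).
  have [h _] := cmeasV (cmeas_real (@measurable_id _ R setT)).
  apply: eq_measurable_fun h => x _ /=.
  have [->|x0] := eqVneq x 0; first by rewrite !invr0 mul0r.
  by rewrite expr0n addr0; field.
have mh0 : cmeasurable setT h0.
  have [ca sa] := cmeas_cexp (ml a); have [cb sb] := cmeas_cexp (ml b).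
  by split; apply: measurable_funM => //; apply: measurable_funB.
apply/L2_sq; split.
  rewrite E; apply: cmeasD => //; apply: cmeasM; last exact: cmeas_cst.
  by apply: cmeas_real; apply: measurable_indic; exact: measurable_set1.
(* In the product with 1 + s^2, the summand 1 is covered by [itv_hat_bound], and s^2 cancels the
   denominators of the closed formula, whose numerators have squares summing to at most 8. *)
pose C := 2 * (b - a) ^+ 2 + 8.
have IC := integrable_Zl (measurableT : measurable [set: measurableTypeR R]) C oneDsqr_integrable.
apply: le_integrable IC => //.
  apply/measurable_EFinP; apply: meas_cmod2.
  rewrite E; apply: cmeasD => //; apply: cmeasM; last exact: cmeas_cst.
  by apply: cmeas_real; apply: measurable_indic; exact: measurable_set1.
suff bnd s : cmod (itv_hat a b s) ^+ 2 <= C * (oneDsqr s)^-1.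
  move=> s _; rewrite gee0_abs ?lee_fin ?sqr_ge0 //.
  by apply: le_trans (bnd s) _; exact: ler_norm.
have o1 : 0 < oneDsqr s by apply: lt_le_trans (oneDsqr_ge1 s).
rewrite ler_pdivlMr // /oneDsqr mulrDr mulr1 lerD //; first exact: itv_hat_bound.
have [->|s0] := eqVneq s 0; first by rewrite expr0n mulr0.
rewrite itv_hatE // cmodE /= !exprMn -mulrDl exprVn divfK ?expf_neq0 //.
have := cos2Dsin2 (a * s); have := cos2Dsin2 (b * s).
set ca := cos (a * s); set sa := sin (a * s); set cb := cos _; set sb := sin _.
have := sqr_ge0 (sb + sa); have := sqr_ge0 (ca + cb).
by rewrite !sqrrB !sqrrD; lra.
Qed.

(** Fubini applies because the kernel has modulus 1_I(x) |g(s)|. Transforms are compared through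
    their integrals over intervals, which determine them almost everywhere. *)
Lemma fourier_itv (g : R -> R[i]) a b : cintegrable (leb R) setT g ->
  cintegrable (leb R) `]a, b] (fun x : R => cintegral (leb R) setT (fun s : R => cexp (x * s) * g s))
  /\ cintegral (leb R) `]a, b] (fun x : R => cintegral (leb R) setT (fun s : R => cexp (x * s) * g s))
  = cintegral (leb R) setT (fun s => itv_hat a b s * g s).
Proof.
move=> [mg gI].
pose I : set (measurableTypeR R) := `]a, b]%classic.
have mI : measurable I by exact: measurable_itv.
pose K (x s : R) : R[i] := (\1_I x : R)%:C%C * (cexp (x * s) * g s).
have mK : cmeasurable [set: measurableTypeR R * measurableTypeR R] (fun z => K z.1 z.2).
  apply: cmeasM.
    by apply: cmeas_real; apply: (@measurableT_comp _ _ _ _ _ _ (\1_I : _ -> R) _ fst).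
  apply: cmeasM.
    by apply: cmeas_cexp; apply: measurable_funM.
  have [m1 m2] := mg.
  by split; [exact: (measurableT_comp m1)|exact: (measurableT_comp m2)].
have Kc x : (fun s => cmod (K x s)) = (fun s => \1_I x * cmod (g s)).
  apply/funext => s; rewrite /K !ComplexField.Normc.normcM cmod_cexp mul1r.
  by rewrite /= expr0n addr0 sqrtr_sqr ger0_norm.
have IK : (\int[leb R]_x \int[leb R]_y (cmod (K x y))%:E < +oo)%E.
  under eq_integral => x _.
    under eq_integral => y _ do rewrite (congr1 (fun f => f y) (Kc x)) EFinM.
    rewrite ge0_integralZl ?lee_fin //; last 2 first.
    - by apply/measurable_EFinP; exact: meas_cmod.
    - by move=> y _; rewrite lee_fin cmod_ge0.
    over.
  rewrite ge0_integralZr //; last 2 first.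
  - by apply/measurable_EFinP; exact: measurable_indic.
  - by apply: integral_ge0 => x _; rewrite lee_fin cmod_ge0.
  rewrite integral_indic // setIT; apply: lte_mul_pinfty => //.
    by rewrite ge0_fin_numE //; exact: itv_lty.
have Kin x : cintegral (leb R) setT (K x) =
    cut I (fun x : R => cintegral (leb R) setT (fun s : R => cexp (x * s) * g s)) x.
  rewrite cutP; case: ifPn => xI; apply: etrans.
  - by apply: eq_cintegral => s _; rewrite /K indicE xI mul1r.
  - by [].
  - apply: eq_cintegral => s _.
    by rewrite /K indicE (negbTE xI) mul0r; reflexivity.
  - exact: cintegral0.
split.
  apply/(cintegrable_cut _ mI).
  have := cfubini_integrable mK IK; congr cintegrable; exact/funext.
rewrite (cintegral_cut _ I) -(_ : (fun x => cintegral (leb R) setT (K x)) = cut I _); last exact/funext.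
rewrite (cfubini mK IK); apply: eq_cintegral => s _.
have -> : (fun x => K x s) = (fun x => g s * cut I (fun x : R => cexp (x * s)) x).
  by apply/funext => x; rewrite /K /cut; ring.
rewrite cintegralZ //.
  by rewrite -cintegral_cut mulrC.
apply/(cintegrable_cut _ mI).
apply: (@cintegrable_le _ _ _ _ _ mI _ (fun _ => 1)).
- apply: cmeas_cexp; apply: measurable_funM => //; exact: measurable_cst.
- exact: itv_integrable_cst.
- by move=> x _; rewrite cmod_cexp.
Qed.

End IntervalTransform.

Section ChangeOfVariable.
Context {R : realType}.

(** The image of Lebesgue measure under h agrees with it on intervals, hence on all measurable
    sets. *)
Lemma leb_change (h : R -> R) (g : R -> \bar R) :
  measurable_fun [set: measurableTypeR R] (h : measurableTypeR R -> measurableTypeR R) ->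
  (forall x y, leb R (h @^-1` `]x, y]) = leb R `]x, y]) ->
  measurable_fun [set: measurableTypeR R] g ->
  (\int[leb R]_x g x = \int[leb R]_x g (h x))%E.
Proof.
move=> mh hI mg.
have key (k : R -> \bar R) : measurable_fun [set: measurableTypeR R] k ->
    (forall x, 0 <= k x)%E -> (\int[leb R]_x k x = \int[leb R]_x k (h x))%E.
  move=> mk k0.
  have := @ge0_integral_pushforward _ _ (measurableTypeR R) (measurableTypeR R) R h mh
    (leb R) setT k measurableT mk (fun y _ => k0 y).
  rewrite preimage_setT => <-; apply: eq_measure_integral => A mA _.
  by apply: lebesgue_measure_unique => // _ [[x y] _ <-]; exact/esym/hI.
have k1 := key _ (measurable_funepos mg) (funepos_ge0 g).
have k2 := key _ (measurable_funeneg mg) (funeneg_ge0 g).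
rewrite integralE [RHS]integralE k1 k2.
by congr (_ - _)%E; apply: eq_integral => x _; rewrite ?funeposE ?funenegE.
Qed.

Lemma leb_translate (c : R) (x y : R) :
  leb R ((fun w => c + w) @^-1` `]x, y]) = leb R `]x, y].
Proof.
have -> : (fun w => c + w) @^-1` `]x, y] = `]x - c, y - c]%classic.
  by apply/seteqP; split => w /=; rewrite !in_itv /= => /andP[h1 h2]; apply/andP; split; lra.
rewrite !lebesgue_measure_itv /= !lte_fin ltrD2r; case: ifP => // _.
by rewrite -!EFinD; congr EFin; lra.
Qed.

Lemma leb_reflect (c : R) (x y : R) :
  leb R ((fun w => c - w) @^-1` `]x, y]) = leb R `]x, y].
Proof.
have -> : (fun w => c - w) @^-1` `]x, y] = `[c - y, c - x[%classic.
  by apply/seteqP; split => w /=; rewrite !in_itv /= => /andP[h1 h2]; apply/andP; split; lra.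
rewrite !lebesgue_measure_itv /= !lte_fin ltrD2l ltrN2; case: ifP => // _.
by rewrite -!EFinD; congr EFin; lra.
Qed.

Lemma cintegral_change (h : R -> R) (g : R -> R[i]) :
  measurable_fun [set: measurableTypeR R] (h : measurableTypeR R -> measurableTypeR R) ->
  (forall x y, leb R (h @^-1` `]x, y]) = leb R `]x, y]) ->
  cmeasurable [set: measurableTypeR R] g ->
  cintegral (leb R) setT g = cintegral (leb R) setT (fun x => g (h x)).
Proof.
move=> mh hI [m1 m2]; congr Complex; congr fine;
  by apply: (leb_change mh hI); exact/measurable_EFinP.
Qed.

Lemma meas_addl (c : R) : measurable_fun [set: measurableTypeR R]
  ((fun w => c + w) : measurableTypeR R -> measurableTypeR R).
Proof. by apply: measurable_funD => //; exact: measurable_cst. Qed.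

Lemma meas_subl (c : R) : measurable_fun [set: measurableTypeR R]
  ((fun w => c - w) : measurableTypeR R -> measurableTypeR R).
Proof. by apply: measurable_funB => //; exact: measurable_cst. Qed.

Lemma cmeas_comp (h : R -> R) (g : R -> R[i]) :
  measurable_fun [set: measurableTypeR R] (h : measurableTypeR R -> measurableTypeR R) ->
  cmeasurable [set: measurableTypeR R] g ->
  cmeasurable [set: measurableTypeR R] (fun x => g (h x)).
Proof. by move=> mh [m1 m2]; split; [exact: (measurableT_comp m1)|exact: (measurableT_comp m2)]. Qed.

End ChangeOfVariable.

Section Truncation.
Context {R : realType} {d : measure_display} {T : measurableType d}.
Context (mu : {measure set T -> \bar R}).

Lemma L2_ae (f g : T -> R[i]) : L2 mu setT f -> cmeasurable setT g ->
  {ae mu, forall x, f x = g x} -> L2 mu setT g.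
Proof.
move=> [mf fI] mg fg; split=> //.
by rewrite -(sqnorm_ae mf mg fg).
Qed.

Lemma L2_cutT (D : set T) (f : T -> R[i]) : measurable D -> L2 mu setT f ->
  L2 mu setT (cut D f).
Proof.
move=> mD [mf fI]; split.
  by apply: cmeasM => //; apply: cmeas_real; exact: measurable_indic.
by apply: le_lt_trans fI; exact: sqnorm_cut_le.
Qed.

(** The indicator of a set of finite measure is in L_2, so f cut to D is a product of two functions
    of L_2. *)
Lemma L2_fin_cintegrable (D : set T) (f : T -> R[i]) : measurable D -> (mu D < +oo)%E ->
  L2 mu setT f -> cintegrable mu D f.
Proof.
move=> mD muD lf.
have l1 : L2 mu setT (fun x => (\1_D x : R)%:C%C).
  split; first by apply: cmeas_real; exact: measurable_indic.
  rewrite /sqnorm; under eq_integral => x _.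
    rewrite (_ : cmod _ ^+ 2 = \1_D x); last first.
      by rewrite cmodE /= expr0n addr0 indicE; case: (x \in D); rewrite /= ?expr1n ?expr0n.
    over.
  by rewrite integral_indic // setIT.
apply/(cintegrable_cut _ mD).
have := L2_mul lf l1; congr cintegrable; apply/funext => x.
by rewrite /cut mulrC; congr (_ * _); rewrite /= oppr0.
Qed.

Lemma truncation_cvg (D : nat -> set T) (f : T -> R[i]) : (forall k, measurable (D k)) ->
  (forall x, exists N, forall k, (N <= k)%N -> D k x) -> L2 mu setT f ->
  (fun k => sqnorm mu setT (fun x => f x - cut (D k) f x)) @ \oo --> 0%E.
Proof.
move=> mD hD lf; have [mf fI] := (L2_sq mu f).1 lf.
have mcut k : cmeasurable setT (cut (D k) f).
  by apply: cmeasM => //; apply: cmeas_real; exact: measurable_indic.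
have := @dominated_convergence _ _ _ mu setT measurableT
  (fun k x => (cmod (f x - cut (D k) f x) ^+ 2)%:E) (cst 0%E)
  (fun x => (cmod (f x) ^+ 2)%:E).
case.
- by move=> k; apply/measurable_EFinP; apply: meas_cmod2; exact: cmeasB.
- exact: measurable_cst.
- apply: aeW => x _; have [N hN] := hD x.
  apply: cvg_near_cst; exists N => // k /= Nk.
  by rewrite cutE ?subrr ?ComplexField.Normc.normc0 ?expr0n //; exact: hN.
- exact: fI.
- apply: aeW => x k _; rewrite gee0_abs ?lee_fin ?sqr_ge0 // cutP.
  case: ifP => _; last by rewrite subr0.
  by rewrite subrr ComplexField.Normc.normc0 expr0n sqr_ge0.
- by move=> _ _; rewrite integral_cst //= mul0e.
Qed.

End Truncation.

(** * Zeros of chi_s *)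

Section ChiZeros.
Context {R : realType}.

Lemma cos_eq1_2pi (y : R) : 0 <= y < pi *+ 2 -> cos y = 1 -> y = 0.
Proof.
move=> /andP[y0 y2] cy; have p0 := pi_gt0 R.
have inj (z : R) : 0 <= z <= pi -> cos z = 1 -> z = 0.
  move=> zp cz; apply: cos_inj; rewrite ?in_itv /= ?lexx ?(ltW p0) //.
  by rewrite cos0.
have [yp|py] := leP y pi; first by apply: inj => //; rewrite y0.
have : pi *+ 2 - y = 0.
  apply: inj; first by rewrite mulr2n in y2 *; apply/andP; split; lra.
  by rewrite addrC cosD2pi cosN.
by move: y2; rewrite mulr2n; lra.
Qed.

(** Subtracting k periods, k being the integer part of x tau / (2 pi), brings x tau into [0, 2 pi[,
    where only 0 has cosine 1; negative x follow by parity. *)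
Lemma cos_eq1_countable (tau : R) : 0 < tau ->
  countable [set x : R | cos (x * tau) = 1].
Proof.
move=> t0.
have p2 : 0 < pi *+ 2 :> R by rewrite mulrn_wgt0 // pi_gt0.
have key (x : R) : 0 <= x -> cos (x * tau) = 1 ->
    exists k : nat, x = (pi *+ 2) *+ k / tau.
  move=> x0 cx; pose q := x * tau / (pi *+ 2); pose k := Num.truncn q.
  have q0 : 0 <= q by rewrite /q !mulr_ge0 ?invr_ge0 // ltW.
  have h1 : k%:R <= q by rewrite truncn_le.
  have h2 : q < k.+1%:R by exact: truncnS_gt.
  exists k.
  suff E : x * tau = pi *+ 2 *+ k by rewrite -E mulfK // gt_eqF.
  have qx : x * tau = q * (pi *+ 2) by rewrite /q divfK // gt_eqF.
  suff : x * tau - pi *+ 2 *+ k = 0 by move=> /eqP; rewrite subr_eq0 => /eqP.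
  apply: cos_eq1_2pi.
    rewrite qx -(mulr_natl _ k) -mulrBl; apply/andP; split.
      by rewrite mulr_ge0 ?subr_ge0 // ltW.
    have h3 : q - k%:R < 1 by rewrite -natr1 in h2; lra.
    by have := ltr_pM2r p2 (q - k%:R) 1; rewrite h3 mul1r.
  by rewrite -(periodicn (@cosD2pi R) k) subrK.
have : [set x : R | cos (x * tau) = 1] `<=`
    \bigcup_(k : nat) [set (pi *+ 2) *+ k / tau; - ((pi *+ 2) *+ k / tau)].
  move=> x /= cx; have [x0|x0] := leP 0 x.
    by have [k ->] := key x x0 cx; exists k => //; left.
  have [] := key (- x); rewrite ?oppr_ge0 ?(ltW x0) // ?mulNr ?cosN // => k xk.
  by exists k => //; right; rewrite -xk opprK.
move=> /subset_card_le /sub_countable; apply; apply: bigcup_countable => // k _.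
by apply: finite_set_countable; exact: finite_set2.
Qed.

(** 1 + ix never vanishes, and 1 - e^{-ix tau} vanishes only where cos (x tau) = 1. This countable
    set contains 0, where [chi] involves a division by 0. *)
Lemma chi_neq0 (n : nat) (tau : R) : 0 < tau ->
  {ae leb R, forall x, chi n tau x != 0}.
Proof.
move=> t0.
pose N := [set x : R | cos (x * tau) = 1].
have cN : countable N by exact: cos_eq1_countable.
have mN : measurable (N : set (measurableTypeR R)) by exact: countable_measurable.
exists N; split => //; first exact: countable_lebesgue_measure0.
move=> x /= /negP; rewrite negbK => h; apply: contrapT => cx.
have x0 : x <> 0 by move=> x0; apply: cx; rewrite /N /= x0 mul0r cos0.
move: h; rewrite /chi mulf_eq0 mulf_eq0 invr_eq0 !expf_eq0.
have -> : (1 + Complex 0 x == 0) = false.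
  by apply/negP => /eqP /(congr1 (@complex.Re R)); rewrite ReD /= addr0 => /eqP; rewrite oner_eq0.
have -> : (Complex 0 x == 0) = false.
  by apply/negP => /eqP /(congr1 (@complex.Im R)) /= h; apply: x0.
have -> : (1 - cexp (- (x * tau)) == 0) = false.
  apply/negP => /eqP /(congr1 (@complex.Re R)); rewrite ReD ReN /= cosN => /eqP.
  by rewrite subr_eq0 => /eqP h; apply: cx.
by rewrite !andbF.
Qed.

End ChiZeros.

Section IndicatorProduct.
Context {R : realType} {d : measure_display} {T : measurableType d}.
Context (mu : {measure set T -> \bar R}).

Lemma L2_indic (D : set T) : measurable D -> (mu D < +oo)%E ->
  L2 mu setT (fun x => (\1_D x : R)%:C%C).
Proof.
move=> mD muD; split; first by apply: cmeas_real; exact: measurable_indic.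
rewrite /sqnorm; under eq_integral => x _.
  rewrite (_ : cmod _ ^+ 2 = \1_D x); last first.
    by rewrite cmodE /= expr0n addr0 indicE; case: (x \in D); rewrite /= ?expr1n ?expr0n.
  over.
by rewrite integral_indic // setIT.
Qed.

Lemma ip2_indic (f : T -> R[i]) (D : set T) : measurable D ->
  ip2 mu f (fun x => (\1_D x : R)%:C%C) = cintegral mu D f.
Proof.
move=> mD; rewrite cintegral_cut; apply: eq_cintegral => x _.
by rewrite /cut conjc_real mulrC.
Qed.

Lemma ip2_indicI (A B : set T) : measurable A -> measurable B ->
  ip2 mu (fun x => (\1_A x : R)%:C%C) (fun x => (\1_B x : R)%:C%C) =
  (fine (mu (A `&` B)))%:C%C.
Proof.
move=> mA mB; rewrite ip2_indic // cintegral_cut; apply: ReImP => /=.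
- rewrite /Rintegral; congr fine.
  under eq_integral => x _ do rewrite /= mul0r subr0 mulrC -[_ * _]/((\1_A \* \1_B) x).
  rewrite -indicI integral_indic ?setIT //; exact: measurableI.
- by rewrite /Rintegral integral0_eq // => x _; rewrite /= mulr0 mul0r addr0.
Qed.

End IndicatorProduct.

(** * Increments of eta as isometric images of indicators *)

Section OrthogonalIncrements.
Context {R : realType} {d : measure_display} {T : measurableType d} (P : probability T R).
Context (eta : R -> T -> R[i]) (eta_orth : orthogonal_increments P eta).

Let H := L2h P.
Let E (s : R) : T -> R[i]^o := (eta s : T -> R[i]^o) - eta 0.

Let eL t : L2 P setT (eta t). Proof. by have [+ _ _] := eta_orth; apply. Qed.

Lemma increment_L2 s t : hdom H ((eta t : T -> R[i]^o) - eta s).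
Proof. exact: L2_sub. Qed.

Lemma increment_nrm s t : nrm H ((eta t : T -> R[i]^o) - eta s) = `|t - s|.
Proof.
have [_ _ h] := eta_orth; apply/EFin_inj.
by rewrite -nrm_sqnorm; [exact: h|exact: increment_L2].
Qed.

Lemma increment_orth s1 t1 s2 t2 : s1 <= t1 -> t1 <= s2 -> s2 <= t2 ->
  hip H ((eta t1 : T -> R[i]^o) - eta s1) ((eta t2 : T -> R[i]^o) - eta s2) = 0.
Proof. by move=> h1 h2 h3; have [_ h _] := eta_orth; exact: h. Qed.

Let dE s : hdom H (E s). Proof. exact: increment_L2. Qed.

Let EB s t : E t - E s = (eta t : T -> R[i]^o) - eta s.
Proof. by rewrite /E opprB addrA subrK. Qed.

(** Norms of increments determine only the real parts of inner products; the imaginary parts require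
    the orthogonality of increments. Since [E] starts at 0, the cases are 0 <= s, t <= 0 and s < 0 <
    t. *)
Let Im0 s t : s <= t -> cIm (hip H (E s) (E t)) = 0.
Proof.
move=> st; have ds := dE s; have dt := dE t.
have [s0|s0] := leP 0 s.
  have -> : E t = E s + (E t - E s) by rewrite addrC subrK.
  rewrite ipDr //; last exact: domB.
  by rewrite EB (increment_orth s0 (lexx s) st) addr0; exact: ip_Im.
have [t0|t0] := leP t 0.
  have -> : E s = E t + (E s - E t) by rewrite addrC subrK.
  rewrite ipDl //; last exact: domB.
  rewrite -(opprB (E t)) EB.
  have -> : hip H (- ((eta t : T -> R[i]^o) - eta s)) (E t) =
      hip H ((eta t : T -> R[i]^o) - eta s) ((eta 0 : T -> R[i]^o) - eta t).
    rewrite -(opprB (eta t : T -> R[i]^o) (eta 0)) (ipNr (H := H)) //; last exact: increment_L2.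
    by rewrite (ipNl (H := H)) //; exact: increment_L2.
  by rewrite (increment_orth st (lexx t) t0) addr0; exact: ip_Im.
have -> : hip H (E s) (E t) = - hip H ((eta 0 : T -> R[i]^o) - eta s) (E t).
  rewrite -(ipNl (H := H)) ?opprB //; exact: increment_L2.
by rewrite (increment_orth (ltW s0) (lexx 0) (ltW t0)) oppr0.
Qed.

(** The covariance of a two-sided Wiener process; its real part comes from |s - t| by
    polarization. *)
Let K s t : hip H (E s) (E t) = ((`|s| + `|t| - `|s - t|) / 2)%:C%C.
Proof.
apply: ReImP; last first.
  have [st|/ltW ts] := leP s t; first by rewrite Im0.
  by rewrite (ipC (H := H)) // ImJ Im0 // oppr0.
have := nrmB_exp (dE s) (dE t); rewrite EB !increment_nrm !subr0 /=; lra.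
Qed.

Lemma increment_ip u v u' v' :
  hip H ((eta v : T -> R[i]^o) - eta u) ((eta v' : T -> R[i]^o) - eta u') =
  ((`|v - u'| + `|u - v'| - `|v - v'| - `|u - u'|) / 2)%:C%C.
Proof.
rewrite -!EB (ipBl (dE v) (dE u) (domB (dE v') (dE u'))).
rewrite (ipBr (dE v') (dE u') (dE v)) (ipBr (dE v') (dE u') (dE u)).
by rewrite !K; apply: ReImP; rewrite !ReImE /=; lra.
Qed.

(** The length of the overlap is given the form that the inner product takes in [increment_ip]. *)
Lemma itvI_measure (u v u' v' : R) : u <= v -> u' <= v' ->
  fine (leb R (`]u, v] `&` `]u', v'])) =
  (`|v - u'| + `|u - v'| - `|v - v'| - `|u - u'|) / 2.
Proof.
move=> uv uv'.
have -> : `]u, v] `&` `]u', v'] = `](Num.max u u'), (Num.min v v')]%classic.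
  apply/seteqP; split => x /=; rewrite !in_itv /= gt_max le_min.
    by move=> [/andP[-> ->] /andP[-> ->]].
  by move=> /andP[/andP[-> ->] /andP[-> ->]].
rewrite lebesgue_measure_itv /= lte_fin -EFinB.
case: (ger0P (v - u')) => h1; case: (ger0P (u - v')) => h2;
  case: (ger0P (v - v')) => h3; case: (ger0P (u - u')) => h4;
  case: (leP u u') => h5; case: (leP v v') => h6; case: ifPn; rewrite -?leNgt => h7 /=; lra.
Qed.

Lemma itv_L2 (u v : R) : L2 (leb R) setT (fun s : R => (\1_(`]u, v]%classic) s : R)%:C%C).
Proof. by apply: L2_indic; [exact: measurable_itv|exact: itv_lty]. Qed.

Lemma span_eta_dom : span_eta eta `<=` hdom (hprod (L2h (leb R)) (L2h P)).
Proof.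
by move=> _ [u [v [uv ->]]]; split; [exact: itv_L2|exact: increment_L2].
Qed.

Lemma span_eta_isometry p q : span_eta eta p -> span_eta eta q ->
  hip (L2h P) p.2 q.2 = (1 : R)%:C%C * hip (L2h (leb R)) p.1 q.1.
Proof.
move=> [u [v [uv ->]]] [u' [v' [uv' ->]]] /=; rewrite mul1r.
rewrite [RHS]ip2_indicI; try exact: measurable_itv.
by rewrite itvI_measure //; exact: increment_ip.
Qed.

End OrthogonalIncrements.

Section Rearrangement.
Context {R : realType} {V1 V2 V3 : lmodType R[i]}.
Context (H1 : hspace V1) (H2 : hspace V2) (H3 : hspace V3).
Context (S : set (V1 * (V2 * V3))) (SD : S `<=` hdom (hprod H1 (hprod H2 H3))).

(** Exchanging and dropping coordinates does not increase the norm, so [clos_image] applies with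
    bound 1, here and in the two variants below. *)
Lemma clos_perm21 (S' : set (V2 * V1)) : S' `<=` hdom (hprod H2 H1) ->
  (forall p, S p -> clos (hprod H2 H1) S' (p.2.1, p.1)) ->
  forall a b c, clos (hprod H1 (hprod H2 H3)) S (a, (b, c)) -> clos (hprod H2 H1) S' (b, a).
Proof.
move=> S'D SS' a b c h.
apply: (@clos_image _ _ _ (hprod H1 (hprod H2 H3)) (hprod H2 H1) (fun p => (p.2.1, p.1)) 1
  S S' SD S'D _ _ _ _ SS' _ h) => //.
- by move=> p [? [? ?]].
- by move=> p [? [? ?]]; rewrite mul1r !nrm_prod /= addrC lerD2l lerDl nrm_ge0.
Qed.

Lemma clos_perm31 (S' : set (V3 * V1)) : S' `<=` hdom (hprod H3 H1) ->
  (forall p, S p -> clos (hprod H3 H1) S' (p.2.2, p.1)) ->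
  forall a b c, clos (hprod H1 (hprod H2 H3)) S (a, (b, c)) -> clos (hprod H3 H1) S' (c, a).
Proof.
move=> S'D SS' a b c h.
apply: (@clos_image _ _ _ (hprod H1 (hprod H2 H3)) (hprod H3 H1) (fun p => (p.2.2, p.1)) 1
  S S' SD S'D _ _ _ _ SS' _ h) => //.
- by move=> p [? [? ?]].
- by move=> p [? [? ?]]; rewrite mul1r !nrm_prod /= addrC lerD2l lerDr nrm_ge0.
Qed.

Lemma clos_perm32 (S' : set (V3 * V2)) : S' `<=` hdom (hprod H3 H2) ->
  (forall p, S p -> clos (hprod H3 H2) S' (p.2.2, p.2.1)) ->
  forall a b c, clos (hprod H1 (hprod H2 H3)) S (a, (b, c)) -> clos (hprod H3 H2) S' (c, b).
Proof.
move=> S'D SS' a b c h.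
apply: (@clos_image _ _ _ (hprod H1 (hprod H2 H3)) (hprod H3 H2) (fun p => (p.2.2, p.2.1)) 1
  S S' SD S'D _ _ _ _ SS' _ h) => //.
- by move=> p [? [? ?]].
- by move=> p [? [? ?]]; rewrite mul1r !nrm_prod /= [leLHS]addrC lerDr nrm_ge0.
Qed.

End Rearrangement.

Lemma clos_fst {R : realType} {V1 V2 : lmodType R[i]} (H1 : hspace V1) (H2 : hspace V2)
    (S : set (V1 * V2)) : S `<=` hdom (hprod H1 H2) ->
  forall a b, clos (hprod H1 H2) S (a, b) -> clos H1 (fst @` S) a.
Proof.
move=> SD a b h.
have S'D : fst @` S `<=` hdom H1 by move=> _ [p /SD[? ?] <-].
apply: (@clos_image _ _ _ (hprod H1 H2) H1 fst 1 S (fst @` S) SD S'D _ _ _ _ _ _ h) => //.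
- by move=> p [].
- by move=> p [? ?]; rewrite mul1r nrm_prod lerDl nrm_ge0.
- by move=> p Sp; apply: clos_sub => //; exists p.
Qed.

Lemma ecvg0_lt (R : realType) (u : nat -> \bar R) : u @ \oo --> 0%E ->
  forall e : R, 0 < e -> exists N, forall k, (N <= k)%N -> (u k < e%:E)%E.
Proof.
move=> h e e0; have : nbhs (0%E : \bar R) [set x | (x < e%:E)%E].
  exists e => // r /=; rewrite sub0r normrN lte_fin.
  exact: le_lt_trans (ler_norm _).
by move=> /h [N _ hN]; exists N => k Nk; exact: hN.
Qed.

Lemma cmeas_itv_cover (R : realType) (G : R -> R[i]) :
  (forall k : nat, cmeasurable (`]- k%:R, k%:R]%classic : set (measurableTypeR R)) G) ->
  cmeasurable [set: measurableTypeR R] G.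
Proof.
move=> key.
have U : [set: measurableTypeR R] =
    \bigcup_(k : nat) (`]- k%:R, k%:R]%classic : set (measurableTypeR R)).
  apply/seteqP; split => // x _ /=.
  exists (Num.truncn `|x : R|).+1 => //=; rewrite in_itv /=.
  have h : `|x : R| < (Num.truncn `|x : R|).+1%:R by exact: truncnS_gt.
  by move: h; rewrite ltr_norml => /andP[-> /ltW ->].
have mI k : measurable (`]- k%:R, k%:R]%classic : set (measurableTypeR R)).
  exact: measurable_itv.
by split; rewrite U; apply/(measurable_fun_bigcup _ mI) => k; case: (key k).
Qed.

(** Fubini's theorem, used in [fourier_itv], includes measurability on each bounded interval. *)
Lemma fourier_meas (R : realType) (g : R -> R[i]) : cintegrable (leb R) setT g ->
  cmeasurable [set: measurableTypeR R]
    (fun x : R => cintegral (leb R) setT (fun s : R => cexp (x * s) * g s)).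
Proof.
by move=> gI; apply: cmeas_itv_cover => k; have [[]] := fourier_itv (- k%:R) k%:R gI.
Qed.

Lemma itvcc_lty (R : realType) (a b : R) : (leb R `[a, b] < +oo)%E.
Proof. by rewrite lebesgue_measure_itv /=; case: ifP => _; rewrite ?ltry // -EFinD ltry. Qed.

(** * Spectral and time domains of the increments *)

Section Setup.
Context {R : realType} {d : measure_display} {T : measurableType d}.
Context (P : probability T R) (n : nat) (xi : R -> T -> R[i]).
Context (F : {finite_measure set (measurableTypeR R) -> \bar R}).
Context (Z : set R -> T -> R[i]) (f : R -> R).
Context (eta : R -> T -> R[i]) (phi_ : R -> R -> R[i]) (phi : R -> R[i]).
Context (Phi_ : R -> R -> R[i]) (Phi : R -> R[i]).
Hypothesis xi_spec : spectral_representation P n xi F Z.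
Hypothesis F_dens : spectral_density F f.
Hypothesis f_fact : canonical_factorization P n xi f eta phi_ phi Phi_ Phi.

Notation HP := (L2h P).
Notation HF := (L2h F).
Notation HL := (L2h (leb R)).
Notation fR := (measurableTypeR R -> R[i]^o).
Notation fT := (T -> R[i]^o).

(* An increment in the spectral domain, in the time domain and in L_2(Omega). *)
Definition Vf (t s : R) : fR := fun x => cexp (t * x) * chi n s x.
Definition Xf (t s : R) : fR := fun u => if u <= t then phi_ s (t - u) else 0.
Definition Wf (t s : R) : fT := incr n xi t s.

#[local] Arguments Vf : simpl never.
#[local] Arguments Xf : simpl never.
#[local] Arguments Wf : simpl never.

Let eta_orth : orthogonal_increments P eta := cf_orthogonal f_fact.

Lemma Xf_L2 t s : 0 < s -> hdom HL (Xf t s).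
Proof. by move=> s0; have [] := cf_moving_average f_fact t s0. Qed.

Lemma Wf_L2 t s : 0 < s -> hdom HP (Wf t s).
Proof. by move=> s0; have [] := cf_moving_average f_fact t s0. Qed.

Lemma Vf_L2 t s : 0 < s -> hdom HF (Vf t s).
Proof. by move=> s0; have [_ h] := xi_spec; have [] := h t s s0. Qed.

Lemma span_Z_dom : span_Z Z `<=` hdom (hprod HF HP).
Proof.
move=> _ [A mA ->]; have [[hZ _] _] := xi_spec; split; last exact: hZ.
by apply: L2_indic => //; rewrite -ge0_fin_numE // fin_num_measure.
Qed.

Lemma span_Z_isometry p q : span_Z Z p -> span_Z Z q ->
  hip HP p.2 q.2 = (1 : R)%:C%C * hip HF p.1 q.1.
Proof.
move=> [A mA ->] [B mB ->] /=; rewrite mul1r [RHS]ip2_indicI //.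
by have [[_ h] _] := xi_spec; exact: h.
Qed.

Lemma clos_Vf t s : 0 < s -> clos (hprod HF HP) (span_Z Z) (Vf t s, Wf t s).
Proof.
move=> s0; apply/is_Z_integralE; first exact: span_Z_dom.
by have [_ h] := xi_spec; exact: h.
Qed.

Lemma clos_Xf t s : 0 < s -> clos (hprod HL HP) (span_eta eta) (Xf t s, Wf t s).
Proof.
move=> s0; apply: is_eta_integral_clos; first exact: (span_eta_dom eta_orth).
exact: (cf_moving_average f_fact t s0).
Qed.

Lemma ip_Vf t s t' s' : 0 < s -> 0 < s' ->
  hip HP (Wf t s) (Wf t' s') = hip HF (Vf t s) (Vf t' s').
Proof.
move=> s0 s0'; rewrite -[RHS]mul1r.
exact: (clos_isometry span_Z_dom span_Z_isometry (clos_Vf t s0) (clos_Vf t' s0')).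
Qed.

Lemma ip_Xf t s t' s' : 0 < s -> 0 < s' ->
  hip HP (Wf t s) (Wf t' s') = hip HL (Xf t s) (Xf t' s').
Proof.
move=> s0 s0'; rewrite -[RHS]mul1r.
exact: (clos_isometry (span_eta_dom eta_orth) (span_eta_isometry eta_orth)
  (clos_Xf t s0) (clos_Xf t' s0')).
Qed.

Notation HVX := (hprod HF HL).
Notation HWVX := (hprod HP HVX).

Definition span_W : set fT := [set w | exists t s, 0 < s /\ w = Wf t s].
(** The three representations share one graph, so that an element of the closure has a single
    approximating sequence of linear combinations, common to the three spaces. *)
Definition span_WVX : set (fT * (fR * fR)) :=
  [set p | exists t s, 0 < s /\ p = (Wf t s, (Vf t s, Xf t s))].

Lemma span_WVX_dom : span_WVX `<=` hdom HWVX.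
Proof.
by move=> _ [t [s [s0 ->]]]; split; [exact: Wf_L2|split; [exact: Vf_L2|exact: Xf_L2]].
Qed.

(** The inner product of the pair adds two contributions, each equal to the inner product in
    L_2(Omega); hence the constant 2. *)
Lemma span_WVX_isometry p q : span_WVX p -> span_WVX q ->
  hip HVX p.2 q.2 = (2 : R)%:C%C * hip HP p.1 q.1.
Proof.
move=> [t [s [s0 ->]]] [t' [s' [s0' ->]]].
transitivity (hip HF (Vf t s) (Vf t' s') + hip HL (Xf t s) (Xf t' s')); first by [].
rewrite -ip_Vf // -ip_Xf //; move: (hip HP _ _) => z.
by apply: ReImP; rewrite !ReImE /=; ring.
Qed.

Lemma span_W_dom : span_W `<=` hdom HP.
Proof. by move=> _ [t [s [s0 ->]]]; exact: Wf_L2. Qed.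

Lemma WVX_extension w : clos HP span_W w -> exists v x, clos HWVX span_WVX (w, (v, x)).
Proof.
move=> cw.
have cw' : clos HP (fst @` span_WVX) w.
  move: cw; congr clos; apply/seteqP; split => y.
    by move=> [t [s [s0 ->]]]; exists (Wf t s, (Vf t s, Xf t s)) => //; exists t, s.
  by move=> [_ [t [s [s0 ->]]] <-]; exists t, s.
have [[v x] h] := clos_extension (ler0n R 2) span_WVX_dom span_WVX_isometry cw'.
by exists v, x.
Qed.

Lemma WVX_clos_V w v x : clos HWVX span_WVX (w, (v, x)) ->
  clos (hprod HF HP) (span_Z Z) (v, w).
Proof.
apply: (clos_perm21 span_WVX_dom span_Z_dom) => _ [t [s [s0 ->]]].
exact: clos_Vf.
Qed.

Lemma WVX_clos_X w v x : clos HWVX span_WVX (w, (v, x)) ->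
  clos (hprod HL HP) (span_eta eta) (x, w).
Proof.
apply: (clos_perm31 span_WVX_dom (span_eta_dom eta_orth)) => _ [t [s [s0 ->]]].
exact: clos_Xf.
Qed.

Lemma WVX_ip_V w v x w' v' x' : clos HWVX span_WVX (w, (v, x)) ->
  clos HWVX span_WVX (w', (v', x')) -> hip HP w w' = hip HF v v'.
Proof.
move=> c c'; rewrite -[RHS]mul1r.
exact: (clos_isometry span_Z_dom span_Z_isometry (WVX_clos_V c) (WVX_clos_V c')).
Qed.

Lemma WVX_ip_X w v x w' v' x' : clos HWVX span_WVX (w, (v, x)) ->
  clos HWVX span_WVX (w', (v', x')) -> hip HP w w' = hip HL x x'.
Proof.
move=> c c'; rewrite -[RHS]mul1r.
exact: (clos_isometry (span_eta_dom eta_orth) (span_eta_isometry eta_orth)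
  (WVX_clos_X c) (WVX_clos_X c')).
Qed.

Definition span_XV : set (fR * fR) :=
  [set p | exists t s, 0 < s /\ p = (Xf t s, Vf t s)].

Lemma span_XV_dom : span_XV `<=` hdom (hprod HL HF).
Proof. by move=> _ [t [s [s0 ->]]]; split; [exact: Xf_L2|exact: Vf_L2]. Qed.

Lemma span_XV_isometry p q : span_XV p -> span_XV q ->
  hip HF p.2 q.2 = (1 : R)%:C%C * hip HL p.1 q.1.
Proof.
move=> [t [s [s0 ->]]] [t' [s' [s0' ->]]]; rewrite mul1r.
exact: etrans (esym (ip_Vf t t' s0 s0')) (ip_Xf t t' s0 s0').
Qed.

Lemma WVX_clos_XV w v x : clos HWVX span_WVX (w, (v, x)) ->
  clos (hprod HL HF) span_XV (x, v).
Proof.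
apply: (clos_perm32 span_WVX_dom span_XV_dom) => _ [t [s [s0 ->]]].
by apply: (clos_sub span_XV_dom); exists t, s.
Qed.

Definition span_upto (z : R) : set fT := [set w | exists u s, [/\ u <= z, 0 < s & w = Wf u s]].
Definition span_before : set fT := [set w | exists u s, [/\ u < 0, 0 < s & w = Wf u s]].
Definition span_inc (z : R) : set fT :=
  [set w | exists s t, [/\ s <= t, t <= z & w = (fun w => eta t w - eta s w)]].

Lemma span_upto_dom z : span_upto z `<=` hdom HP.
Proof. by move=> _ [u [s [_ s0 ->]]]; exact: Wf_L2. Qed.

Lemma span_before_dom : span_before `<=` hdom HP.
Proof. by move=> _ [u [s [_ s0 ->]]]; exact: Wf_L2. Qed.

Lemma span_inc_dom z : span_inc z `<=` hdom HP.
Proof. by move=> _ [s [t [_ _ ->]]]; exact: (increment_L2 eta_orth). Qed.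

Lemma H_obsE : H_obs P n xi = clos HP span_before.
Proof. exact: (closed_spanE span_before_dom). Qed.

Lemma clos_upto_inc z : clos HP (span_upto z) = clos HP (span_inc z).
Proof.
have := cf_span f_fact z; rewrite /H_incr /H_eta.
by rewrite (closed_spanE (@span_upto_dom z)) (closed_spanE (@span_inc_dom z)).
Qed.

Lemma clos_upto_W z w : clos HP (span_upto z) w -> clos HP span_W w.
Proof.
apply: clos_min; first exact: span_W_dom.
move=> _ [u [s [_ s0 ->]]]; apply: clos_sub; first exact: span_W_dom.
by exists u, s.
Qed.

Lemma clos_before_W w : clos HP span_before w -> clos HP span_W w.
Proof.
apply: clos_min; first exact: span_W_dom.
move=> _ [u [s [_ s0 ->]]]; apply: clos_sub; first exact: span_W_dom.
by exists u, s.
Qed.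

Lemma clos_before_upto w : clos HP span_before w -> clos HP (span_upto 0) w.
Proof.
apply: clos_min; first exact: span_upto_dom.
move=> _ [u [s [u0 s0 ->]]]; apply: clos_sub; first exact: span_upto_dom.
by exists u, s; split => //; exact: ltW.
Qed.

Lemma clos_upto_before z w : z < 0 -> clos HP (span_upto z) w -> clos HP span_before w.
Proof.
move=> z0; apply: clos_min; first exact: span_before_dom.
move=> _ [u [s [uz s0 ->]]]; apply: clos_sub; first exact: span_before_dom.
by exists u, s; split => //; exact: le_lt_trans z0.
Qed.

Lemma inc_upto u v : u <= v -> clos HP (span_upto v) ((eta v : fT) - eta u).
Proof.
move=> uv; rewrite clos_upto_inc; apply: clos_sub; first exact: span_inc_dom.
by exists u, v.
Qed.

(** As H^b(xi^(n)) = H^b(eta), the increment of eta over ]a, b] lies in the closed span of the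
    increments of xi. Hence the indicator of ]a, b] is, up to a null function, in the closed span of
    the [Xf t s], and u has integral 0 over ]a, b]. *)
Lemma Xf_total (u : fR) : hdom HL u -> (forall t s, 0 < s -> hip HL (Xf t s) u = 0) ->
  {ae leb R, forall x, u x = 0}.
Proof.
move=> lu hu.
have key a b : a <= b -> cintegral (leb R) `]a, b] u = 0.
  move=> ab; have mI : measurable (`]a, b]%classic : set (measurableTypeR R)).
    exact: measurable_itv.
  have [v [x c]] := WVX_extension (clos_upto_W (inc_upto ab)).
  have cx := WVX_clos_X c.
  pose I : fR := fun s => (\1_(`]a, b]%classic) s : R)%:C%C.
  have cI : clos (hprod HL HP) (span_eta eta) (I, (eta b : fT) - eta a).
    by apply: clos_sub; [exact: (span_eta_dom eta_orth)|exists a, b].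
  have lx : hdom HL x by case: (clos_dom cx).
  have lI : hdom HL I by case: (clos_dom cI).
  have cB := closB (span_eta_dom eta_orth) cx cI.
  have := clos_isometry_nrm (span_eta_dom eta_orth) (span_eta_isometry eta_orth) cB.
  rewrite /= subrr nrm0 mul1r => /esym n0.
  have x0 : hip HL x u = 0.
    apply: (@orth_clos _ _ HL (fst @` span_XV) u lu).
    - by move=> _ [_ [t [s [s0 ->]]] <-]; exact: Xf_L2.
    - by move=> _ [_ [t [s [s0 ->]]] <-]; exact: hu.
    - exact: (clos_fst span_XV_dom (WVX_clos_XV c)).
  have I0 : hip HL I u = 0.
    have := nrm0_ip0 (domB lx lI) lu n0; rewrite ipBl // x0 sub0r => /eqP.
    by rewrite oppr_eq0 => /eqP.
  have : hip HL u I = 0 by rewrite (ipC (H := HL)) // I0 conjc0.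
  by rewrite -[LHS]/(ip2 (leb R) u I) ip2_indic.
have := @ae0_of_cintervals R u setT openT.
move=> h; apply: (ae_imp (h _ _)) => [a b|a b ab _|x].
- by apply: L2_fin_cintegrable => //; exact: itv_lty.
- exact: key.
- by apply.
Qed.

(** The time domain is all of L_2(R), so every function has a spectral counterpart, in particular
    the truncations whose transforms are genuine integrals. *)
Lemma Xf_clos (u : fR) : hdom HL u -> exists v, clos (hprod HL HF) span_XV (u, v).
Proof.
move=> lu; apply: (clos_extension (c := 1) _ span_XV_dom span_XV_isometry) => //.
apply: clos_total => //.
  by move=> _ [_ [t [s [s0 ->]]] <-]; exact: Xf_L2.
move=> w lw hw.
have w0 : {ae leb R, forall x, w x = 0}.
  apply: Xf_total => // t s s0; apply: hw.
  by exists (Xf t s, Vf t s) => //; exists t, s.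
have mw : cmeasurable [set: measurableTypeR R] w by case: lw.
have E : ip2 (leb R) w w = ip2 (leb R) (fun _ => 0) w.
  by apply: ip2_ae => //; exact: cmeas_cst.
rewrite /nrm -[hip _ _ _]/(ip2 (leb R) w w) E.
by rewrite -[ip2 _ _ _]/(hip HL 0 w) ip0l.
Qed.

Lemma Phi_L2 : hdom HL Phi.
Proof. by have [_ h _] := cf_Phi f_fact. Qed.

Let mPhi : cmeasurable [set: measurableTypeR R] Phi. Proof. by case: Phi_L2. Qed.

Let fPhi := cf_density f_fact.

Definition mulPhi (v : fR) : fR := fun x => v x * Phi x.

Lemma two_pi_gt0 : 0 < 2 * pi :> R. Proof. by rewrite mulr_gt0 // pi_gt0. Qed.

Lemma mulPhi_sqnorm v : cmeasurable [set: measurableTypeR R] v ->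
  sqnorm (leb R) setT (mulPhi v) = ((2 * pi)%:E * sqnorm F setT v)%E.
Proof.
move=> mv; rewrite (density_sqnorm F_dens mPhi fPhi mv) muleA -EFinM divff ?mul1e //.
by rewrite gt_eqF // two_pi_gt0.
Qed.

Lemma mulPhi_L2 v : hdom HF v -> hdom HL (mulPhi v).
Proof.
move=> [mv vI]; split; first exact: cmeasM.
rewrite (mulPhi_sqnorm mv) lte_mul_pinfty // ?lee_fin ?(ltW two_pi_gt0) //.
Qed.

Lemma mulPhi_nrm v : hdom HF v -> nrm HL (mulPhi v) = 2 * pi * nrm HF v.
Proof.
move=> lv; apply/EFin_inj; rewrite -nrm_sqnorm; last exact: mulPhi_L2.
by rewrite mulPhi_sqnorm ?EFinM; [rewrite (nrm_sqnorm lv) | case: lv].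
Qed.

(** Conjugated because [hip] conjugates its second argument. *)
Definition conj_hat (a b : R) : fR := fun s => ((itv_hat a b s)^*)%C.

Lemma conj_hat_L2 a b : a <= b -> hdom HL (conj_hat a b).
Proof.
move=> ab; have [m h] := itv_hat_L2 ab; split; first exact: cmeasJ.
by move: h; rewrite /sqnorm; under eq_integral do rewrite -cmodJ.
Qed.

Lemma ip_conj_hat a b (x : fR) :
  hip HL x (conj_hat a b) = cintegral (leb R) setT (fun s => itv_hat a b s * x s).
Proof. by apply: eq_cintegral => s _; rewrite /conj_hat conjcK mulrC. Qed.

Lemma ip_itv a b (x : fR) :
  hip HL x (fun s : R => (\1_(`]a, b]%classic) s : R)%:C%C) = cintegral (leb R) `]a, b] x.
Proof. by apply: ip2_indic; exact: measurable_itv. Qed.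

(** The image of the window [0, N] of [is_fourier] under u -> t - u. *)
Let win (t : R) (N : nat) : set (measurableTypeR R) := `[t - N%:R, t]%classic.

Let win_m t N : measurable (win t N). Proof. exact: measurable_itv. Qed.

Let win_lty t N : (leb R (win t N) < +oo)%E.
Proof. exact: itvcc_lty. Qed.

(** Substituting w = t - u turns e^{itx} e^{-ixu} into e^{ixw}: this is how the transform with sign
    -1 of phi_s becomes a transform with sign +1 of [Xf t s]. *)
Lemma trunc_fourier t s (N : nat) (x : R) : 0 < s ->
  cexp (t * x) * cintegral (leb R) `[0, N%:R] (fun u : R => cexp (-1 * x * u) * phi_ s u) =
  cintegral (leb R) setT (fun w : R => cexp (x * w) * cut (win t N) (Xf t s) w).
Proof.
move=> s0; have [lphi _ _] := cf_Phi_ f_fact s0.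
pose D : set (measurableTypeR R) := `[0, N%:R]%classic.
have mD : measurable D by exact: measurable_itv.
have DH : D `<=` halfline by move=> u; rewrite /D /halfline /= !in_itv /= => /andP[->].
have mphi : cmeasurable D (phi_ s).
  by have [[m1 m2] _] := lphi; split; apply: measurable_funS (m1) || apply: measurable_funS (m2);
     rewrite // /halfline; exact: measurable_itv.
have mexp : cmeasurable D (fun u : R => cexp (-1 * x * u)).
  by apply: cmeas_cexp; apply: measurable_funM => //; exact: measurable_cst.
have mg : cmeasurable D (fun u : R => cexp (-1 * x * u) * phi_ s u) by exact: cmeasM.
have lcut : L2 (leb R) setT (cut D (fun u : R => cexp (-1 * x * u) * phi_ s u)).
  split; first exact/(cmeas_cut mD).
  have [_ h] := lphi; apply: le_lt_trans h; rewrite -sqnorm_cut.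
  have -> : sqnorm (leb R) D (fun u : R => cexp (-1 * x * u) * phi_ s u) =
      sqnorm (leb R) D (phi_ s).
    by apply: eq_integral => u _; rewrite ComplexField.Normc.normcM cmod_cexp mul1r.
  apply: ge0_subset_integral => //; first exact: measurable_itv.
  - by apply/measurable_EFinP; apply: meas_cmod2; case: lphi.
  - by move=> u _; rewrite lee_fin sqr_ge0.
have gI : cintegrable (leb R) D (fun u : R => cexp (-1 * x * u) * phi_ s u).
  have h := L2_fin_cintegrable mD _ lcut.
  apply/(cintegrable_cut _ mD).
  have -> : cut D (fun u => cexp (-1 * x * u) * phi_ s u) =
    cut D (cut D (fun u => cexp (-1 * x * u) * phi_ s u)).
    by apply/funext => u; rewrite [RHS]cutP; case: ifPn => // /negP uD; rewrite cutN // => /mem_set.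
  apply/(cintegrable_cut _ mD); apply: h.
  exact: itvcc_lty.
rewrite -cintegralZ // cintegral_cut.
have mh : cmeasurable [set: measurableTypeR R] (cut D (fun u => cexp (t * x) * (cexp (-1 * x * u) * phi_ s u))).
  by apply/(cmeas_cut mD); exact: cmeasZ.
rewrite (cintegral_change (meas_subl t) (leb_reflect t) mh).
apply: eq_cintegral => w _; rewrite !cutP.
have -> : (t - w \in D) = (w \in win t N).
  apply/idP/idP; rewrite !inE /D /win /= !in_itv /= => /andP[h1 h2]; apply/andP; split; lra.
case: ifPn => [wD|_]; last by rewrite mulr0.
have wt : w <= t by move: wD; rewrite inE /win /= in_itv /= => /andP[].
rewrite /Xf wt mulrA -cexpD; congr (cexp _ * _); ring.
Qed.

(** For the truncation to a window the identity is [fourier_itv]. Both sides are continuous in L_2,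
    and the truncations converge in both domains, on the spectral side by the definition of Phi_s as
    an L_2 limit. *)
Lemma fourier_Xf a b t s : a <= b -> 0 < s ->
  hip HL (Xf t s) (conj_hat a b) = cintegral (leb R) `]a, b] (mulPhi (Vf t s)).
Proof.
move=> ab s0; have [lphi lPhi hcvg] := cf_Phi_ f_fact s0.
pose g (N : nat) (x : R) := cintegral (leb R) `[0, N%:R] (fun u : R => cexp (-1 * x * u) * phi_ s u).
pose xN N : fR := cut (win t N) (Xf t s).
pose I : fR := fun s : R => (\1_(`]a, b]%classic) s : R)%:C%C.
have lX := Xf_L2 t s0.
have lxN N : hdom HL (xN N) by exact: L2_cutT.
have iX N : cintegrable (leb R) setT (xN N).
  apply/(cintegrable_cut (leb R) (win_m t N)).
  exact: (L2_fin_cintegrable (win_m t N) (win_lty t N) lX).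
have lh := conj_hat_L2 ab.
have lI : hdom HL I by exact: itv_L2.
have eE N : (fun x => cexp (t * x) * g N x) =
    (fun x => cintegral (leb R) setT (fun w : R => cexp (x * w) * xN N w)).
  by apply/funext => x; exact: trunc_fourier.
have mg N : cmeasurable [set: measurableTypeR R] (fun x => cexp (t * x) * g N x).
  by rewrite eE; exact: fourier_meas.
have mexp : cmeasurable [set: measurableTypeR R] (fun x : R => cexp (t * x)).
  by apply: cmeas_cexp; apply: measurable_funM => //; exact: measurable_cst.
pose A : fR := fun x => cexp (t * x) * Phi_ s x.
have lA : hdom HL A.
  have [m h] := lPhi; split; first exact: cmeasM.
  rewrite /sqnorm; under eq_integral do rewrite ComplexField.Normc.normcM cmod_cexp mul1r.
  exact: h.
have AV : cintegral (leb R) `]a, b] A = cintegral (leb R) `]a, b] (mulPhi (Vf t s)).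
  have mV : cmeasurable [set: measurableTypeR R] (mulPhi (Vf t s)).
    by have [] := mulPhi_L2 (Vf_L2 t s0).
  have [A1 A2] := lA.1; have [V1 V2] := mV.
  apply: cintegral_ae; first exact: measurable_itv.
  - by split; exact: measurable_funTS.
  - by split; exact: measurable_funTS.
  - by apply: (ae_imp (cf_chi f_fact s0)) => x hx _; rewrite /A /mulPhi /Vf hx mulrA.
rewrite -AV; apply/eqP; rewrite -subr_eq0; apply/eqP; apply: cmod_eq0.
(* Both truncation errors are estimated by Cauchy-Schwarz, against [conj_hat a b] and I; the factors
   2 come from [cmodD2]. *)
apply: (@le_small _ (2 * nrm HL I + 2 * nrm HL (conj_hat a b))) => e e0.
have [N1 hN1] := ecvg0_lt hcvg e0.
have hwin : forall x : R, exists N, forall k, (N <= k)%N -> (if x <= t then win t k x else True).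
  move=> x; exists (Num.truncn `|t - x|).+1 => k Nk; case: ifP => // xt.
  rewrite /win /= in_itv /= xt andbT lerBlDr -lerBlDl.
  apply: le_trans (ler_norm _) _; apply: (@le_trans _ _ (Num.truncn `|t - x|).+1%:R).
    by apply/ltW; exact: truncnS_gt.
  by rewrite ler_nat.
have [N2 hN2] : exists N, forall k, (N <= k)%N ->
    (sqnorm (leb R) setT (fun x => (Xf t s x - xN k x)%R) < e%:E)%E.
  (* The windows exhaust only the half-line up to t. Adding the points beyond t, where [Xf t s] is
     0, does not change the truncation. *)
  pose D k : set (measurableTypeR R) := win t k `|` `]t, +oo[%classic.
  have mD k : measurable (D k) by apply: measurableU; [exact: win_m|exact: measurable_itv].
  have hD x : exists N, forall k, (N <= k)%N -> D k x.
    have [N hN] := hwin x; exists N => k /hN; rewrite /D; case: leP => xt; first by left.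
    by right; rewrite /= in_itv /= xt.
  have [N hN] := ecvg0_lt (truncation_cvg mD hD lX) e0; exists N => k /hN.
  have -> // : cut (D k) (Xf t s) = xN k.
  apply/funext => x; rewrite /xN; have [xt|xt] := leP x t.
    rewrite !cutP; congr (if _ then _ else _).
    apply/idP/idP; rewrite !inE; last by left.
    by move=> [//|]; rewrite /= in_itv /= andbT ltNge xt.
  by rewrite !cutP /Xf leNgt xt /=; case: ifP => _; case: ifP.
pose N := maxn N1 N2.
pose B : fR := fun x => cexp (t * x) * g N x.
have sAB : sqnorm (leb R) setT (fun x => A x - B x) =
    sqnorm (leb R) setT (fun x => Phi_ s x - g N x).
  apply: eq_integral => x _.
  by rewrite /A /B -mulrBr ComplexField.Normc.normcM cmod_cexp mul1r.
have AB_lt : (sqnorm (leb R) setT (fun x => (A x - B x)%R) < e%:E)%E.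
  by rewrite sAB; apply: hN1; rewrite leq_maxl.
have lAB : hdom HL (A - B).
  split; first by apply: cmeasB; [case: lA|exact: mg].
  by apply: lt_trans AB_lt _; rewrite ltry.
have lB : hdom HL B by have := domB lA lAB; rewrite opprB addrC subrK.
have nAB : nrm HL (A - B) < e by rewrite -lte_fin -nrm_sqnorm.
have lXx : hdom HL (Xf t s - xN N) by exact: domB.
have nX : nrm HL (Xf t s - xN N) < e.
  by rewrite -lte_fin -nrm_sqnorm //; apply: hN2; rewrite leq_maxr.
have BI : hip HL B I = hip HL (xN N) (conj_hat a b).
  by rewrite ip_itv ip_conj_hat /B eE; have [_ ->] := fourier_itv a b (iX N).
have -> : hip HL (Xf t s) (conj_hat a b) - cintegral (leb R) `]a, b] A =
    hip HL (Xf t s - xN N) (conj_hat a b) - hip HL (A - B) I.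
  by rewrite (ipBl lX (lxN N) lh) (ipBl lA lB lI) BI ip_itv; ring.
have c1 := cauchy_schwarz lXx lh; have c2 := cauchy_schwarz lAB lI.
set z1 := hip HL (Xf t s - xN N) _ in c1 *; set z2 := hip HL (A - B) I in c2 *.
have := cmodD2 z1 (- z2); rewrite [cmod (- z2)](_ : _ = cmod z2); last first.
  by rewrite -[LHS]/(cmod (- z2)); case: (z2) => p q /=; rewrite !sqrrN.
move=> h; apply: le_trans h _.
have k1 : nrm HL (Xf t s - xN N) * nrm HL (conj_hat a b) <= e * nrm HL (conj_hat a b).
  by rewrite ler_wpM2r ?nrm_ge0 // ltW.
have k2 : nrm HL (A - B) * nrm HL I <= e * nrm HL I by rewrite ler_wpM2r ?nrm_ge0 // ltW.
rewrite -!mulrDr -mulrA ler_pM2l //.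
apply: le_trans (lerD (le_trans c1 k1) (le_trans c2 k2)) _.
by rewrite -mulrDr mulrC addrC.
Qed.

(** For fixed a and b the claim is that (x, v Phi) is orthogonal to ([conj_hat a b], - 1_]a, b]),
    which passes from generators to their closed span. *)
Lemma fourier_clos (x v : fR) : clos (hprod HL HF) span_XV (x, v) ->
  forall a b, a <= b -> cintegral (leb R) `]a, b] (mulPhi v) = hip HL x (conj_hat a b).
Proof.
move=> c a b ab.
pose I : fR := fun s : R => (\1_(`]a, b]%classic) s : R)%:C%C.
have lI : hdom HL I by exact: itv_L2.
have lh := conj_hat_L2 ab.
pose S : set (fR * fR) := [set p | exists t s, 0 < s /\ p = (Xf t s, mulPhi (Vf t s))].
have SD : S `<=` hdom (hprod HL HL).
  move=> _ [t [s [s0 ->]]]; split; first exact: Xf_L2.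
  by apply: mulPhi_L2; exact: Vf_L2.
have cS : clos (hprod HL HL) S (x, mulPhi v).
  (* The map (x, v) -> (x, v Phi) multiplies the second squared norm by 2 pi, so 1 + 2 pi is a
     bound. *)
  have h := @clos_image _ _ _ (hprod HL HF) (hprod HL HL) (fun p => (p.1, mulPhi p.2))
    (1 + 2 * pi) span_XV S span_XV_dom SD.
  apply: (h _ _ _ _ _ (x, v) c) => {h}.
  - by move=> p [? ?]; split; [|exact: mulPhi_L2].
  - by congr pair; apply/funext => y; rewrite /mulPhi mul0r.
  - move=> k p q; congr pair; apply/funext => y.
    transitivity ((k * p.2 y + q.2 y) * Phi y); first by [].
    transitivity (k * (p.2 y * Phi y) + q.2 y * Phi y); last by [].
    by rewrite mulrDl mulrA.
  - move=> p [h1 h2]; rewrite !nrm_prod (mulPhi_nrm h2).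
    have := nrm_ge0 h1; have := nrm_ge0 h2; have := two_pi_gt0.
    by move=> g0 g1 g2; have := mulr_ge0 (ltW g0) g2; rewrite mulrDl mul1r mulrDr; lra.
  - by move=> _ [t [s [s0 ->]]]; apply: (clos_sub SD); exists t, s.
have lu : hdom (hprod HL HL) (conj_hat a b, - I) by split => //; exact: domN.
have := orth_clos lu SD _ cS.
rewrite ip_prod (ipNr lI (mulPhi_L2 (clos_dom c).2)) ip_itv => h.
apply/eqP; rewrite eq_sym -subr_eq0; apply/eqP; apply: h => _ [t [s [s0 ->]]].
rewrite ip_prod (ipNr lI (mulPhi_L2 (Vf_L2 t s0))) ip_itv -(fourier_Xf t ab s0).
exact: subrr.
Qed.

(** Both sides have the same integral over each interval ]a, b], by [fourier_clos] on the left and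
    [fourier_itv] on the right. *)
Lemma fourier_compact (x v : fR) (N : R) : clos (hprod HL HF) span_XV (x, v) ->
  cintegrable (leb R) setT x ->
  {ae leb R, forall w, mulPhi v w = cintegral (leb R) setT (fun s : R => cexp (w * s) * x s)}.
Proof.
move=> c xI; have [lx lv] := clos_dom c.
have lr : hdom HL (mulPhi v) := mulPhi_L2 lv.
pose h (w : R) := mulPhi v w - cintegral (leb R) setT (fun s : R => cexp (w * s) * x s).
have mI a b : measurable (`]a, b]%classic : set (measurableTypeR R)) by exact: measurable_itv.
have rI a b : cintegrable (leb R) `]a, b] (mulPhi v).
  exact: (L2_fin_cintegrable (mI a b) (itv_lty a b) lr).
have gI a b := (fourier_itv a b xI).1.
have E : h = fun w => mulPhi v w + (-1) * cintegral (leb R) setT (fun s : R => cexp (w * s) * x s).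
  by apply/funext => w; rewrite mulN1r.
have := @ae0_of_cintervals R h setT openT.
move=> H; apply: (ae_imp (H _ _)) => [a b|a b ab _|w].
- by rewrite E; apply: cintegrableD => //; exact: cintegrableZ.
- rewrite E cintegralD //; last exact: cintegrableZ.
  rewrite cintegralZ // (fourier_clos c ab) (fourier_itv a b xI).2 ip_conj_hat.
  by rewrite mulN1r subrr.
- by move=> /(_ Logic.I) /eqP; rewrite /h subr_eq0 => /eqP.
Qed.

(** The integral over [0, N] is w Phi, where w is the spectral counterpart of the truncation of psi.
    The isometry makes the squared distance from w Phi to v Phi equal to 2 pi times that from psi to
    its truncation, which tends to 0. *)
Lemma is_fourier_clos (psi : R -> R[i]) (v : fR) : L2 (leb R) halfline psi ->
  clos (hprod HL HF) span_XV (cut (halfline : set (measurableTypeR R)) psi, v) ->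
  is_fourier 1 psi (mulPhi v).
Proof.
move=> lpsi c; have [lx lv] := clos_dom c.
split=> //; first exact: mulPhi_L2.
(* Symmetric windows exhaust the line and meet [0, oo) in [0, N]. *)
pose D (N : nat) : set (measurableTypeR R) := `[- N%:R, N%:R]%classic.
have mD N : measurable (D N) by exact: measurable_itv.
have D_lty N : (leb R (D N) < +oo)%E.
  exact: itvcc_lty.
have hD x : exists N, forall k, (N <= k)%N -> D k x.
  exists (Num.truncn `|x : R|).+1 => k Nk.
  have h : `|x : R| <= k%:R.
    apply: (@le_trans _ _ (Num.truncn `|x : R|).+1%:R); last by rewrite ler_nat.
    by apply/ltW; exact: truncnS_gt.
  by move: h; rewrite ler_norml /D /= in_itv.
pose x0 := cut (halfline : set (measurableTypeR R)) psi.
have cv := truncation_cvg mD hD lx.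
suff E N : sqnorm (leb R) setT (fun x : R => mulPhi v x -
    cintegral (leb R) `[0, N%:R] (fun t : R => cexp (1 * x * t) * psi t)) =
    ((2 * pi)%:E * sqnorm (leb R) setT (fun x => (x0 x - cut (D N) x0 x)%R))%E.
  rewrite (funext E) -[X in _ --> X](mule0 (2 * pi)%:E).
  exact: cvgeZl.
pose xN : fR := cut (D N) x0.
have lxN : hdom HL xN by exact: L2_cutT.
have iN : cintegrable (leb R) setT xN.
  apply/(cintegrable_cut (leb R) (mD N)).
  exact: (L2_fin_cintegrable (mD N) (D_lty N) lx).
have [w cw] := Xf_clos lxN.
have [_ lw] := clos_dom cw.
have aeN := fourier_compact 0 cw iN.
have EN (x : R) : cintegral (leb R) setT (fun s : R => cexp (x * s) * xN s) =
    cintegral (leb R) `[0, N%:R] (fun t : R => cexp (1 * x * t) * psi t).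
  pose D0 : set (measurableTypeR R) := `[0, N%:R]%classic.
  rewrite [RHS](cintegral_cut (leb R) D0); apply: eq_cintegral => s _.
  rewrite /xN /x0 !cutP mul1r.
  have -> : (s \in D0) = (s \in D N) && (s \in (halfline : set (measurableTypeR R))).
    apply/idP/andP; rewrite !inE /D0 /D /halfline /= !in_itv /= ?andbT.
      move=> /andP[h1 h2]; split=> //; rewrite h2 andbT; apply: le_trans h1.
      by rewrite oppr_le0.
    by move=> [/andP[_ ->] ->].
  by case: (s \in D N); case: (s \in _) => //=; rewrite mulr0.
have mr : cmeasurable [set: measurableTypeR R] (mulPhi v) by case: (mulPhi_L2 lv).
have mw : cmeasurable [set: measurableTypeR R] (mulPhi w) by case: (mulPhi_L2 lw).
have cB := closB span_XV_dom c cw.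
have n0 := clos_isometry_nrm span_XV_dom span_XV_isometry cB.
have lvw : hdom HF (v - w) by exact: domB.
have lxx : hdom HL (x0 - xN) by exact: domB.
transitivity (sqnorm (leb R) setT (mulPhi (v - w))); last first.
  rewrite (nrm_sqnorm (mulPhi_L2 lvw)) (mulPhi_nrm lvw) (nrm_sqnorm lxx) EFinM.
  by congr (_ * _%:E)%E; rewrite n0 mul1r.
apply: sqnorm_ae.
- apply: cmeasB => //.
  have := fourier_meas iN; congr cmeasurable; exact/funext.
- by case: (mulPhi_L2 lvw).
- apply: (ae_imp aeN) => x hx; rewrite -EN -hx /mulPhi -mulrBl.
  by [].
Qed.

(** * The optimal estimate *)

Context (tau : R) (tau_gt0 : 0 < tau) (b : R -> R[i]) (Bxi : T -> R[i]).
Hypothesis b_int : cintegrable (leb R) halfline b.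
Hypothesis B_int : is_ms_integral P halfline b (fun t => incr n xi t tau) Bxi.

Let mH : measurable (halfline : set (measurableTypeR R)). Proof. exact: measurable_itv. Qed.

Let b0 : fR := cut (halfline : set (measurableTypeR R)) b.

Let b0I : cintegrable (leb R) setT b0. Proof. exact/(cintegrable_cut (leb R) mH). Qed.

Let mb0 : cmeasurable [set: measurableTypeR R] b0. Proof. by case: b0I. Qed.

Lemma B_L2 : hdom HP Bxi. Proof. by case: B_int. Qed.

Lemma B_ip Y : hdom HP Y ->
  hip HP Bxi Y = cintegral (leb R) halfline (fun t : R => b t * hip HP (Wf t tau) Y).
Proof. by move=> lY; have [_ h] := B_int; have [_ h2] := h Y lY; exact: h2. Qed.

Lemma B_ip0 Y : hdom HP Y -> (forall t, hip HP (Wf t tau) Y = 0) -> hip HP Bxi Y = 0.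
Proof.
move=> lY h; rewrite B_ip // -[RHS](@cintegral0 _ _ _ (leb R) halfline).
by apply: eq_cintegral => t _; rewrite h mulr0.
Qed.

(** The residual of the projection of [Bxi] on the closed span is orthogonal to every xi^(n)(t,
    tau), hence to [Bxi] by the definition of the weak integral, hence to itself. *)
Lemma B_in_W : clos HP span_W Bxi.
Proof.
have [q cq hq] := projection span_W_dom B_L2.
have lq := clos_dom cq; have lB := domB B_L2 lq.
have n0 : nrm HP ((Bxi : fT) - q) = 0.
  suff e0 : hip HP ((Bxi : fT) - q) ((Bxi : fT) - q) = 0 by rewrite /nrm e0.
  rewrite (ipBl B_L2 lq lB) (ipC lB lq) (hq _ cq) conjc0 subr0.
  apply: (B_ip0 lB) => t; rewrite (ipC lB (Wf_L2 t tau_gt0)).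
  have -> : hip HP ((Bxi : fT) - q) (Wf t tau) = 0; last exact: conjc0.
  by apply: hq; apply: (clos_sub span_W_dom); exists t, tau.
by apply: (clos_limit span_W_dom B_L2) => e e0; exists q => //; rewrite n0.
Qed.

Lemma fourier_L1_cut (x : R) :
  fourier_L1 b x = cintegral (leb R) setT (fun t : R => cexp (x * t) * b0 t).
Proof.
rewrite /fourier_L1 cintegral_cut; apply: eq_cintegral => t _.
by rewrite /b0 !cutP; case: ifP; rewrite ?mulr0.
Qed.

Lemma fourier_L1_meas : cmeasurable [set: measurableTypeR R] (fourier_L1 b).
Proof. by have := fourier_meas b0I; congr cmeasurable; apply/funext => x; rewrite fourier_L1_cut. Qed.

Let exp_b0_int (x : R) : cintegrable (leb R) setT (fun t : R => cexp (x * t) * b0 t).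
Proof.
have mexp : cmeasurable [set: measurableTypeR R] (fun t : R => cexp (x * t)).
  by apply: cmeas_cexp; apply: measurable_funM => //; exact: measurable_cst.
have [m h] := b0I; split; first exact: cmeasM.
by under eq_integral do rewrite ComplexField.Normc.normcM cmod_cexp mul1r.
Qed.

Let beta : R := fine (\int[leb R]_t (cmod (b0 t))%:E)%E.

Let betaE : (\int[leb R]_t (cmod (b0 t))%:E)%E = beta%:E.
Proof.
have [_ h] := b0I; rewrite /beta fineK // ge0_fin_numE //.
by apply: integral_ge0 => t _; rewrite lee_fin cmod_ge0.
Qed.

Let beta_ge0 : 0 <= beta.
Proof. by rewrite /beta fine_ge0 //; apply: integral_ge0 => t _; rewrite lee_fin cmod_ge0. Qed.

(** The factor 2 comes from bounding real and imaginary parts separately by [beta], the L_1 norm of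
    b. *)
Lemma fourier_L1_bound (x : R) : cmod (fourier_L1 b x) ^+ 2 <= 2 * beta ^+ 2.
Proof.
have mT : measurable [set: measurableTypeR R] := measurableT.
pose g (t : R) := cexp (x * t) * b0 t.
have [gm _] := exp_b0_int x.
have Ib : (leb R).-integrable setT (EFin \o (fun t : R => cmod (b0 t))).
  apply/integrableP; split; first by apply/measurable_EFinP; exact: meas_cmod.
  by under eq_integral do rewrite /= ger0_norm ?cmod_ge0 //; case: b0I.
have key (k : R -> R) : (leb R).-integrable setT (EFin \o k) ->
    (forall t, `|k t| <= cmod (b0 t)) -> (\int[leb R]_t k t)%R ^+ 2 <= beta ^+ 2.
  move=> kI kb; rewrite -[leLHS]real_normK ?num_real // lerXn2r ?nnegrE //.
  apply: le_trans (le_normr_Rintegral mT kI) _.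
  exact: (le_Rintegral mT (integrable_norm kI) Ib (fun t _ => kb t)).
have [I1 I2] := (cintegrableP (leb R) mT g).1 (exp_b0_int x).
have gb t : cmod (g t) = cmod (b0 t).
  by rewrite /g ComplexField.Normc.normcM cmod_cexp mul1r.
rewrite fourier_L1_cut cmodE mulr2n mulrDl mul1r lerD //; apply: key => // t.
- by rewrite -gb abs_Re.
- by rewrite -gb abs_Im.
Qed.

(** A_tau chi_tau, which will represent [Bxi] in the spectral domain. *)
Definition fourier_chi : fR := fun x => fourier_L1 b x * chi n tau x.

Lemma chi_L2 : hdom HF (chi n tau).
Proof.
have := Vf_L2 0 tau_gt0; congr hdom; apply/funext => x.
rewrite /Vf mul0r (_ : cexp 0 = 1) ?mul1r //.
by apply: ReImP; rewrite /= ?cos0 ?sin0.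
Qed.

Lemma fourier_chi_L2 : hdom HF fourier_chi.
Proof.
have [mc cI] := chi_L2.
split; first exact: (cmeasM fourier_L1_meas mc).
have c0 : (0%:E <= (2 * beta ^+ 2)%:E)%E by rewrite lee_fin mulr_ge0 // sqr_ge0.
apply: (@le_lt_trans _ _ ((2 * beta ^+ 2)%:E * sqnorm F setT (chi n tau))%E).
  rewrite -ge0_integralZl //; last 2 first.
  - by apply/measurable_EFinP; exact: meas_cmod2.
  - by move=> x _; rewrite lee_fin sqr_ge0.
  apply: ge0_le_integral => //.
  - by move=> x _; rewrite lee_fin sqr_ge0.
  - apply/measurable_EFinP; apply: meas_cmod2.
    exact: (cmeasM fourier_L1_meas mc).
  - apply: emeasurable_funM; first exact: measurable_cst.
    by apply/measurable_EFinP; exact: meas_cmod2.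
  - move=> x _; rewrite -EFinM lee_fin /fourier_chi ComplexField.Normc.normcM exprMn.
    by rewrite ler_wpM2r ?sqr_ge0 // fourier_L1_bound.
by apply: lte_mul_pinfty.
Qed.

(** The spectral analogue of [B_ip], by Fubini for the product of F and Lebesgue measure: the
    exponential has modulus 1, and both b and chi_tau times the conjugate of y are integrable. *)
Lemma fourier_chi_ip (y : fR) : hdom HF y ->
  hip HF fourier_chi y = cintegral (leb R) halfline (fun t : R => b t * hip HF (Vf t tau) y).
Proof.
move=> ly; have [mc cI] := chi_L2; have my : cmeasurable [set: measurableTypeR R] y by case: ly.
pose g : fR := fun x => chi n tau x * (y x)^*%C.
have gI : cintegrable F setT g := L2_mul chi_L2 ly.
have mg : cmeasurable [set: measurableTypeR R] g by case: gI.
pose K (x t : R) : R[i] := b0 t * (cexp (t * x) * g x).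
have mK : cmeasurable [set: measurableTypeR R * measurableTypeR R] (fun z => K z.1 z.2).
  have [m1 m2] := mb0; have [g1 g2] := mg.
  apply: cmeasM.
    by split; [exact: (measurableT_comp m1)|exact: (measurableT_comp m2)].
  apply: cmeasM; first by apply: cmeas_cexp; exact: measurable_funM.
  by split; [exact: (measurableT_comp g1)|exact: (measurableT_comp g2)].
have IK : (\int[F]_x \int[leb R]_t (cmod (K x t))%:E < +oo)%E.
  have -> : (\int[F]_x \int[leb R]_t (cmod (K x t))%:E = \int[F]_x ((cmod (g x))%:E * beta%:E))%E.
    apply: eq_integral => x _; rewrite -betaE -ge0_integralZl //.
    - by apply: eq_integral => t _; rewrite /K !ComplexField.Normc.normcM cmod_cexp mul1r -EFinM mulrC.
    - by apply/measurable_EFinP; exact: meas_cmod.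
    - by move=> t _; rewrite lee_fin cmod_ge0.
    - by rewrite lee_fin cmod_ge0.
  rewrite ge0_integralZr ?lee_fin //; last 2 first.
  - by apply/measurable_EFinP; exact: meas_cmod.
  - by move=> x _; rewrite lee_fin cmod_ge0.
  rewrite muleC; apply: lte_mul_pinfty => //; last by case: gI.
have L x : fourier_chi x * (y x)^*%C = cintegral (leb R) setT (K x).
  rewrite /fourier_chi fourier_L1_cut.
  transitivity (g x * cintegral (leb R) setT (fun t : R => cexp (x * t) * b0 t)).
    by rewrite /g; ring.
  rewrite -cintegralZ //; apply: eq_cintegral => t _; rewrite /K (mulrC t x); ring.
have RR : (fun t : R => b0 t * hip HF (Vf t tau) y) = (fun t => cintegral F setT (fun x => K x t)).
  apply/funext => t.
  have cZ := @cintegralZ R _ (measurableTypeR R) F setT measurableT (b0 t) _ (L2_mul (Vf_L2 t tau_gt0) ly).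
  apply: etrans (esym cZ) _; apply: eq_cintegral => x _.
  by rewrite /K /g /Vf; ring.
transitivity (cintegral F setT (fun x => cintegral (leb R) setT (K x))).
  by apply: eq_cintegral => x _; exact: L.
rewrite (cfubini mK IK) -RR [RHS]cintegral_cut; apply: eq_cintegral => t _.
by rewrite /b0 !cutP; case: ifP; rewrite ?mul0r.
Qed.

(** By [B_ip] and [fourier_chi_ip], v and [fourier_chi] have the same inner products with all
    generators. Their difference is thus orthogonal to v, which lies in the closed span of the
    generators, and to [fourier_chi], by [fourier_chi_ip] again; so it is null. *)
Lemma B_spectral v x : clos HWVX span_WVX (Bxi, (v, x)) ->
  {ae F, forall w, v w = fourier_chi w}.
Proof.
move=> c; have lv : hdom HF v by case: (clos_dom c) => _ [].
have lA := fourier_chi_L2; have lvA := domB lv lA.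
apply: nrmB_ae => //.
have V0 t s : 0 < s -> hip HF (Vf t s) (v - fourier_chi) = 0.
  move=> s0; have lV := Vf_L2 t s0.
  have cV : clos HWVX span_WVX (Wf t s, (Vf t s, Xf t s)).
    by apply: (clos_sub span_WVX_dom); exists t, s.
  have e1 : hip HF v (Vf t s) = hip HF fourier_chi (Vf t s).
    rewrite fourier_chi_ip // -(WVX_ip_V c cV) B_ip; last exact: Wf_L2.
    by apply: eq_cintegral => u _; rewrite ip_Vf.
  by rewrite (ipBr lv lA lV) (ipC lv lV) (ipC lA lV) e1 subrr.
suff e0 : hip HF (v - fourier_chi) (v - fourier_chi) = 0 by rewrite /nrm e0.
rewrite (ipBl lv lA lvA).
have -> : hip HF fourier_chi (v - fourier_chi) = 0.
  rewrite fourier_chi_ip // -[RHS](@cintegral0 _ _ _ (leb R) halfline).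
  by apply: eq_cintegral => t _; rewrite V0 // mulr0.
rewrite subr0.
have SD : snd @` span_XV `<=` hdom HF by move=> _ [_ [t [s [s0 ->]]] <-]; exact: Vf_L2.
apply: (orth_clos lvA SD); first by move=> _ [_ [t [s [s0 ->]]] <-]; exact: V0.
apply: (@clos_image _ _ _ (hprod HL HF) HF snd 1 span_XV (snd @` span_XV) span_XV_dom SD
  _ _ _ _ _ _ (WVX_clos_XV c)).
- by move=> p [].
- by [].
- by [].
- by move=> p [? ?]; rewrite mul1r nrm_prod lerDr; exact: (@nrm_ge0 _ _ HL).
- by move=> p Sp; apply: (clos_sub SD); exists p.
Qed.

Let phi0 : fR := cut (halfline : set (measurableTypeR R)) (phi_ tau).

Let mphi0 : cmeasurable [set: measurableTypeR R] phi0.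
Proof. by apply/(cmeas_cut mH); have [[] ] := cf_Phi_ f_fact tau_gt0. Qed.

Let Xf_phi0 (t s : R) : Xf t tau s = phi0 (t - s).
Proof.
rewrite /Xf /phi0 cutP.
have -> : (t - s \in (halfline : set (measurableTypeR R))) = (s <= t).
  by apply/idP/idP; rewrite inE /halfline /= in_itv /= andbT subr_ge0.
by [].
Qed.

(* Represents [Bxi] in the time domain. *)
Definition smoothing : fR := fun s => cintegral (leb R) setT (fun t : R => b0 t * Xf t tau s).

Lemma smoothing_itv (u v : R) : u <= v ->
  cintegrable (leb R) `]u, v] smoothing /\
  cintegral (leb R) `]u, v] smoothing =
  cintegral (leb R) halfline
    (fun t : R => b t * hip HL (Xf t tau) (fun s : R => (\1_(`]u, v]%classic) s : R)%:C%C)).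
Proof.
move=> uv.
pose I : set (measurableTypeR R) := `]u, v]%classic.
have mI : measurable I by exact: measurable_itv.
have I_lty : (leb R I < +oo)%E by exact: itv_lty.
pose K (t s : R) : R[i] := b0 t * cut I (Xf t tau) s.
have mK : cmeasurable [set: measurableTypeR R * measurableTypeR R] (fun z => K z.1 z.2).
  have [m1 m2] := mb0; have [p1 p2] := mphi0.
  have msub : measurable_fun [set: measurableTypeR R * measurableTypeR R]
      (fun z : measurableTypeR R * measurableTypeR R => (z.1 - z.2 : R) : measurableTypeR R).
    exact: measurable_funB.
  apply: cmeasM.
    by split; [exact: (measurableT_comp m1)|exact: (measurableT_comp m2)].
  apply: cmeasM.
    by apply: cmeas_real; apply: (@measurableT_comp _ _ _ _ _ _ (\1_I : _ -> R) _ snd).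
  have -> : (fun z : measurableTypeR R * measurableTypeR R => Xf z.1 tau z.2) =
            (fun z => phi0 (z.1 - z.2)).
    by apply/funext => z; rewrite Xf_phi0.
  by split; [exact: (measurableT_comp p1)|exact: (measurableT_comp p2)].
(* Bounds the integral over I of |Xf t tau| uniformly in t: pointwise |z| <= 1 + |z|^2, and the norm
   of [Xf t tau] is that of [Vf t tau], which is independent of t because |e^{itx}| = 1. *)
pose C : R := fine (leb R I) + nrm HF (Vf 0 tau).
have nX t : nrm HL (Xf t tau) = nrm HF (Vf 0 tau).
  have -> : nrm HL (Xf t tau) = nrm HF (Vf t tau).
    by rewrite /nrm -ip_Xf // ip_Vf.
  have l1 := Vf_L2 t tau_gt0; have l2 := Vf_L2 0 tau_gt0.
  apply/EFin_inj; rewrite -(nrm_sqnorm l1) -(nrm_sqnorm l2).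
  by apply: eq_integral => x _; rewrite /Vf !ComplexField.Normc.normcM !cmod_cexp.
have bnd t : (\int[leb R]_s (cmod (cut I (Xf t tau) s))%:E <= C%:E)%E.
  have lX := Xf_L2 t tau_gt0; have [mX _] := lX.
  have mc : cmeasurable [set: measurableTypeR R] (cut I (Xf t tau)).
    by apply: cmeasM => //; apply: cmeas_real; exact: measurable_indic.
  apply: (@le_trans _ _ (\int[leb R]_s ((\1_I s : R)%:E + (cmod (Xf t tau s) ^+ 2)%:E))%E).
    apply: ge0_le_integral => //.
    - by move=> s _; rewrite lee_fin cmod_ge0.
    - by apply/measurable_EFinP; exact: meas_cmod.
    - apply: emeasurable_funD; apply/measurable_EFinP; first exact: measurable_indic.
      exact: meas_cmod2.
    - move=> s _; rewrite -EFinD lee_fin cutP indicE.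
      have q0 : 0 <= cmod (Xf t tau s) ^+ 2 by exact: sqr_ge0.
      have q1 : 0 <= (cmod (Xf t tau s) - 1) ^+ 2 by exact: sqr_ge0.
      have q2 := cmod_ge0 (Xf t tau s).
      case: ifP => _; last by rewrite ComplexField.Normc.normc0 addr_ge0.
      move: q1 q2 {q0}; rewrite sqrrB expr1n mulr1.
      by move: (cmod _) => z; rewrite mulr2n mulr1n; lra.
  rewrite ge0_integralD //; last 3 first.
  - by apply/measurable_EFinP; exact: measurable_indic.
  - by move=> s _; rewrite lee_fin sqr_ge0.
  - by apply/measurable_EFinP; exact: meas_cmod2.
  rewrite integral_indic // setIT.
  have -> : (\int[leb R]_s (cmod (Xf t tau s) ^+ 2)%:E)%E = (nrm HL (Xf t tau))%:E.
    exact: (nrm_sqnorm lX).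
  have fI : (fine (leb R I))%:E = leb R I by apply: fineK; rewrite ge0_fin_numE.
  have -> : C%:E = (leb R I + (nrm HF (Vf 0 tau))%:E)%E by rewrite /C EFinD fI.
  by rewrite nX.
have IK : (\int[leb R]_t \int[leb R]_s (cmod (K t s))%:E < +oo)%E.
  have C0 : (0%:E <= C%:E)%E.
    rewrite lee_fin; apply: addr_ge0; first exact: fine_ge0.
    exact: (nrm_ge0 (Vf_L2 0 tau_gt0)).
  apply: (@le_lt_trans _ _ (\int[leb R]_t ((cmod (b0 t))%:E * C%:E))%E).
    apply: ge0_le_integral => //.
    - by move=> t _; apply: integral_ge0 => s _; rewrite lee_fin cmod_ge0.
    - apply: (@measurable_fun_fubini_tonelli_F _ _ _ _ _ (leb R) (fun z => (cmod (K z.1 z.2))%:E)%E).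
        by apply/measurable_EFinP; exact: meas_cmod.
      by move=> z; rewrite lee_fin cmod_ge0.
    - apply: emeasurable_funM; last exact: measurable_cst.
      by apply/measurable_EFinP; exact: meas_cmod.
    - move=> t _.
      have mc : cmeasurable [set: measurableTypeR R] (cut I (Xf t tau)).
        by apply: cmeasM; [apply: cmeas_real; exact: measurable_indic|case: (Xf_L2 t tau_gt0)].
      have -> : (\int[leb R]_s (cmod (K t s))%:E =
          (cmod (b0 t))%:E * \int[leb R]_s (cmod (cut I (Xf t tau) s))%:E)%E.
        rewrite -ge0_integralZl ?lee_fin ?cmod_ge0 //.
        - by apply: eq_integral => s _; rewrite /K ComplexField.Normc.normcM.
        - by apply/measurable_EFinP; exact: meas_cmod.
        - by move=> s _; rewrite lee_fin cmod_ge0.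
      by apply: lee_wpmul2l; rewrite ?lee_fin ?cmod_ge0.
  rewrite ge0_integralZr //; last 2 first.
  - by apply/measurable_EFinP; exact: meas_cmod.
  - by move=> t _; rewrite lee_fin cmod_ge0.
  by rewrite betaE -EFinM ltry.
have inner_s : (fun s => cintegral (leb R) setT (fun t => K t s)) = cut I smoothing.
  apply/funext => s; rewrite cutP /smoothing; case: ifPn => sI.
    by apply: eq_cintegral => t _; rewrite /K cutP sI.
  rewrite -[RHS](@cintegral0 _ _ _ (leb R) setT); apply: eq_cintegral => t _.
  by rewrite /K cutP (negbTE sI) mulr0.
split.
  apply/(cintegrable_cut (leb R) mI).
  by have := cfubini_integrable2 mK IK; rewrite inner_s.
rewrite (cintegral_cut (leb R) I) -inner_s -(cfubini mK IK) [RHS]cintegral_cut.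
apply: eq_cintegral => t _.
have cI : cintegrable (leb R) setT (cut I (Xf t tau)).
  apply/(cintegrable_cut (leb R) mI).
  exact: (L2_fin_cintegrable mI I_lty (Xf_L2 t tau_gt0)).
rewrite /K cintegralZ // -(cintegral_cut (leb R) I) -ip_itv /b0 !cutP.
by case: ifP; rewrite ?mul0r.
Qed.

(** With t = s + u, the cut of phi_tau restricts to u >= 0, and for such u and s >= 0 the cut of b
    at 0 has no effect. *)
Lemma smoothing_opA (s : R) : 0 <= s -> smoothing s = opA b (phi_ tau) s.
Proof.
move=> s0.
have mK : cmeasurable [set: measurableTypeR R] (fun t => b0 t * Xf t tau s).
  apply: cmeasM => //.
  have -> : (fun t => Xf t tau s) = (fun t => phi0 (- s + t)).
    by apply/funext => t; rewrite Xf_phi0 addrC.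
  exact: (cmeas_comp (meas_addl (- s)) mphi0).
rewrite /smoothing (cintegral_change (meas_addl s) (leb_translate s) mK) /opA [RHS]cintegral_cut.
apply: eq_cintegral => u _; rewrite Xf_phi0.
have -> : s + u - s = u by rewrite addrC addrA addNr add0r.
rewrite /phi0 !cutP; case: ifPn => uH; last by rewrite mulr0.
rewrite /b0 cutP ifT //; move: uH; rewrite !inE /halfline /= !in_itv /= !andbT.
exact: addr_ge0.
Qed.

Let psi := opA b (phi_ tau).
Let psi0 : fR := cut (halfline : set (measurableTypeR R)) psi.

Let psi0_meas : cmeasurable [set: measurableTypeR R] psi0.
Proof.
have mG : cmeasurable [set: measurableTypeR R] smoothing.
  apply: cmeas_itv_cover => k.
  have kk : - k%:R <= k%:R :> R by rewrite (@le_trans _ _ 0) ?oppr_le0.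
  by have [[]] := smoothing_itv kk.
have -> : psi0 = cut (halfline : set (measurableTypeR R)) smoothing.
  apply/funext => s; rewrite /psi0 !cutP; case: ifPn => //.
  by rewrite inE /halfline /= in_itv /= andbT => s0; rewrite smoothing_opA.
by apply: cmeasM => //; apply: cmeas_real; exact: measurable_indic.
Qed.

(** On each open half-line, x is determined by its integrals over intervals, that is, by the inner
    products of the error with the increments of eta. *)
Lemma innovation (Bhat : fT) (v x : fR) : clos HP span_before Bhat ->
  (forall w, clos HP span_before w -> hip HP ((Bxi : fT) - Bhat) w = 0) ->
  clos HWVX span_WVX ((Bxi : fT) - Bhat, (v, x)) ->
  {ae leb R, forall s, x s = psi0 s}.
Proof.
move=> cB orth c; have lx : hdom HL x by case: (clos_dom c) => _ [].
have lB := B_L2; have lBh := clos_dom cB.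
pose ind (u w : R) : fR := fun s : R => (\1_(`]u, w]%classic) s : R)%:C%C.
have ipE u w : u <= w ->
    cintegral (leb R) `]u, w] x = hip HP ((Bxi : fT) - Bhat) ((eta w : fT) - eta u).
  move=> uw; rewrite -ip_itv.
  have cI : clos (hprod HL HP) (span_eta eta) (ind u w, (eta w : fT) - eta u).
    by apply: (clos_sub (span_eta_dom eta_orth)); exists u, w.
  rewrite (clos_isometry (span_eta_dom eta_orth) (span_eta_isometry eta_orth) (WVX_clos_X c) cI).
  by rewrite mul1r.
have mI u w : measurable (`]u, w]%classic : set (measurableTypeR R)) by exact: measurable_itv.
have xI u w : cintegrable (leb R) `]u, w] x.
  exact: (L2_fin_cintegrable (mI u w) (itv_lty u w) lx).
have neg : {ae leb R, forall s, s < 0 -> x s = 0}.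
  have oN : open [set s : R | s < 0] by exact: open_lt.
  apply: (@ae0_of_cintervals R x [set s | s < 0] oN) => //.
  move=> u w; rewrite le_eqVlt => /orP[/eqP <- _|uw sub].
    by rewrite (ipE u u (lexx u)) subrr (ip0r (domB lB lBh)).
  (* The interval contains its right end w, so the increment of eta ends strictly before 0 and
     belongs to the observed space. *)
  have w0 : w < 0 by apply: (sub w); rewrite /= in_itv /= uw lexx.
  rewrite (ipE u w (ltW uw)); apply: orth; apply: (clos_upto_before w0).
  exact: (inc_upto (ltW uw)).
have pos : {ae leb R, forall s, 0 < s -> x s - smoothing s = 0}.
  have E : (fun s => x s - smoothing s) = fun s => x s + (-1) * smoothing s.
    by apply/funext => s; rewrite mulN1r.
  have gI u w : u <= w -> cintegrable (leb R) `]u, w] (fun s => (-1) * smoothing s).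
    by move=> uw; apply: (cintegrableZ (mI u w)); case: (smoothing_itv uw).
  have oP : open [set s : R | 0 < s] by exact: open_gt.
  apply: (@ae0_of_cintervals R (fun s => x s - smoothing s) [set s | 0 < s] oP).
  - move=> u w; have [uw|wu] := leP u w.
      by rewrite E; exact: (cintegrableD (mI u w) (xI u w) (gI u w uw)).
    have -> : `]u, w]%classic = set0 :> set R by rewrite set_itv_ge // bnd_simp -leNgt ltW.
    split; first by split; exact: measurable_fun_set0.
    by rewrite integral_set0 ltry.
  - move=> u w; rewrite le_eqVlt => /orP[/eqP <- _|uw sub].
      apply: ReImP; rewrite /= set_itv_ge ?Rintegral_set0 //; by rewrite bnd_simp ltxx.
    (* Otherwise min 0 w would be a point of ]u, w] that is not positive. *)
    have u0 : 0 <= u.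
      rewrite leNgt; apply/negP => u0.
      pose m := Num.min 0 w.
      have := sub m; rewrite /= in_itv /= => h.
      have : 0 < m by apply: h; rewrite lt_min u0 uw ge_min lexx orbT.
      by rewrite lt_min ltxx.
    rewrite E (cintegralD (mI u w) (xI u w) (gI u w (ltW uw))).
    have [sI sE] := smoothing_itv (ltW uw).
    rewrite (cintegralZ (mI u w)) // sE (ipE u w (ltW uw)).
    have lD := increment_L2 eta_orth u w.
    rewrite (ipBl lB lBh lD).
    (* [Bhat] lies in H^0(eta), which is spanned by increments ending at or before 0 <= u. *)
    have -> : hip HP Bhat ((eta w : fT) - eta u) = 0.
      have := clos_before_upto cB; rewrite clos_upto_inc.
      apply: (orth_clos lD (@span_inc_dom 0)) => _ [p [q [pq q0 ->]]].
      exact: (increment_orth eta_orth pq (le_trans q0 u0) (ltW uw)).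
    rewrite subr0 B_ip // mulN1r; apply/eqP; rewrite subr_eq0; apply/eqP.
    apply: eq_cintegral => t _; congr (_ * _).
    have cI : clos (hprod HL HP) (span_eta eta) (ind u w, (eta w : fT) - eta u).
      by apply: (clos_sub (span_eta_dom eta_orth)); exists u, w; split; [exact: ltW|].
    rewrite (clos_isometry (span_eta_dom eta_orth) (span_eta_isometry eta_orth) (clos_Xf t tau_gt0) cI).
    by rewrite mul1r.
(* [neg] and [pos] concern open half-lines; the remaining point is null. *)
have zero : {ae leb R, forall s : R, s != 0}.
  exists [set 0 : measurableTypeR R]; split => //.
  - exact: lebesgue_measure_set1.
  - by move=> s /= /negP; rewrite negbK => /eqP.
apply: (ae_imp (ae_and (ae_and neg pos) zero)) => s [[h1 h2] s0].
rewrite /psi0 cutP; case: ifPn; rewrite ?inE ?notin_setE /halfline /= in_itv /= andbT.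
  move=> sp; have sp' : 0 < s by rewrite lt_neqAle eq_sym s0.
  by rewrite /psi -(smoothing_opA sp); move/eqP: (h2 sp'); rewrite subr_eq0 => /eqP.
by move=> /negP; rewrite -ltNge; exact: h1.
Qed.

(** The mean square error is the squared norm of one element seen in three spaces: L_2(Omega),
    L_2(F), where multiplication by Phi yields r, and L_2(R), where it is D^tau A phi_tau. *)
Lemma estimate : exists (r : R -> R[i]) (Bhat : T -> R[i]),
  [/\ is_fourier 1 (opA b (phi_ tau)) r,
      is_Z_integral P F Z
        (fun x => (fourier_L1 b x - r x * (Phi_ tau x)^-1) * chi n tau x) Bhat,
      is_projection P (H_obs P n xi) Bxi Bhat,
      sqnorm P setT (fun w => Bxi w - Bhat w) =
        ((2 * pi)^-1%:E * sqnorm (leb R) setT r)%E &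
      ((2 * pi)^-1%:E * sqnorm (leb R) setT r)%E =
        sqnorm (leb R) halfline (opA b (phi_ tau))].
Proof.
have [Bhat cB orth] := projection span_before_dom B_L2.
have [v1 [x1 c1]] := WVX_extension B_in_W.
have [v2 [x2 c2]] := WVX_extension (clos_before_W cB).
have c : clos HWVX span_WVX ((Bxi : fT) - Bhat, (v1 - v2, x1 - x2)).
  exact: (closB span_WVX_dom c1 c2).
have lM : hdom HP ((Bxi : fT) - Bhat) by case: (clos_dom c).
have lv : hdom HF (v1 - v2) by case: (clos_dom c) => _ [].
have lx : hdom HL (x1 - x2) by case: (clos_dom c) => _ [].
have xE := innovation cB orth c.
have lpsi0 : hdom HL psi0 by exact: (L2_ae lx psi0_meas xE).
have lpsi : L2 (leb R) halfline psi by exact/(L2_cut (leb R) mH).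
have cpsi : clos (hprod HL HF) span_XV (psi0, v1 - v2).
  exact: (ae_clos span_XV_dom (WVX_clos_XV c) lpsi0 xE).
have four := is_fourier_clos lpsi cpsi.
have nV : nrm HP ((Bxi : fT) - Bhat) = nrm HF (v1 - v2).
  by rewrite /nrm (WVX_ip_V c c).
have nX : nrm HP ((Bxi : fT) - Bhat) = nrm HL (x1 - x2).
  by rewrite /nrm (WVX_ip_X c c).
have pi2 (v : fR) (lv' : hdom HF v) :
    ((2 * pi)^-1%:E * sqnorm (leb R) setT (mulPhi v))%E = (nrm HF v)%:E.
  rewrite (nrm_sqnorm (mulPhi_L2 lv')) (mulPhi_nrm lv') -EFinM mulrA mulVf ?mul1r //.
  by rewrite gt_eqF // two_pi_gt0.
exists (mulPhi (v1 - v2)), Bhat; split; first exact: four.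
- have lv2 : hdom HF v2 by case: (clos_dom c2) => _ [].
  have mPhi_tau : cmeasurable [set: measurableTypeR R] (Phi_ tau).
    by have [_ []] := cf_Phi_ f_fact tau_gt0.
  (* Where neither Phi nor chi_tau vanishes, (v1 - v2) Phi / (chi_tau Phi) times chi_tau is v1 - v2;
     subtracting it from v1 = A_tau chi_tau leaves v2. *)
  have vE : {ae F, forall x, v2 x =
      (fourier_L1 b x - mulPhi (v1 - v2 : fR)%R x * (Phi_ tau x)^-1) * chi n tau x}.
    have a1 := density_ae F_dens (cf_chi f_fact tau_gt0).
    have a2 := density_ae F_dens (chi_neq0 n tau_gt0).
    apply: (ae_imp (ae_and (ae_and (B_spectral c1) (density_Phi_neq0 F_dens mPhi fPhi))
      (ae_and a1 a2))) => x [[h1 h2] [h3 h4]].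
    have h1' : v1 x = fourier_L1 b x * chi n tau x := h1.
    rewrite h3 /mulPhi.
    have -> : (v1 - v2) x = v1 x - v2 x by [].
    rewrite h1'; move: (fourier_L1 b x) (chi n tau x) (Phi x) (v2 x) h2 h4 => p q u w.
    by move=> u0 q0; field; rewrite u0 q0.
  apply/(is_Z_integralE _ _ span_Z_dom).
  have mr : cmeasurable [set: measurableTypeR R] (mulPhi (v1 - v2)).
    by have [] := mulPhi_L2 lv.
  apply: (ae_clos span_Z_dom (WVX_clos_V c2) _ vE).
  apply: (L2_ae lv2 _ vE); apply: cmeasM; last by case: chi_L2.
  by apply: cmeasB; [exact: fourier_L1_meas|apply: cmeasM => //; exact: cmeasV].
- by rewrite H_obsE; split; [exact: cB|exact: orth].
- by rewrite (pi2 _ lv) -nV; exact: (nrm_sqnorm lM).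
- rewrite (pi2 _ lv) -nV nX -(nrm_sqnorm lx) (sqnorm_cut (leb R) halfline).
  by apply: sqnorm_ae; [case: lx|exact: psi0_meas|exact: xE].
Qed.

End Setup.

Theorem theorem5 (R : realType) (d : measure_display) (T : measurableType d)
    (P : probability T R) (n : nat) (tau : R) (xi : R -> T -> R[i])
    (F : {finite_measure set (measurableTypeR R) -> \bar R})
    (Z : set R -> T -> R[i]) (f : R -> R)
    (eta : R -> T -> R[i]) (phi_ : R -> R -> R[i]) (phi : R -> R[i])
    (Phi_ : R -> R -> R[i]) (Phi : R -> R[i])
    (a : R -> R[i]) (Bxi Vxi : T -> R[i])
    (n_ge1 : (1 <= n)%N) (tau_gt0 : 0 < tau)
    (xi_L2 : forall t, L2 P setT (xi t))
    (xi_stat : stationary_increments P n xi)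
    (xi_mean : forall t s, 0 < s -> cE P (incr n xi t s) = 0)
    (xi_spec : spectral_representation P n xi F Z)
    (F_dens : spectral_density F f)
    (f_fact : canonical_factorization P n xi f eta phi_ phi Phi_ Phi)
    (a_cvg : {ae leb R, forall t : R, 0 <= t -> Dconverges n tau a t})
    (a_int : cintegrable (leb R) halfline (Dop n tau a))
    (a_tint : (\int[leb R]_(t in halfline)
                 (t * cmod (Dop n tau a t) ^+ 2)%:E < +oo)%E)
    (B_int : is_ms_integral P halfline (Dop n tau a)
               (fun t => incr n xi t tau) Bxi)
    (V_int : is_ms_integral P `[- (tau * n%:R), 0[%classic
               (vfun n tau (Dop n tau a)) xi Vxi) :
  let b := Dop n tau a in
  let psi := opA b (phi_ tau) in
  let Axi := fun w => Bxi w - Vxi w in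
  exists (r : R -> R[i]) (J : T -> R[i]),
    let h := fun x => fourier_L1 b x - r x * (Phi_ tau x)^-1 in
    let Ahat := fun w => - Vxi w + J w in
    [/\ is_fourier 1 psi r,
        is_Z_integral P F Z (fun x => h x * chi n tau x) J,
        is_optimal_estimate P n xi Bxi Vxi Ahat,
        sqnorm P setT (fun w => Axi w - Ahat w)
          = ((2 * pi)^-1%:E * sqnorm (leb R) setT r)%E &
        ((2 * pi)^-1%:E * sqnorm (leb R) setT r)%E
          = sqnorm (leb R) halfline psi].
Proof.
move=> b psi Axi.
have [r [Bhat [h1 h2 h3 h4 h5]]] := estimate xi_spec F_dens f_fact tau_gt0 a_int B_int.
exists r, Bhat => h Ahat; split=> //.
- by exists Bhat; split=> //; apply/funext => w; rewrite /Ahat addrC.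
(* V xi cancels, so the error is that of the projection of B xi. *)
- rewrite -h4; congr sqnorm; apply/funext => w.
  by rewrite /Axi /Ahat opprD opprK addrA subrK.
Qed.
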